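(* The ring $E^*BV_w$ admits a finite filtration by ideals, whose quotients are finitely generated free modules over (graded) regular local rings of dimension $w$.
   Context: Fix a prime $p$ and integers $0\le m\le n$; put $w=n+1-m$. $BP^*$ is the largest quotient ring of $MU_{(p)}^*$ over which the standard formal group law becomes $p$-typical; $F$ denotes its formal group law and its images over $BP^*$-algebras, with $p$-series $[p](t)$. Fixed elements $v_k\in BP^{-2(p^k-1)}$ ($k\ge0$) are chosen with $v_0=p$ and $[p](t)\equiv v_kt^{p^k}\pmod{v_0,\ldots,v_{k-1},t^{p^k+1}}$ (for $p=2$, chosen so that the rings $BP^*/(v_i\mid i>n)$ are realised by commutative ring objects $BP\langle n\rangle$ in the derived category of strict $MU_{(p)}$-modules). $E=BP\langle m,n\rangle$ is the ring object in that derived category with homotopy ring $E^*=BP^*/(v_i\mid i<m\text{ or }i>n)$ (commutative for $p>2$, a central $BP\langle n\rangle$-algebra for $p=2$); thus $E^*=\mathbb{F}_p[v_m,\ldots,v_n]$ for $m>0$ and $\mathbb{Z}_{(p)}[v_1,\ldots,v_n]$ for $m=0$, with $|v_k|=-2(p^k-1)$. $V_w=\mathbb{F}_p^w$, and $E^*BV_w=E^*[\![x_0,\ldots,x_{w-1}]\!]/([p](x_0),\ldots,[p](x_{w-1}))$ (graded power series, $|x_i|=2$). Graded conventions: graded rings are commutative and concentrated in even degrees; only homogeneous elements are considered, and ideals and modules are graded. A graded ring is local if it has a unique maximal ideal, Noetherian if every ideal is generated by finitely many homogeneous elements, a domain if products of nonzero homogeneous elements are nonzero; an ideal is prime if the quotient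 is a domain; Krull dimension is the maximal length $d$ of a chain $P_0<\cdots<P_d$ of (graded) primes. A Noetherian graded local ring of Krull dimension $d$ is regular if its maximal ideal is generated by $d$ homogeneous elements. *)

(* Defs.v *)
From HB Require Import structures.
From mathcomp Require Import all_boot all_order all_algebra.
From mathcomp Require Import mpoly zify.
From mathcomp Require Import boolp classical_sets functions.

Set Implicit Arguments.
Unset Strict Implicit.
Unset Printing Implicit Defensive.

Import GRing.Theory.
Local Open Scope classical_set_scope.
Local Open Scope ring_scope.

(* A graded ring is a commutative ring [R] with subgroups [hom d] whose direct
   sum is [R]; the degrees are cohomological and only even ones occur. *)
Record is_grading (R : comPzRingType) (hom : int -> set R) : Prop := IsGrading {
  grading0 : forall d, hom d 0;
  gradingB : forall d x y, hom d x -> hom d y -> hom d (x - y);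
  grading1 : hom 0 1;
  gradingM : forall d e x y, hom d x -> hom e y -> hom (d + e) (x * y);
  grading_span : forall x, exists s : seq R,
    (forall y, y \in s -> exists d, hom d y) /\ x = \sum_(y <- s) y;
  grading_free : forall (s : seq int) (f : int -> R),
    uniq s -> (forall d, hom d (f d)) -> \sum_(d <- s) f d = 0 ->
    forall d, d \in s -> f d = 0;
  grading_even : forall d x, hom d x -> odd `|d|%N -> x = 0 }.

Record gradedRing := GradedRing {
  gcarrier :> comPzRingType;
  ghom : int -> set gcarrier;
  ghomP : is_grading ghom }.

Definition homogen (A : gradedRing) : set A := [set x | exists d, ghom d x].

Definition graded_map (A B : gradedRing) (f : A -> B) : Prop :=
  forall d x, ghom d x -> ghom d (f x).

Definition ideal_gen (R : comPzRingType) (J : set R) : set R :=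
  [set x | exists (r : nat) (a b : 'I_r -> R),
     (forall i, J (b i)) /\ x = \sum_(i < r) a i * b i].

Definition gideal (A : gradedRing) (I : set A) : Prop :=
  [/\ I 0,
      forall x y, I x -> I y -> I (x + y),
      forall a x, I x -> I (a * x)
    & forall x, I x -> exists s : seq A,
        (forall y, y \in s -> homogen y /\ I y) /\ x = \sum_(y <- s) y].

Definition gprime (A : gradedRing) (P : set A) : Prop :=
  [/\ gideal P, ~ P 1
    & forall a b, homogen a -> homogen b -> P (a * b) -> P a \/ P b].

Definition gmaximal (A : gradedRing) (M : set A) : Prop :=
  [/\ gideal M, ~ M 1
    & forall I, gideal I -> ~ I 1 -> M `<=` I -> I = M].

Definition fg_ideal (A : gradedRing) (r : nat) (I : set A) : Prop :=
  exists b : 'I_r -> A, (forall i, homogen (b i)) /\ I = ideal_gen (range b).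

Definition gnoetherian (A : gradedRing) : Prop :=
  forall I : set A, gideal I -> exists r, fg_ideal r I.

Definition prime_chain (A : gradedRing) (d : nat) : Prop :=
  exists P : nat -> set A,
    (forall i, (i <= d)%N -> gprime (P i)) /\
    (forall i, (i < d)%N -> P i `<` P i.+1).

Definition krull_dim (A : gradedRing) (d : nat) : Prop :=
  prime_chain A d /\ forall e, prime_chain A e -> (e <= d)%N.

Definition regular_local (A : gradedRing) (d : nat) : Prop :=
  [/\ gnoetherian A, krull_dim A d
    & exists M : set A,
        unique (@gmaximal A) M /\ fg_ideal d M].

(* For graded ideals [I' <= I] of [A]: [I / I'] is a finitely generated free
   graded module over the graded [A]-algebra [R], that is, it is isomorphic as a
   graded [A]-module to a direct sum of shifted copies of [R]. The isomorphism
   is given by [q], of which only the values on [I] matter; [e] lists the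
   degrees of the basis elements. *)
Definition free_quotient (A R : gradedRing) (I I' : set A) : Prop :=
  exists rho : {rmorphism A -> R}, graded_map rho /\
  exists (r : nat) (e : 'I_r -> int) (q : A -> 'rV[R]_r),
    [/\ forall x y, I x -> I y -> q (x + y) = q x + q y,
        forall a x, I x -> q (a * x) = rho a *: q x,
        forall x, I x -> (q x = 0 <-> I' x),
        forall u, exists2 x, I x & q x = u
      & forall d x, ghom d x -> I x -> forall i, ghom (d - e i) (q x ord0 i)].

Lemma ideal_genD (R : comPzRingType) (J : set R) x y :
  ideal_gen J x -> ideal_gen J y -> ideal_gen J (x + y).
Proof.
move=> [r [a [b [Jb ->]]]] [s [c [d [Jd ->]]]].
exists (r + s)%N, (fun i => match fintype.split i with inl j => a j | inr j => c j end),
  (fun i => match fintype.split i with inl j => b j | inr j => d j end).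
split; first by move=> i; case: (fintype.split i).
rewrite big_split_ord /=; congr (_ + _); apply: eq_bigr => i _.
  by rewrite (fintype.unsplitK (inl i)).
by rewrite (fintype.unsplitK (inr i)).
Qed.

Lemma ideal_genM (R : comPzRingType) (J : set R) c x :
  ideal_gen J x -> ideal_gen J (c * x).
Proof.
move=> [r [a [b [Jb ->]]]]; exists r, (fun i => c * a i), b; split=> //.
by rewrite big_distrr /=; apply: eq_bigr => i _; rewrite mulrA.
Qed.

Lemma ideal_gen0 (R : comPzRingType) (J : set R) : ideal_gen J 0.
Proof. by exists 0%N, (fun=> 0), (fun=> 0); split=> [[]//|]; rewrite big_ord0. Qed.

Section GradedTheory.
Variable A : gradedRing.
Implicit Types (x y : A) (I J : set A).

Lemma ghomN d x : ghom d x -> ghom d (- x).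
Proof.
by move=> dx; rewrite -sub0r; apply: gradingB => //; [exact: ghomP | exact: grading0 (ghomP A) d].
Qed.

Lemma ghomD d x y : ghom d x -> ghom d y -> ghom d (x + y).
Proof.
move=> dx dy; rewrite -[y]opprK; apply: (gradingB (ghomP A)) => //.
exact: ghomN.
Qed.

Lemma ghom_sum d (K : Type) (s : seq K) (P : pred K) (F : K -> A) :
  (forall k, P k -> ghom d (F k)) -> ghom d (\sum_(k <- s | P k) F k).
Proof.
move=> H; elim/big_ind: _ => //; first exact: grading0 (ghomP A) d.
by move=> *; apply: ghomD.
Qed.

Lemma gideal_sum I (K : eqType) (s : seq K) (P : pred K) (F : K -> A) :
  gideal I -> (forall k, k \in s -> P k -> I (F k)) ->
  I (\sum_(k <- s | P k) F k).
Proof.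
move=> [I0 ID _ _] H; rewrite big_seq_cond.
elim/big_ind: _ => // k /andP[ks Pk]; exact: H.
Qed.

Lemma gideal_gen (J : set A) : gideal (ideal_gen (J `&` @homogen A)).
Proof.
split; [exact: ideal_gen0 | move=> *; exact: ideal_genD
       | move=> *; exact: ideal_genM |].
move=> x [r [a [b [Jb ->]]]].
have h i : {s : seq A | (forall y, y \in s -> exists d, ghom d y) /\
    a i = \sum_(y <- s) y}.
  by apply/cid/(grading_span (ghomP A)).
exists (flatten [seq [seq y * b i | y <- sval (h i)] | i <- enum 'I_r]); split.
  move=> y /flattenP[_ /mapP[i _ ->] /mapP[z zs ->]].
  case: (svalP (h i)) => [/(_ _ zs)[d dz] _].
  have [Jbi [e eb]] := Jb i; split.
    by exists (d + e); exact: (gradingM (ghomP A)).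
  exists 1%N, (fun=> z), (fun=> b i); split=> [_|]; first exact: Jb.
  by rewrite big_ord1.
rewrite big_flatten /= big_map big_enum /=; apply: eq_bigr => i _.
by rewrite big_map -big_distrl /= -(proj2 (svalP (h i))).
Qed.

Lemma gideal_comp I (s : seq int) (f : int -> A) : gideal I ->
  uniq s -> (forall d, ghom d (f d)) -> I (\sum_(d <- s) f d) ->
  forall d, d \in s -> I (f d).
Proof.
move=> HI us fh Is d ds.
have [I0 ID IM Ihom] := HI.
have [t [th tE]] := Ihom _ Is.
have /choice[deg degP] : forall z : A, exists e : int, z \in t -> ghom e z.
  move=> z; case: (boolP (z \in t)) => [zt|_]; last by exists 0.
  by have [[e ez] _] := th _ zt; exists e.
pose y e := \sum_(z <- t | deg z == e) z.
have yh e : ghom e (y e).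
  rewrite /y big_seq_cond; apply: ghom_sum => z /andP[zt /eqP <-].
  exact: degP.
have yI e : I (y e) by apply: gideal_sum => // z zt _; case: (th _ zt).
pose s' := undup (s ++ map deg t).
pose x e := if e \in s then f e else 0.
have xh e : ghom e (x e).
  by rewrite /x; case: ifP => // _; exact: grading0 (ghomP A) e.
have sumx : \sum_(e <- s') x e = \sum_(e <- s) f e.
  rewrite /x -big_mkcond /= -big_filter; apply: perm_big.
  apply: uniq_perm => //; first by rewrite filter_uniq // undup_uniq.
  by move=> e; rewrite mem_filter mem_undup mem_cat; case: (e \in s).
have sumy : \sum_(e <- s') y e = \sum_(z <- t) z.
  rewrite /y (exchange_big_dep xpredT) //= big_seq [RHS]big_seq.
  apply: eq_bigr => z zt.
  rewrite (eq_bigl (fun e => e == deg z)); last by move=> e; rewrite eq_sym.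
  rewrite big_const_seq -/s'.
  rewrite (_ : count _ s' = count_mem (deg z) s'); last by apply: eq_count.
  rewrite count_uniq_mem ?undup_uniq // mem_undup mem_cat map_f ?orbT //=.
  by rewrite addr0.
have /(grading_free (ghomP A)) : uniq s' by exact: undup_uniq.
move=> /(_ (fun e => x e - y e)) H.
have ds' : d \in s' by rewrite mem_undup mem_cat ds.
have : x d - y d = 0.
  apply: H => //; first by move=> e; exact: (gradingB (ghomP A)).
  by rewrite sumrB sumx sumy tE subrr.
by rewrite /x ds => /eqP; rewrite subr_eq0 => /eqP ->.
Qed.

End GradedTheory.

Section Quotient.
Variables (A : gradedRing) (J : set A).

(* Only the homogeneous elements of [J] are used as generators. *)
Definition gqideal : set A := ideal_gen (J `&` @homogen A).
Definition gqpred : {pred A} := fun x => `[< gqideal x >].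

Lemma gqpredP x : reflect (gqideal x) (x \in gqpred).
Proof. exact: asboolP. Qed.

Lemma gqpred_zmod : zmod_closed gqpred.
Proof.
split; first by apply/gqpredP; exact: ideal_gen0.
move=> x y /gqpredP Ix /gqpredP Iy; apply/gqpredP/ideal_genD => //.
by rewrite -mulN1r; exact: ideal_genM.
Qed.
HB.instance Definition _ := GRing.isZmodClosed.Build A gqpred gqpred_zmod.

Definition gquot_car := Quotient.quot (gqpred : zmodClosed A).
HB.instance Definition _ := GRing.Zmodule.on gquot_car.

Definition gq_pi : A -> gquot_car := \pi_(gquot_car)%qT.
Definition gq_repr : gquot_car -> A := repr.

Lemma gq_reprK : cancel gq_repr gq_pi.
Proof. exact: reprK. Qed.

Lemma gq_eq x y : gq_pi x = gq_pi y <-> gqideal (x - y).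
Proof.
have -> : gq_pi x = gq_pi y <-> gq_pi x == gq_pi y by split=> /eqP.
rewrite /gq_pi -[X in _ <-> X]asboolE -/(gqpred (x - y)).
by have := @Quotient.idealrBE _ gqpred x y; rewrite /in_mem /= => <-.
Qed.

Lemma gq_piD : {morph gq_pi : x y / x + y}.
Proof. by move=> x y; exact: Quotient.pi_add. Qed.

Lemma gq_pi0 : gq_pi 0 = 0.
Proof. by apply: (addrI (gq_pi 0)); rewrite -gq_piD !addr0. Qed.

Definition gq_mul (u v : gquot_car) := gq_pi (gq_repr u * gq_repr v).
Definition gq_one := gq_pi 1.

Lemma gq_piM x y : gq_pi (x * y) = gq_mul (gq_pi x) (gq_pi y).
Proof.
apply/gq_eq.
have hx : gqideal (x - gq_repr (gq_pi x)) by apply/gq_eq; rewrite gq_reprK.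
have hy : gqideal (y - gq_repr (gq_pi y)) by apply/gq_eq; rewrite gq_reprK.
set x' := gq_repr _ in hx *; set y' := gq_repr _ in hy *.
rewrite (_ : x * y - x' * y' = y * (x - x') + x' * (y - y')); last first.
  by rewrite !mulrBr addrA (mulrC y x) (mulrC y x') subrK.
by apply: ideal_genD; exact: ideal_genM.
Qed.

Lemma gq_mulA : associative gq_mul.
Proof.
move=> x y z; rewrite -[x]gq_reprK -[y]gq_reprK -[z]gq_reprK.
by rewrite -!gq_piM mulrA.
Qed.

Lemma gq_mulC : commutative gq_mul.
Proof. by move=> x y; rewrite /gq_mul mulrC. Qed.

Lemma gq_mul1 : left_id gq_one gq_mul.
Proof. by move=> x; rewrite -[x]gq_reprK -gq_piM mul1r. Qed.

Lemma gq_mulD : left_distributive gq_mul +%R.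
Proof.
move=> x y z; rewrite -[x]gq_reprK -[y]gq_reprK -[z]gq_reprK.
by rewrite -gq_piD -!gq_piM mulrDl gq_piD.
Qed.

HB.instance Definition _ :=
  GRing.Zmodule_isComPzRing.Build gquot_car gq_mulA gq_mulC gq_mul1 gq_mulD.

Lemma gq_pi_is_zmod : zmod_morphism gq_pi.
Proof. by move=> x y; apply: (addIr (gq_pi y)); rewrite -gq_piD !subrK. Qed.
HB.instance Definition _ := GRing.isZmodMorphism.Build A gquot_car gq_pi gq_pi_is_zmod.

Lemma gq_pi_is_monoid : monoid_morphism gq_pi.
Proof. by split=> // x y; exact: gq_piM. Qed.
HB.instance Definition _ :=
  GRing.isMonoidMorphism.Build A gquot_car gq_pi gq_pi_is_monoid.

Definition gq_hom (d : int) : set gquot_car := gq_pi @` ghom d.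

Lemma gq_homP : is_grading gq_hom.
Proof.
have AP := ghomP A; split.
- by move=> d; exists 0; [exact: grading0 AP d | exact: gq_pi0].
- move=> d _ _ [x dx <-] [y dy <-]; exists (x - y); last by rewrite rmorphB.
  exact: (gradingB AP).
- by exists 1; [exact: (grading1 AP) | exact: rmorph1].
- move=> d e _ _ [x dx <-] [y ey <-]; exists (x * y); last by rewrite rmorphM.
  exact: (gradingM AP).
- move=> u; have [s [sh sE]] := grading_span AP (gq_repr u).
  exists (map gq_pi s); split.
    by move=> _ /mapP[y /sh[d dy] ->]; exists d, y.
  by rewrite big_map -[u]gq_reprK sE rmorph_sum.
- move=> s f us fh fs d ds.
  have /choice[g gP] : forall d, exists x : A, ghom d x /\ gq_pi x = f d.
    by move=> k; have [x] := fh k; exists x.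
  have gs : gqideal (\sum_(k <- s) g k).
    have /gq_eq : gq_pi (\sum_(k <- s) g k) = gq_pi 0.
      rewrite gq_pi0 -fs rmorph_sum /=.
      by apply: eq_bigr => k _; exact: (proj2 (gP k)).
    by rewrite subr0.
  have := gideal_comp (gideal_gen J) us (fun k => proj1 (gP k)) gs ds.
  rewrite -(proj2 (gP d)) -gq_pi0 => h.
  by apply/gq_eq; rewrite subr0.
- move=> d _ [x dx <-] od; rewrite (grading_even AP dx od); exact: gq_pi0.
Qed.

Definition gquot : gradedRing := GradedRing gq_homP.

End Quotient.

Definition fps (n : nat) (R : comPzRingType) : Type := 'X_{1..n} -> R.

Section Fps.
Variables (n : nat) (R : comPzRingType).
Implicit Types (f g h : fps n R) (c : 'X_{1..n}).

HB.instance Definition _ := GRing.Zmodule.copy (fps n R) ('X_{1..n} -> R).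

(* The exponents [a] with [a <= c] componentwise. *)
Definition mdivs c : seq 'X_{1..n} :=
  [seq a <- map val (enum {: 'X_{1..n < (mdeg c).+1}}) | (a <= c)%MM].

Lemma mem_mdivs a c : (a \in mdivs c) = (a <= c)%MM.
Proof.
rewrite mem_filter; case: (boolP (a <= c)%MM) => //= ac.
have ha : (mdeg a < (mdeg c).+1)%N by rewrite ltnS -(submK ac) mdegD leq_addl.
by apply/mapP; exists (BMultinom ha); rewrite ?mem_enum.
Qed.

Lemma mdivs_uniq c : uniq (mdivs c).
Proof. by rewrite filter_uniq // map_inj_uniq ?enum_uniq //; exact: val_inj. Qed.

Definition fps_one : fps n R := fun c => (c == 0%MM)%:R.
Definition fps_mul f g : fps n R :=
  fun c => \sum_(a <- mdivs c) f a * g (c - a)%MM.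
Definition fps_var (i : 'I_n) : fps n R := fun c => (c == U_(i)%MM)%:R.
Definition fps_scale (a : R) f : fps n R := fun c => a * f c.

Lemma fps_addE f g c : (f + g) c = f c + g c. Proof. by []. Qed.

Lemma fps_mulC : commutative fps_mul.
Proof.
move=> f g; apply/funext => c; rewrite /fps_mul.
have p : perm_eq (mdivs c) [seq (c - a)%MM | a <- mdivs c].
  have cK a : (a <= c)%MM -> (c - (c - a))%MM = a.
    by move=> ac; rewrite submBA // addmC addmK.
  apply: uniq_perm; first exact: mdivs_uniq.
    rewrite map_inj_in_uniq ?mdivs_uniq // => a b; rewrite !mem_mdivs => ac bc.
    by move=> /(congr1 (fun z => c - z)%MM); rewrite !cK.
  move=> a; rewrite mem_mdivs; apply/idP/mapP => [ac|[b _ ->]].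
    by exists (c - a)%MM; rewrite ?mem_mdivs ?lem_subr ?cK.
  exact: lem_subr.
rewrite (perm_big _ p) /= big_map big_seq [RHS]big_seq.
apply: eq_bigr => a; rewrite mem_mdivs => ac.
by rewrite submBA // addmC addmK mulrC.
Qed.

Lemma fps_mulA : associative fps_mul.
Proof.
move=> f g h; apply/funext => c; rewrite /fps_mul.
transitivity (\sum_(b <- mdivs c) \sum_(a <- mdivs c | (b <= a)%MM)
    f b * g (a - b)%MM * h (c - a)%MM).
  rewrite big_seq [RHS]big_seq; apply: eq_bigr => b; rewrite mem_mdivs => bc.
  have p : perm_eq [seq (a + b)%MM | a <- mdivs (c - b)%MM]
      [seq a <- mdivs c | (b <= a)%MM].
    apply: uniq_perm.
    - by rewrite map_inj_uniq ?mdivs_uniq // => x y /(congr1 (fun z => z - b)%MM);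
        rewrite !addmK.
    - by rewrite filter_uniq // mdivs_uniq.
    move=> a; rewrite mem_filter mem_mdivs; apply/mapP/andP.
      move=> [d + ->]; rewrite mem_mdivs => /mnm_lepP hd; split.
        exact: lem_addl.
      apply/mnm_lepP => i; have := hd i; rewrite mnmBE mnmDE => h1.
      have bi : (b i <= c i)%N by move/mnm_lepP: bc.
      by rewrite -(subnK bi) leq_add2r.
    move=> [ba ac]; exists (a - b)%MM; last by rewrite submK.
    rewrite mem_mdivs; apply/mnm_lepP => i; rewrite !mnmBE leq_sub2r //.
    by move/mnm_lepP: ac.
  rewrite -[RHS]big_filter -(perm_big _ p) /= big_map big_distrr /=.
  apply: eq_bigr => a _; rewrite addmK mulrA; congr (_ * h _).
  by rewrite submDA addmC.
rewrite (exchange_big_dep xpredT) //= big_seq [RHS]big_seq.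
apply: eq_bigr => a; rewrite mem_mdivs => ac; rewrite big_distrl /=.
rewrite -big_filter; apply: perm_big; apply: uniq_perm.
- by rewrite filter_uniq // mdivs_uniq.
- exact: mdivs_uniq.
move=> b; rewrite mem_filter !mem_mdivs.
case: (boolP (b <= a)%MM) => //= ba.
apply/mnm_lepP => i; apply: (@leq_trans (a i)); first by move/mnm_lepP: ba.
by move/mnm_lepP: ac.
Qed.

Lemma fps_mul1 : left_id fps_one fps_mul.
Proof.
move=> f; apply/funext => c; rewrite /fps_mul.
rewrite (bigD1_seq 0%MM) ?mdivs_uniq ?mem_mdivs //=; last first.
  by apply/mnm_lepP => i; rewrite mnm0E.
rewrite /fps_one eqxx mul1r subm0 big1 ?addr0 // => a /negPf ->.
by rewrite mul0r.
Qed.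

Lemma fps_mulD : left_distributive fps_mul +%R.
Proof.
move=> f g h; apply/funext => c; rewrite fps_addE /fps_mul -big_split /=.
by apply: eq_bigr => a _; rewrite fps_addE mulrDl.
Qed.

HB.instance Definition _ :=
  GRing.Zmodule_isComPzRing.Build (fps n R) fps_mulA fps_mulC fps_mul1 fps_mulD.

End Fps.

Section GradedFps.
Variables (A : gradedRing) (n : nat).

(* The series that are homogeneous of degree [d] when the variables have
   degree 2. *)
Definition fps_hom (d : int) : set (fps n A) :=
  [set f | forall c, ghom (d - (2 * mdeg c)%:Z) (f c)].

(* The direct sum, inside all power series, of the groups [fps_hom d]. *)
Definition gfps_pred : {pred fps n A} := fun f =>
  `[< exists s : seq (fps n A),
        (forall g, g \in s -> exists d, fps_hom d g) /\ f = \sum_(g <- s) g >].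

Lemma fps_homN d f : fps_hom d f -> fps_hom d (- f).
Proof. by move=> fd c; apply: ghomN; exact: fd. Qed.

Lemma fps_hom1 : fps_hom 0 1.
Proof.
move=> c; rewrite /GRing.one /= /fps_one.
have [->|_] := eqVneq c 0%MM; last exact: grading0 (ghomP A) _.
by rewrite mdeg0 muln0 subr0; exact: (grading1 (ghomP A)).
Qed.

Lemma fps_homM d e f g : fps_hom d f -> fps_hom e g -> fps_hom (d + e) (f * g).
Proof.
move=> fd ge c; rewrite /GRing.mul /= /fps_mul big_seq; apply: ghom_sum => a.
rewrite mem_mdivs => ac.
have -> : d + e - (2 * mdeg c)%:Z =
    (d - (2 * mdeg a)%:Z) + (e - (2 * mdeg (c - a)%MM)%:Z).
  rewrite -{1}(submK ac) mdegD mulnDr PoszD addrACA -opprD; congr (_ - _).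
  by rewrite addrC.
exact: (gradingM (ghomP A)).
Qed.

Lemma gfps_subring : subring_closed gfps_pred.
Proof.
split.
- apply/asboolP; exists [:: 1]; rewrite big_seq1; split=> // g.
  by rewrite inE => /eqP ->; exists 0; exact: fps_hom1.
- move=> _ _ /asboolP[s [sh ->]] /asboolP[t [th ->]]; apply/asboolP.
  exists (s ++ map -%R t); split; last by rewrite big_cat big_map /= sumrN.
  move=> g; rewrite mem_cat => /orP[/sh//|/mapP[h /th[d hd] ->]].
  by exists d; exact: fps_homN.
- move=> _ _ /asboolP[s [sh ->]] /asboolP[t [th ->]]; apply/asboolP.
  exists [seq f * g | f <- s, g <- t]; split; last first.
    rewrite big_allpairs_dep /= big_distrl /=; apply: eq_bigr => f _.
    by rewrite big_distrr.
  move=> _ /allpairsP[[f g] /= [/sh[d fd] /th[e ge] ->]].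
  by exists (d + e); exact: fps_homM.
Qed.
HB.instance Definition _ := GRing.isSubringClosed.Build (fps n A) gfps_pred gfps_subring.

Record gfps_car := GFps { gfps_val :> fps n A; _ : gfps_val \in gfps_pred }.
HB.instance Definition _ := [isSub of gfps_car for gfps_val].
HB.instance Definition _ := [Choice of gfps_car by <:].
HB.instance Definition _ :=
  GRing.SubChoice_isSubComPzRing.Build (fps n A) gfps_pred gfps_car gfps_subring.

Definition gfps_hom (d : int) : set gfps_car := [set f | fps_hom d (val f)].

Lemma gfps_homP : is_grading gfps_hom.
Proof.
have AP := ghomP A; split.
- by move=> d c; rewrite raddf0; exact: grading0 AP _.
- move=> d f g fd gd c; rewrite raddfB.
  by apply: (gradingB AP); [exact: fd | exact: gd].
- rewrite /gfps_hom; suff : fps_hom 0 (val (1 : gfps_car)) by [].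
  by rewrite rmorph1; exact: fps_hom1.
- move=> d e f g fd ge; suff : fps_hom (d + e) (val (f * g)) by [].
  by rewrite rmorphM; exact: fps_homM.
- move=> [f fP]; have /asboolP[s [sh sE]] := fP.
  have hin g : g \in s -> g \in gfps_pred.
    move=> /sh[d gd]; apply/asboolP; exists [:: g]; rewrite big_seq1.
    by split=> // h; rewrite inE => /eqP ->; exists d.
  exists (pmap insub s); split.
    move=> g; rewrite mem_pmap_sub => /sh[d gd]; by exists d.
  apply: val_inj; rewrite raddf_sum /= sE.
  elim: s hin {fP sh sE} => [|g s IH] hin; first by rewrite !big_nil.
  rewrite big_cons /= insubT; first by apply: hin; rewrite mem_head.
  move=> gP /=; rewrite big_cons /= -IH // => k ks.
  by apply: hin; rewrite inE ks orbT.
- move=> s f us fh fs d ds; apply: val_inj; rewrite raddf0.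
  apply/funext => c.
  have sE : \sum_(k <- s) (val (f k) : fps n A) c = 0.
    transitivity ((\sum_(k <- s) val (f k) : fps n A) c); last first.
      by rewrite -raddf_sum fs raddf0.
    by elim: (s) => [|k t IH]; rewrite ?big_nil // !big_cons fps_addE -IH.
  pose j k : int := k - (2 * mdeg c)%:Z.
  have jK : cancel j (fun k => k + (2 * mdeg c)%:Z) by move=> k; rewrite /j subrK.
  have := @grading_free _ _ AP (map j s)
    (fun k => (val (f (k + (2 * mdeg c)%:Z)) : fps n A) c).
  move=> /(_ _ _ _ (j d)) /=; rewrite jK; apply.
  + by rewrite map_inj_uniq //; exact: can_inj jK.
  + by move=> k; have := fh (k + (2 * mdeg c)%:Z) c; rewrite addrK.
  + by rewrite big_map -[RHS]sE; apply: eq_bigr => k _; rewrite jK.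
  + exact: map_f.
- move=> d f fd od; apply: val_inj; rewrite raddf0; apply/funext => c.
  apply: (grading_even AP (fd c)).
  move: od; clear; lia.
Qed.

Definition gfps : gradedRing := GradedRing gfps_homP.

End GradedFps.

Section GradedMpoly.
Variables (R : comNzRingType) (r : nat) (wt : 'I_r -> int).

(* The generator ['X_i] has degree [2 * wt i], the coefficients degree 0. *)
Definition gmpoly_hom (d : int) : set {mpoly R[r]} :=
  [set f | forall a, a \in msupp f -> d = 2 * \sum_(i < r) (a i)%:Z * wt i].

Lemma gmpoly_homP : is_grading gmpoly_hom.
Proof.
split.
- by move=> d a; rewrite msupp0.
- move=> d f g fd gd a /msuppB_le; rewrite mem_cat => /orP[/fd|/gd]; exact.
- move=> a; rewrite msupp1 inE => /eqP ->.
  by rewrite big1 ?mulr0 // => i _; rewrite mnm0E mul0r.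
- move=> d e f g fd ge a /msuppM_le /allpairsP[[b c] /= [/fd -> /ge -> ->]].
  rewrite -mulrDr -big_split /=; congr (_ * _); apply: eq_bigr => i _.
  by rewrite mnmDE PoszD mulrDl.
- move=> f; exists [seq f@_a *: 'X_[a] | a <- msupp f]; split; last first.
    by rewrite big_map -mpolyE.
  move=> _ /mapP[a _ ->]; exists (2 * \sum_(i < r) (a i)%:Z * wt i) => b.
  by move=> /msuppZ_le; rewrite msuppX inE => /eqP ->.
- move=> s f us fh fs d ds; apply/mpolyP => a; rewrite mcoeff0.
  case: (boolP (a \in msupp (f d))) => [ad|/memN_msupp_eq0 //].
  have : (\sum_(e <- s) f e)@_a = 0 by rewrite fs mcoeff0.
  rewrite (bigD1_seq d) //= mcoeffD raddf_sum /= big1 ?addr0 // => e.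
  move=> ed; apply: memN_msupp_eq0; apply/negP => ae.
  by move: ed; rewrite (fh _ _ ad) (fh _ _ ae) eqxx.
- move=> d f fd od; apply/mpolyP => a; rewrite mcoeff0.
  apply: memN_msupp_eq0; apply/negP => /fd dE; move: od; rewrite dE; lia.
Qed.

Definition gmpoly : gradedRing := GradedRing gmpoly_homP.

End GradedMpoly.

Section Zloc.
Variable p : nat.

Definition Zloc_pred : {pred rat} := fun x => coprime p `|denq x|%N.

Lemma Zloc_predP (a b : int) : coprime p `|b|%N -> b != 0 ->
  (a%:Q / b%:Q) \in Zloc_pred.
Proof.
move=> cb b0; rewrite unfold_in /=; case: divqP cb b0 => // k x k0.
by rewrite abszM coprimeMr => /andP[].
Qed.

Lemma Zloc_subring : subring_closed Zloc_pred.
Proof.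
have den x : (denq x)%:Q != 0 by rewrite intr_eq0 denq_neq0.
split.
- by rewrite unfold_in; exact: coprimen1.
- move=> x y; rewrite !unfold_in => cx cy.
  rewrite -[x]divq_num_den -[y]divq_num_den.
  rewrite -mulNr addf_div // -!intrM -rmorphN /= -intrM -rmorphD /=.
  apply: Zloc_predP; last by rewrite mulf_neq0 // denq_neq0.
  by rewrite abszM coprimeMr cx.
- move=> x y; rewrite !unfold_in => cx cy.
  rewrite -[x]divq_num_den -[y]divq_num_den mulf_div -!intrM.
  apply: Zloc_predP; last by rewrite mulf_neq0 // denq_neq0.
  by rewrite abszM coprimeMr cx.
Qed.
HB.instance Definition _ := GRing.isSubringClosed.Build rat Zloc_pred Zloc_subring.

Record Zloc := ZLoc { Zloc_val :> rat; _ : Zloc_val \in Zloc_pred }.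
HB.instance Definition _ := [isSub of Zloc for Zloc_val].
HB.instance Definition _ := [Choice of Zloc by <:].
HB.instance Definition _ := [SubChoice_isSubComNzRing of Zloc by <:].

End Zloc.

(* [F : nat -> nat -> R] stands for the series [\sum F i j x^i y^j]. *)

Section FormalGroupLaw.
Variable R : comPzRingType.
Implicit Types F : nat -> nat -> R.

(* The series [F(f, g)], for [f] and [g] without constant term: then
   [f ^+ i * g ^+ j] only has terms of degree at least [i + j], so the
   truncated sum gives the coefficient of ['X^c]. *)
Definition fgl_add n F (f g : fps n R) : fps n R := fun c =>
  \sum_(i < (mdeg c).+1) \sum_(j < (mdeg c).+1) F i j * (f ^+ i * g ^+ j) c.

(* The series [[k](f)]. *)
Definition fgl_nmul n F (k : nat) (f : fps n R) : fps n R :=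
  iter k (fgl_add F f) 0.

Definition is_fgl F : Prop :=
  [/\ (let x : fps 1 R := fps_var R ord0 in fgl_add F x 0 = x),
      (let x : fps 2 R := fps_var R ord0 in
       let y := fps_var R (inord 1) in fgl_add F x y = fgl_add F y x)
    & (let x : fps 3 R := fps_var R ord0 in
       let y := fps_var R (inord 1) in
       let z := fps_var R (inord 2) in
       fgl_add F (fgl_add F x y) z = fgl_add F x (fgl_add F y z))].

End FormalGroupLaw.

Definition fgl_map (R S : comPzRingType) (h : R -> S) (F : nat -> nat -> R) :=
  fun i j => h (F i j).

(* Cartier's definition: for all primes [q != p], the image of the curve [x]
   under the Frobenius operator [F_q] vanishes, that is, the formal sum of the
   [z ^+ i * x] for [i < q] is zero over any [R]-algebra with an element [z]
   such that [1 + z + ... + z ^+ (q - 1) = 0]. When [R] is a torsion-free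
   Z_(p)-algebra, this means that the logarithm is a series in the [x^(p^k)]. *)
Definition p_typical (p : nat) (R : comPzRingType) (F : nat -> nat -> R) : Prop :=
  forall q, prime q -> q != p ->
  forall (B : comPzRingType) (h : {rmorphism R -> B}) (z : B),
    \sum_(i < q) z ^+ i = 0 ->
    \big[fgl_add (fgl_map h F)/0]_(i < q)
      fps_scale (z ^+ i) (fps_var B (ord0 : 'I_1)) = 0.

Definition p_local (p : nat) (R : comPzRingType) : Prop :=
  forall q, prime q -> q != p -> exists u : R, q%:R * u = 1.

(* By Quillen's theorem, MU^* with its standard formal group law is the Lazard
   ring, so its p-localisation is universal over p-local rings. *)
Definition is_MUp (p : nat) (MU : gradedRing) (F : nat -> nat -> MU) : Prop :=
  [/\ p_local p MU,
      is_fgl F,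
      forall i j, ghom (2 - (2 * (i + j))%:Z) (F i j)
    & forall (R : comPzRingType) (G : nat -> nat -> R), p_local p R -> is_fgl G ->
        exists f : {rmorphism MU -> R},
          (forall i j, f (F i j) = G i j) /\
          forall g : {rmorphism MU -> R},
            (forall i j, g (F i j) = G i j) -> g =1 f].

(* [pi] exhibits [BP] as the largest quotient of [MU] over which [F] becomes
   p-typical. *)
Definition is_BP (p : nat) (MU : gradedRing) (F : nat -> nat -> MU)
    (BP : gradedRing) (pi : {rmorphism MU -> BP}) : Prop :=
  [/\ graded_map pi,
      forall y, exists x, pi x = y,
      p_typical p (fgl_map pi F)
    & forall (R : comPzRingType) (rho : {rmorphism MU -> R}),
        (forall y, exists x, rho x = y) -> p_typical p (fgl_map rho F) ->
        forall x, pi x = 0 -> rho x = 0].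

(* [v 0 = p], [v k] has degree [-2(p^k-1)], and [[p](t)] is congruent to
   [v k t^(p^k)] modulo [(v 0, ..., v (k-1), t^(p^k+1))]. *)
Definition is_vseq (p : nat) (BP : gradedRing) (F : nat -> nat -> BP)
    (v : nat -> BP) : Prop :=
  [/\ v 0%N = p%:R,
      forall k, ghom (- (2 * (p ^ k - 1))%:Z) (v k)
    & forall k j, (j <= p ^ k)%N ->
        ideal_gen [set v i | i in [set i | (i < k)%N]]
          (fgl_nmul F p (fps_var BP (ord0 : 'I_1)) [multinom j | _ < 1]
           - (if j == (p ^ k)%N then v k else 0))].

(* [E^* = F_p[v_m, ..., v_n]] if [m > 0], and [Z_(p)[v_1, ..., v_n]] if
   [m = 0]: the generator ['X_i] is [v_(maxn m 1 + i)]. *)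
Definition Ebase (p m : nat) : comNzRingType :=
  if m is 0 then Zloc p else 'F_p.

Definition Ering (p m n : nat) : gradedRing :=
  gmpoly (Ebase p m)
    (fun i : 'I_(n.+1 - maxn m 1) => - (p ^ (maxn m 1 + i) - 1)%N%:Z).

Definition Egen (p m n : nat) (i : 'I_(n.+1 - maxn m 1)) : Ering p m n :=
  'X_i : {mpoly (Ebase p m)[n.+1 - maxn m 1]}.

(* [phi] identifies [Ering p m n] with the quotient of [BP] by the ideal
   generated by the [v k] with [k < m] or [k > n]. *)
Definition is_BPmn (p m n : nat) (BP : gradedRing) (v : nat -> BP)
    (phi : {rmorphism BP -> Ering p m n}) : Prop :=
  [/\ graded_map phi,
      forall y, exists x, phi x = y,
      forall x, phi x = 0 <->
        ideal_gen [set v k | k in [set k | (k < m)%N || (n < k)%N]] x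
    & forall i : 'I_(n.+1 - maxn m 1), phi (v (maxn m 1 + i)%N) = Egen p i].

(* [E^*BV_w = E^*[[x_0, ..., x_(w-1)]] / ([p](x_0), ..., [p](x_(w-1)))].
   The series [[p](x_i)] are homogeneous of degree 2 when [F i j] has degree
   [2 - 2(i + j)], which holds for the formal group law of [BP]. *)
Definition EBV (p w : nat) (E : gradedRing) (F : nat -> nat -> E) : gradedRing :=
  gquot [set f : gfps E w |
    exists i : 'I_w, gfps_val f = fgl_nmul F p (fps_var E i)].

(* Main.v *)
Require Import Defs.
From HB Require Import structures.
From mathcomp Require Import all_boot all_order all_algebra.
From mathcomp Require Import zify ring mpoly.
From mathcomp Require Import boolp classical_sets functions.

Set Implicit Arguments.
Unset Strict Implicit.
Unset Printing Implicit Defensive.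

Import GRing.Theory.
Local Open Scope classical_set_scope.
Local Open Scope ring_scope.

(** The ring in question is [A = S/([p](x_0), ..., [p](x_(w-1)))], where [S] is the
    graded power series ring over [E^*] in [w] variables. [S] is regular local of
    dimension [2w], with parameters [v_m, ..., v_n, x_0, ..., x_(w-1)] (for [m = 0] the
    first one is [v_0 = p]); so the [w] relations should cut the dimension down to [w],
    and the point is to factor them into pieces whose quotients stay regular.

    The variables are treated one after the other. Suppose that an ideal [J] is reached
    such that [S/J] is regular, hence a domain, and that [k] of the variables treated so
    far are independent p-torsion points of the formal group over [S/J], while
    [v_m, ..., v_(m+k-1)] lie in the ideal of these variables. The [p^k] formal linear
    combinations [y] of these points are again p-torsion, and the p-series is invariant
    under translation by them; since [[p](t)] is divisible by [t^(p^m)], it follows that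
    [(x_i - y)^(p^m)] divides [[p](x_i)] ([torsion_root]). The elements [x_i - y] are
    parameters and pairwise non-associated primes ([g_distinct]), so that
    [[p](x_i) = f prod_y (x_i - y)^(p^m)] ([cofactor]). Modulo the [k] points the product
    becomes [x_i^(p^(m+k))], which is the leading power of [[p](x_i)] there, with
    coefficient [v_(m+k)]; hence [f] is [v_(m+k)] plus a multiple of [x_i], and it is a
    parameter too ([cofactor_mod], [step_f]). Passing to [J + (x_i - y)] identifies [x_i]
    with an old torsion point, passing to [J + (f)] makes it a new one, and both quotients
    are regular of dimension one less. After [w] steps every branch ends in a regular
    local ring of dimension [w].

    A factorisation [b c] of a relation gives the exact sequence
    [0 -> S/(J + (c)) -> S/(J + (b c)) -> S/(J + (b)) -> 0], which stays exact modulo the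
    remaining relations because these form a regular sequence at both ends; that they do
    is proved along the same tree of cases ([good_mul], [tower_good]). So the filtrations
    of the branches assemble to a chain of ideals whose quotients are cyclic, with
    annihilators the ideals at the ends of the branches: free modules of rank one over the
    regular rings there ([adj_free]).

    The algebra behind this is developed for graded ideals of a single graded ring. Krull's
    principal ideal theorem ([principal_ideal]) gives the height theorem ([hchain_le]) and
    the fact that regular local rings are domains ([regular_prime]); that a system of
    parameters may be changed ([params_change]) is a consequence. [S] is Noetherian by
    Cohen's criterion, as it is complete for each of its variables ([noeth_of_complete]).
    The axioms of a formal group law are transported from variables to all series without
    constant term by substitution ([subst_fgl_add]). *)

(** * Ideals of a graded ring *)

Section Ideals.
Variables (R : comPzRingType) (I : set R).
Implicit Types (a x y : R).

Definition is_ideal : Prop :=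
  [/\ I 0, forall x y, I x -> I y -> I (x + y) & forall a x, I x -> I (a * x)].

Hypothesis HI : is_ideal.

Lemma is_ideal0 : I 0. Proof. by case: HI. Qed.

Lemma is_idealD x y : I x -> I y -> I (x + y).
Proof. by case: HI => _ + _; apply. Qed.

Lemma is_idealM a x : I x -> I (a * x).
Proof. by case: HI => _ _; apply. Qed.

Lemma is_idealMr a x : I x -> I (x * a).
Proof. by rewrite mulrC; exact: is_idealM. Qed.

Lemma is_idealN x : I x -> I (- x).
Proof. by rewrite -mulN1r; exact: is_idealM. Qed.

Lemma is_idealB x y : I x -> I y -> I (x - y).
Proof. by move=> Ix /is_idealN; exact: is_idealD. Qed.

Lemma is_ideal_sum (T : eqType) (s : seq T) (F : T -> R) :
  (forall k, k \in s -> I (F k)) -> I (\sum_(k <- s) F k).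
Proof.
by move=> H; rewrite big_seq; elim/big_ind: _ => //; [exact: is_ideal0|exact: is_idealD].
Qed.

End Ideals.

Lemma is_ideal_zero (R : comPzRingType) : is_ideal [set (0 : R)].
Proof. by split=> //= [x y -> ->|a x ->]; rewrite ?addr0 ?mulr0. Qed.

Lemma is_ideal_gen (R : comPzRingType) (J : set R) : is_ideal (ideal_gen J).
Proof.
by split; [exact: ideal_gen0|move=> x y; exact: ideal_genD|move=> a x; exact: ideal_genM].
Qed.

Lemma sub_ideal_gen (R : comPzRingType) (J : set R) : J `<=` ideal_gen J.
Proof.
by move=> x Jx; exists 1%N, (fun=> 1), (fun=> x); rewrite big_ord1 mul1r.
Qed.

Lemma ideal_gen_min (R : comPzRingType) (J K : set R) :
  is_ideal K -> J `<=` K -> ideal_gen J `<=` K.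
Proof.
move=> HK JK _ [r [a [b [Jb ->]]]]; apply: is_ideal_sum => // i _.
by apply: is_idealM => //; exact/JK/Jb.
Qed.

Section GradedIdeals.
Variable A : gradedRing.
Implicit Types (x y a b c u : A) (I J K N P Q : set A).

Let AP := ghomP A.

Lemma gideal_ideal I : gideal I -> is_ideal I.
Proof. by case. Qed.

Lemma hom0 d : ghom d (0 : A). Proof. exact: (grading0 AP). Qed.
Lemma homogen1 : @homogen A 1. Proof. by exists 0; exact: (grading1 AP). Qed.
Lemma homogenM a b : homogen a -> homogen b -> homogen (a * b).
Proof. by move=> [d da] [e eb]; exists (d + e); exact: (gradingM AP). Qed.
Lemma homogenX a n : homogen a -> homogen (a ^+ n).
Proof.
move=> ha; elim: n => [|n IH]; first by rewrite expr0; exact: homogen1.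
by rewrite exprS; exact: homogenM.
Qed.

Lemma hom_dec x : exists (s : seq int) (f : int -> A),
  [/\ uniq s, forall d, ghom d (f d), forall d, d \notin s -> f d = 0
    & x = \sum_(d <- s) f d].
Proof.
have [t [th ->]] := grading_span AP x.
have /choice[edeg degP] : forall z : A, exists e : int, z \in t -> ghom e z.
  move=> z; case: (boolP (z \in t)) => [zt|_]; last by exists 0.
  by have [e ez] := th _ zt; exists e.
exists (undup (map edeg t)), (fun e => \sum_(z <- t | edeg z == e) z); split.
- exact: undup_uniq.
- move=> e; rewrite big_seq_cond; apply: ghom_sum => z /andP[zt /eqP <-].
  exact: degP.
- move=> d; rewrite mem_undup => dt; rewrite big_seq_cond big1 // => z.
  by move=> /andP[zt /eqP zd]; move: dt; rewrite -zd map_f.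
- rewrite (exchange_big_dep xpredT) //= big_seq [RHS]big_seq.
  apply: eq_bigr => z zt.
  rewrite (eq_bigl (fun e => e == edeg z)); last by move=> e; rewrite eq_sym.
  rewrite -big_filter filter_pred1_uniq ?undup_uniq ?big_seq1 //.
  by rewrite mem_undup map_f.
Qed.

Lemma gideal_dec I x : gideal I -> I x -> exists (s : seq int) (f : int -> A),
  [/\ forall d, ghom d (f d), forall d, I (f d) & x = \sum_(d <- s) f d].
Proof.
move=> HI Ix; have [s [f [us fh f0 xE]]] := hom_dec x.
exists s, f; split=> // d; case: (boolP (d \in s)) => [ds|/f0 ->].
  by apply: (gideal_comp HI us fh _ ds); rewrite -xE.
exact: is_ideal0 (gideal_ideal HI).
Qed.

Lemma gidealI I : is_ideal I ->
  (forall x, I x -> exists (s : seq int) (f : int -> A),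
    [/\ forall d, ghom d (f d), forall d, I (f d) & x = \sum_(d <- s) f d]) ->
  gideal I.
Proof.
move=> [I0 ID IM] H; split=> // x /H[s [f [fh fI ->]]].
exists (map f s); split; last by rewrite big_map.
by move=> _ /mapP[d _ ->]; split; [exists d|].
Qed.

(** Inclusions out of a graded ideal are tested on homogeneous elements: it is the
    span of those it contains. *)
Lemma gideal_sub I K : gideal I -> is_ideal K ->
  (forall x, homogen x -> I x -> K x) -> I `<=` K.
Proof.
move=> HI HK H x /(gideal_dec HI)[s [f [fh fI ->]]].
by apply: (is_ideal_sum HK) => d _; apply: H => //; exists d.
Qed.

Lemma gideal_witness I K : gideal I -> is_ideal K -> ~ (I `<=` K) ->
  exists x, [/\ homogen x, I x & ~ K x].
Proof.
move=> HI HK nIK; apply: contrapT => H; apply: nIK.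
apply: gideal_sub => // x hx Ix; apply: contrapT => Kx; apply: H.
by exists x.
Qed.

(** Multiplication by a homogeneous element shifts degrees, so the components of a
    product are the products of the components. *)
Lemma gideal_mul_comp I e b (s : seq int) (f : int -> A) : gideal I -> ghom e b ->
  uniq s -> (forall d, ghom d (f d)) -> I ((\sum_(d <- s) f d) * b) ->
  forall d, d \in s -> I (f d * b).
Proof.
move=> HI eb us fh H d ds.
have := @gideal_comp A I (map (fun k => k + e) s) (fun k => f (k - e) * b) HI.
rewrite map_inj_uniq; last exact: addIr.
move=> /(_ us _ _ (d + e)); rewrite addrK; apply; last exact: map_f.
  by move=> k; rewrite -[k in ghom k](subrK e); apply: (gradingM AP).
move: H; rewrite big_distrl big_map /=.
by under [X in _ -> I X]eq_bigr do rewrite addrK.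
Qed.

(** Comparing components of one degree in [x = k b] modulo [J] leaves a single
    component of [k]. That component lies in every graded ideal that contains [k],
    which lets side conditions on [k] survive. *)
Lemma hom_coef J d e x b k : gideal J -> ghom d x -> ghom e b -> J (x - k * b) ->
  exists k', [/\ ghom (d - e) k', forall N, gideal N -> N k -> N k'
    & J (x - k' * b)].
Proof.
move=> HJ dx eb Jk; have [s [f [us fh f0 kE]]] := hom_dec k.
exists (f (d - e)); split=> [//|N HN Nk|].
  case: (boolP (d - e \in s)) => [ds|/f0 ->]; last exact: is_ideal0 (gideal_ideal HN).
  by apply: (gideal_comp HN us fh _ ds); rewrite -kE.
pose t := map (fun j => j + e) s; pose s' := undup (d :: t).
pose g j := (if j == d then x else 0) - f (j - e) * b.
have := @gideal_comp A J s' g HJ (undup_uniq _) _ _ d.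
rewrite /g eqxx; apply; last by rewrite mem_undup mem_head.
  move=> j; apply: (gradingB AP); first by case: eqP => [->//|_]; exact: hom0.
  by rewrite -[j in ghom j](subrK e); apply: (gradingM AP).
rewrite sumrB -big_mkcond -big_filter filter_pred1_uniq ?undup_uniq //; last first.
  by rewrite mem_undup mem_head.
rewrite big_seq1; suff -> : \sum_(j <- s') f (j - e) * b = k * b by [].
have ut : uniq t by rewrite map_inj_uniq //; exact: addIr.
have tE : \sum_(j <- t) f (j - e) * b = k * b.
  by rewrite big_map kE big_distrl; apply: eq_bigr => j _; rewrite addrK.
rewrite -tE /s' /=; case: ifP => dt; rewrite undup_id //.
rewrite big_cons (f0 (d - e)) ?mul0r ?add0r //.
apply/negP => ds; move/negP: dt; apply; apply/mapP.
by exists (d - e); rewrite ?subrK.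
Qed.

(** The form of [hom_coef] used in Nakayama arguments, where [a - k] with [k] in a
    prime [N] must become a homogeneous element outside [N]. *)
Lemma homogenize L (N : set A) d e a b k : gideal L -> gideal N ->
  ghom d a -> ghom e b -> N k -> L ((a - k) * b) ->
  exists k', [/\ ghom d k', N k' & L ((a - k') * b)].
Proof.
move=> HL HN da eb Nk; rewrite mulrBl => Lk.
have [k' [dk' Nk' Lk']] := hom_coef HL (gradingM AP da eb) eb Lk.
by exists k'; rewrite mulrBl; split=> //; [rewrite addrK in dk'|exact: Nk'].
Qed.

Definition adj I a : set A := [set x | exists y c, I y /\ x = y + c * a].
Definition adjs I (s : seq A) : set A := foldl adj I s.
Definition colon I a : set A := [set x | I (x * a)].

Lemma adj_ideal I a : is_ideal I -> is_ideal (adj I a).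
Proof.
move=> HI; split.
- by exists 0, 0; split; [exact: is_ideal0 | rewrite mul0r addr0].
- move=> _ _ [y [c [Iy ->]]] [y' [c' [Iy' ->]]]; exists (y + y'), (c + c').
  by split; [exact: is_idealD | rewrite mulrDl addrACA].
- move=> k _ [y [c [Iy ->]]]; exists (k * y), (k * c).
  by split; [exact: is_idealM | rewrite mulrDr mulrA].
Qed.

Lemma sub_adj I a : I `<=` adj I a.
Proof. by move=> x Ix; exists x, 0; rewrite mul0r addr0. Qed.

Lemma mem_adj I a : is_ideal I -> adj I a a.
Proof. by move=> HI; exists 0, 1; rewrite mul1r add0r; split=> //; exact: is_ideal0. Qed.

Lemma adj_min I a K : is_ideal K -> I `<=` K -> K a -> adj I a `<=` K.
Proof. by move=> HK IK Ka _ [y [c [/IK Iy ->]]]; apply: is_idealD => //; exact: is_idealM. Qed.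

Lemma gideal_adj I a : gideal I -> homogen a -> gideal (adj I a).
Proof.
move=> HI [e ea]; have HI' := gideal_ideal HI.
have HJ := adj_ideal a HI'.
split; [exact: is_ideal0|exact: is_idealD|exact: is_idealM|].
move=> _ [y [c [Iy ->]]].
have [s [f [fh fI ->]]] := gideal_dec HI Iy.
have [t [g [_ gh _ ->]]] := hom_dec c.
exists (map f s ++ map (fun d => g d * a) t); split; last first.
  by rewrite big_cat /= !big_map -big_distrl.
move=> z; rewrite mem_cat => /orP[/mapP[d _ ->]|/mapP[d _ ->]]; split.
- by exists d.
- exact: sub_adj.
- by exists (d + e); apply: (gradingM AP).
- by apply: is_idealM => //; exact: mem_adj.
Qed.

Lemma adjs_ideal I s : is_ideal I -> is_ideal (adjs I s).
Proof. by elim: s I => //= a s IH I HI; apply: IH; exact: adj_ideal. Qed.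

Lemma gideal_adjs I s : gideal I -> (forall a, a \in s -> homogen a) ->
  gideal (adjs I s).
Proof.
elim: s I => //= a s IH I HI H; apply: IH; last by move=> b bs; apply: H; rewrite inE bs orbT.
by apply: gideal_adj => //; apply: H; rewrite mem_head.
Qed.

Lemma sub_adjs I s : I `<=` adjs I s.
Proof. by elim: s I => [|a s IH] I x Ix //=; apply: IH; exact: sub_adj. Qed.

Lemma mem_adjs I s a : is_ideal I -> a \in s -> adjs I s a.
Proof.
elim: s I => //= b s IH I HI; rewrite inE => /orP[/eqP ->|].
  by apply: sub_adjs; exact: mem_adj.
by apply: IH; exact: adj_ideal.
Qed.

Lemma adjs_min I s K : is_ideal K -> I `<=` K -> (forall a, a \in s -> K a) ->
  adjs I s `<=` K.
Proof.
move=> HK; elim: s I => [|a s IH] I IK sK //=; apply: IH.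
  by apply: adj_min => //; apply: sK; rewrite mem_head.
by move=> b bs; apply: sK; rewrite inE bs orbT.
Qed.

Lemma adjs_cat I s t : adjs I (s ++ t) = adjs (adjs I s) t.
Proof. by rewrite /adjs foldl_cat. Qed.

Lemma adjs_mono I J s : is_ideal J -> I `<=` J -> adjs I s `<=` adjs J s.
Proof.
move=> HJ IJ; apply: adjs_min; first exact: adjs_ideal.
  by apply: subset_trans IJ _; exact: sub_adjs.
by move=> a; exact: mem_adjs.
Qed.

(** Both sides are the least ideal that contains [I], [a] and [s]. *)
Lemma adjs_adj I a s : is_ideal I -> adjs (adj I a) s = adj (adjs I s) a.
Proof.
move=> HI; have H1 := adjs_ideal s HI; have H2 := adj_ideal a HI.
apply/seteqP; split.
  apply: adjs_min; first exact: adj_ideal.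
    apply: adj_min; [exact: adj_ideal| |exact: mem_adj].
    by apply: subset_trans (sub_adj _); exact: sub_adjs.
  by move=> b bs; apply: sub_adj; exact: mem_adjs.
apply: adj_min; first exact: adjs_ideal.
  by apply: adjs_mono => //; exact: sub_adj.
by apply: sub_adjs; exact: mem_adj.
Qed.

Lemma gideal_colon I a : gideal I -> homogen a -> gideal (colon I a).
Proof.
move=> HI [e ea]; have HI' := gideal_ideal HI; apply: gidealI.
  split; rewrite /colon /=.
  - by rewrite mul0r; exact: is_ideal0.
  - by move=> x y Ix Iy; rewrite mulrDl; exact: is_idealD.
  - by move=> k x Ix; rewrite -mulrA; exact: is_idealM.
move=> x Ix; have [s [f [us fh f0 xE]]] := hom_dec x.
exists s, f; split=> // d; case: (boolP (d \in s)) => [ds|/f0 ->].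
  by apply: (gideal_mul_comp HI ea us fh _ ds); rewrite -xE.
by rewrite /colon /= mul0r; exact: is_ideal0.
Qed.

Lemma gideal0 : gideal [set (0 : A)].
Proof.
apply: gidealI.
  by split=> //= [x y -> ->|a x ->]; rewrite ?addr0 ?mulr0.
move=> x /= ->; exists [::], (fun=> 0); split=> //; first exact: hom0.
by rewrite big_nil.
Qed.

Lemma gidealT : gideal [set: A].
Proof.
apply: gidealI; first by split.
by move=> x _; have [s [f [_ fh _ xE]]] := hom_dec x; exists s, f.
Qed.

Lemma ideal1T I : is_ideal I -> I 1 -> I = setT.
Proof.
by move=> HI I1; apply/seteqP; split=> // x _; rewrite -[x]mulr1; exact: is_idealM.
Qed.

(** The contraction to the ring of the localisation of [I] at the graded prime [N]: it
    replaces localisation, so that all ideals live in one ring. *)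
Definition sat N I : set A := [set x | exists s, [/\ homogen s, ~ N s & I (s * x)]].

Lemma gprime_ideal N : gprime N -> is_ideal N.
Proof. by move=> [/gideal_ideal]. Qed.

Lemma gprimeM N a b : gprime N -> homogen a -> homogen b ->
  ~ N a -> ~ N b -> ~ N (a * b).
Proof. by move=> [_ _ H] ha hb Na Nb /(H _ _ ha hb)[]. Qed.

Lemma sub_sat N I : gprime N -> I `<=` sat N I.
Proof.
move=> [_ N1 _] x Ix; exists 1; rewrite mul1r; split=> //; exact: homogen1.
Qed.

Lemma gideal_sat N I : gprime N -> gideal I -> gideal (sat N I).
Proof.
move=> HN HI; have HI' := gideal_ideal HI; apply: gidealI.
  split.
  - by apply: sub_sat => //; exact: is_ideal0.
  - move=> x y [s [hs Ns Is]] [t [ht Nt It]]; exists (s * t); split.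
    + exact: homogenM.
    + exact: gprimeM.
    + rewrite mulrDr; apply: is_idealD => //; last by rewrite -mulrA; exact: is_idealM.
      by rewrite mulrAC; exact: is_idealMr.
  - move=> a x [s [hs Ns Is]]; exists s; split=> //.
    by rewrite mulrCA; exact: is_idealM.
move=> x [h [[e eh] Nh Ih]]; have [s [f [us fh f0 xE]]] := hom_dec x.
exists s, f; split=> // d; exists h; split=> //; first by exists e.
rewrite mulrC; case: (boolP (d \in s)) => [ds|/f0 ->].
  by apply: (gideal_mul_comp HI eh us fh _ ds); rewrite -xE mulrC.
by rewrite mul0r; exact: is_ideal0.
Qed.

Lemma sat_mono N I J : I `<=` J -> sat N I `<=` sat N J.
Proof. by move=> IJ x [s [hs Ns /IJ Js]]; exists s. Qed.

Lemma sat_sat N I : gprime N -> sat N (sat N I) `<=` sat N I.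
Proof.
move=> HN x [s [hs Ns [t [ht Nt It]]]]; exists (t * s); split.
- exact: homogenM.
- exact: gprimeM.
- by rewrite -mulrA.
Qed.

(** A homogeneous element of [I] outside [N] becomes a unit in the localisation at
    [N]. *)
Lemma sat_proper N I : gideal N -> gideal I -> sat N I `<=` I -> ~ I 1 ->
  I `<=` N.
Proof.
move=> HN HI sI I1; apply: gideal_sub => //; first exact: gideal_ideal.
move=> x hx Ix; apply: contrapT => Nx; apply: I1; apply: sI.
by exists x; rewrite mulr1.
Qed.

Lemma sat_fix N I s x : sat N I `<=` I -> homogen s -> ~ N s -> I (s * x) -> I x.
Proof. by move=> sI hs Ns Is; apply: sI; exists s. Qed.

(** Nakayama's lemma in the localisation at [N]. The generators of [I] are discarded
    one at a time: modulo the others and [J], the generator [b] satisfies [(s - t k) b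
    = 0] with [s - t k] outside [N]. *)
Lemma nakayama N I J l t : gprime N -> gideal I -> gideal J -> N t ->
  (forall b, b \in l -> homogen b) -> I = adjs [set 0] l ->
  (forall x, I x -> sat N [set z | exists y c, [/\ J y, I c & z = y + t * c]] x) ->
  I `<=` sat N J.
Proof.
move=> HN HI HJ Nt hl IE H.
have HN' : gideal N by case: HN.
have HJ' := gideal_ideal HJ.
have Il b : b \in l -> I b.
  by rewrite IE; apply: mem_adjs; exact: gideal_ideal gideal0.
have : I `<=` sat N (adjs J l).
  apply: subset_trans (sub_sat HN); rewrite IE; apply: adjs_mono => //.
  by move=> _ ->; exact: is_ideal0.
elim: l hl Il {IE} => //= b l IH hl Il HIs; apply: IH.
- by move=> c cl; apply: hl; rewrite inE cl orbT.
- by move=> c cl; apply: Il; rewrite inE cl orbT.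
have Ib : I b by apply: Il; rewrite mem_head.
have hb : homogen b by apply: hl; rewrite mem_head.
have HL : gideal (adjs J l).
  by apply: gideal_adjs => // c cl; apply: hl; rewrite inE cl orbT.
have HL' := gideal_ideal HL.
move: HIs; rewrite adjs_adj // => HIs.
suff bs : sat N (adjs J l) b.
  move=> x /HIs[s [hs Ns [y [c [Ly E]]]]]; apply: (sat_sat HN).
  exists s; split=> //; rewrite E.
  have HS := gideal_ideal (gideal_sat HN HL).
  by apply: is_idealD => //; [exact: sub_sat | exact: is_idealM].
have [s [[d ds] Ns [y [c [Jy Ic E]]]]] := H _ Ib.
have [s' [[d' ds'] Ns' [z [k [Lz E']]]]] := HIs _ Ic.
have [e eb] := hb.
have L : adjs J l ((s' * s - t * k) * b).
  have -> : (s' * s - t * k) * b = s' * y + t * z.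
    rewrite mulrBl -mulrA E mulrDr mulrCA E' mulrDr -[t * k * b]mulrA.
    by rewrite addrA addrK.
  by apply: is_idealD => //; apply: is_idealM => //; exact: sub_adjs.
have [k' [dk' Nk' Lk']] := homogenize HL HN' (gradingM AP ds' ds) eb
   (is_idealMr (gprime_ideal HN) k Nt) L.
exists (s' * s - k'); split=> //.
  by exists (d' + d); apply: (gradingB AP) => //; exact: (gradingM AP).
move=> Nn; apply: (gprimeM HN _ _ Ns' Ns); [by exists d'|by exists d|].
by rewrite -[s' * s](subrK k'); apply: is_idealD => //; exact: gprime_ideal.
Qed.

(** * Noetherian graded rings and the principal ideal theorem *)

(** Zorn's lemma in the form needed for ideals; chains are required to be nonempty
    because the empty union is not an ideal. *)
Lemma zorn_above (Q : set (set A)) I0 : Q I0 ->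
  (forall F : set (set A), F `<=` Q -> F !=set0 -> total_on F subset ->
     Q (\bigcup_(X in F) X)) ->
  exists I, [/\ Q I, I0 `<=` I & forall J, Q J -> I `<=` J -> J = I].
Proof.
move=> QI0 H.
have [I [PI maxI]] : exists I, (I = set0 \/ Q I /\ I0 `<=` I) /\
    forall B, I `<` B -> ~ (B = set0 \/ Q B /\ I0 `<=` B).
  apply: (@Zorn_bigcup _ [set X | X = set0 \/ Q X /\ I0 `<=` X]) => F FP Ft.
  have [[X [FX X0]]|nF] := pselect (exists X, F X /\ X <> set0); last first.
    left; apply/seteqP; split=> // x [X FX Xx]; apply: nF; exists X; split=> //.
    by move=> X0; rewrite X0 in Xx.
  right.
  have -> : \bigcup_(X in F) X = \bigcup_(X in [set Y | F Y /\ Y <> set0]) X.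
    apply/seteqP; split=> x [Y FY Yx]; last by exists Y => //; case: FY.
    by exists Y => //; split=> // Y0; rewrite Y0 in Yx.
  split.
    apply: H; first by move=> Y [/FP[//|[]]].
      by exists X.
    by move=> S T [FS _] [FT _]; exact: Ft.
  have [//|[_ IX]] := FP _ FX.
  by move=> x /IX Xx; exists X.
have [QI I0I] : Q I /\ I0 `<=` I.
  case: PI => // I0E.
  have [I0e|I0n] := pselect (I0 = set0); first by rewrite I0E -I0e; split=> // ?.
  exfalso; apply: (maxI I0); last by right; split=> // ?.
  rewrite I0E; split; first exact: sub0set.
  by move=> I0s; apply: I0n; apply/seteqP; split.
exists I; split=> // J QJ IJ; apply/seteqP; split=> //.
apply: contrapT => nJI; apply: (maxI J) => //; right; split=> //.
exact: subset_trans IJ.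
Qed.

Lemma gideal_bigcup (F : set (set A)) : F !=set0 -> total_on F subset ->
  (forall X, F X -> gideal X) -> gideal (\bigcup_(X in F) X).
Proof.
move=> [X0 FX0] Ft Fg; split.
- by exists X0 => //; exact: is_ideal0 (gideal_ideal (Fg _ FX0)).
- move=> x y [X FX Xx] [Y FY Yy]; case: (Ft _ _ FX FY) => XY.
    by exists Y => //; apply: is_idealD (gideal_ideal (Fg _ FY)) _ _ _ Yy; exact: XY.
  by exists X => //; apply: is_idealD (gideal_ideal (Fg _ FX)) _ _ Xx _; exact: XY.
- by move=> a x [X FX Xx]; exists X => //; exact: is_idealM (gideal_ideal (Fg _ FX)) _ _ Xx.
- move=> x [X FX Xx]; have [_ _ _ /(_ _ Xx)[s [sh sE]]] := Fg _ FX.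
  by exists s; split=> // y /sh[hy Xy]; split=> //; exists X.
Qed.

Definition fin_gen I := exists2 s : seq A,
  forall a, a \in s -> homogen a & I = adjs [set 0] s.

Lemma adjs_ideal_gen (s : seq A) :
  adjs [set 0] s = ideal_gen (range (fun i : 'I_(size s) => s`_i)).
Proof.
have H0 := is_ideal_zero A; apply/seteqP; split.
  apply: adjs_min; first exact: is_ideal_gen.
    by move=> _ ->; exact: ideal_gen0.
  by move=> a /(nthP 0)[i is_ <-]; apply: sub_ideal_gen; exists (Ordinal is_).
apply: ideal_gen_min; first exact: adjs_ideal.
by move=> _ [i _ <-]; apply: mem_adjs => //; exact: mem_nth.
Qed.

Lemma fin_genP I : fin_gen I <-> exists r, fg_ideal r I.
Proof.
split=> [[s hs ->]|[r [b [hb ->]]]].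
  exists (size s), (fun i => s`_i); split; last exact: adjs_ideal_gen.
  by move=> i; apply: hs; exact: mem_nth.
have H0 := is_ideal_zero A; exists [seq b i | i <- enum 'I_r].
  by move=> _ /mapP[i _ ->].
apply/seteqP; split.
  apply: ideal_gen_min; first exact: adjs_ideal.
  by move=> _ [i _ <-]; apply: mem_adjs => //; rewrite map_f // mem_enum.
apply: adjs_min; first exact: is_ideal_gen.
  by move=> _ ->; exact: ideal_gen0.
by move=> _ /mapP[i _ ->]; apply: sub_ideal_gen; exists i.
Qed.

(** Finitely many members of a chain lie in the largest of them. *)
Lemma chain_seq (F : set (set A)) (s : seq A) : F !=set0 -> total_on F subset ->
  (forall a, a \in s -> (\bigcup_(X in F) X) a) ->
  exists2 X, F X & forall a, a \in s -> X a.
Proof.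
move=> [X0 FX0] Ft; elim: s => [|a s IH] H; first by exists X0.
have [X FX Xs] := IH (fun b bs => H b (mem_behead (s := a :: s) bs)).
have [Y FY Ya] := H _ (mem_head _ _).
case: (Ft _ _ FX FY) => XY.
  by exists Y => // b; rewrite inE => /orP[/eqP ->//|/Xs/XY].
by exists X => // b; rewrite inE => /orP[/eqP ->|/Xs//]; exact: XY.
Qed.

Section Noetherian.
Hypothesis noeth : gnoetherian A.

(** The union of a chain of ideals is finitely generated, so it already occurs in the
    chain. *)
Lemma noeth_max (Q : set (set A)) I0 : Q I0 -> (forall I, Q I -> gideal I) ->
  exists I, [/\ Q I, I0 `<=` I & forall J, Q J -> I `<=` J -> J = I].
Proof.
move=> QI0 Qg; apply: zorn_above => // F FQ F0 Ft.
have Fg X : F X -> gideal X by move=> /FQ/Qg.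
have HU := gideal_bigcup F0 Ft Fg.
have [s hs sE] : fin_gen (\bigcup_(X in F) X) by apply/fin_genP; exact: noeth.
have [X FX Xs] : exists2 X, F X & forall a, a \in s -> X a.
  apply: chain_seq => // a as_; rewrite sE; apply: mem_adjs => //.
  exact: gideal_ideal gideal0.
suff -> : \bigcup_(X in F) X = X by exact: FQ.
apply/seteqP; split; last by move=> x Xx; exists X.
rewrite sE; apply: adjs_min => //; first exact: gideal_ideal (Fg _ FX).
by move=> _ ->; exact: is_ideal0 (gideal_ideal (Fg _ FX)).
Qed.

(** A colon ideal [(I : a)] that is maximal among the proper ones is prime: if [b] is
    not in it, then [(I : ba)] contains it, hence equals it. *)
Lemma colon_prime I : gideal I -> ~ I 1 ->
  exists a, [/\ homogen a, ~ I a & gprime (colon I a)].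
Proof.
move=> HI I1.
pose Q : set (set A) := [set K | exists a, [/\ homogen a, ~ I a & K = colon I a]].
have [||K [[a [ha Ia ->]] _ maxK]] := @noeth_max Q (colon I 1).
- by exists 1; split=> //; exact: homogen1.
- by move=> _ [a [ha _ ->]]; exact: gideal_colon.
exists a; split=> //; split; first exact: gideal_colon.
  by rewrite /colon /= mul1r.
move=> b c hb hc; rewrite /colon /= => H.
have [Ib|Ib] := pselect (I (b * a)); first by left.
right; rewrite -[I (c * a)]/(colon I a c) -(maxK (colon I (b * a))).
- by rewrite /colon /= mulrCA mulrA.
- by exists (b * a); split=> //; exact: homogenM.
- move=> x; rewrite /colon /= mulrCA.
  by apply: is_idealM; exact: gideal_ideal.
Qed.

(** In the localisation at [N] the quotient by [B] has finite length, since [N] is its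
    only prime; hence descending chains stop. The proof is by Noetherian induction on
    a lower bound [I] of the chain. If [(I : a) = N] then the saturation [I'] of [I +
    (a)] is one simple factor above [I]; a chain either stays above [I'], or
    eventually meets [I'] in [I] only and is then controlled by its sum with [I']. *)
Lemma sat_dcc N B (K : nat -> set A) : gprime N -> gideal B ->
  (forall Q, gprime Q -> B `<=` Q -> Q `<=` N -> Q = N) ->
  (forall n, [/\ gideal (K n), B `<=` K n, sat N (K n) `<=` K n & K n.+1 `<=` K n]) ->
  exists n, K n `<=` K n.+1.
Proof.
move=> HN HB minN; have HN' : gideal N by case: HN.
pose ok I (K : nat -> set A) := forall n,
  [/\ gideal (K n), I `<=` K n, sat N (K n) `<=` K n & K n.+1 `<=` K n].
pose Q : set (set A) := [set I | [/\ gideal I, B `<=` I, sat N I `<=` I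
  & exists K : nat -> set A, ok I K /\ ~ exists n, K n `<=` K n.+1]].
suff Q0 I : ~ Q I.
  move=> HK; apply: contrapT => nK; apply: (Q0 (sat N B)).
  split; [exact: gideal_sat|exact: sub_sat|exact: sat_sat|].
  exists K; split=> // n; have [K1 K2 K3 K4] := HK n; split=> //.
  by apply: subset_trans K3; exact: sat_mono.
move=> QI0; have [|{QI0}I0 [[HI BI sI [K' [K'ok nK']]] _ maxI]] := noeth_max QI0.
  by move=> J [].
move: I0 K' HI BI sI K'ok nK' maxI => {}I {}K HI BI sI Kok nK maxI.
apply: nK.
have [I1|I1] := pselect (I 1).
  by exists 0%N => x _; have [_ + _ _] := Kok 1%N; apply; rewrite (ideal1T (gideal_ideal HI) I1).
have [a [ha Ia primeC]] := colon_prime HI I1.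
(* [I] is saturated, so [(I : a)] lies in [N]; by minimality of [N] they agree. *)
have CN : colon I a = N.
  apply: minN => //.
    by move=> x /BI Ix; rewrite /colon /= mulrC; apply: is_idealM => //; exact: gideal_ideal.
  apply: sat_proper => //; first exact: gideal_colon.
    move=> x [s [hs Ns]]; rewrite /colon /= -mulrA => Isx.
    exact: (sat_fix sI hs Ns).
  by rewrite /colon /= mul1r.
have Na c : N c -> I (c * a) by rewrite -CN.
have HI2 := gideal_adj HI ha.
pose I' := sat N (adj I a).
have HI' : gideal I' by exact: gideal_sat.
have I'a : I' a by apply: sub_sat => //; apply: mem_adj; exact: gideal_ideal.
(* By maximality of [I], every chain above the larger ideal [I'] stops. *)
have phi (K1 : nat -> set A) : ok I' K1 -> exists n, K1 n `<=` K1 n.+1.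
  move=> K1ok; apply: contrapT => nK1.
  have II' : I `<=` I' by apply: subset_trans (sub_sat HN); exact: sub_adj.
  apply: Ia; rewrite -(maxI I') //; split=> //.
  - exact: subset_trans II'.
  - exact: sat_sat.
  - by exists K1.
have [Ka|] := pselect (forall n, K n a).
  apply: phi => n; have [K1 K2 K3 K4] := Kok n; split=> //.
  apply: subset_trans K3; apply: sat_mono; apply: adj_min => //.
  exact: gideal_ideal.
move=> /existsNP[n0 Kn0].
(* From [n0] on [a] is missing from the chain, so that [(K n : a)] lies in [N]. *)
have Kn0' n : ~ K (n + n0)%N a.
  by elim: n => // n IH Kn; apply: IH; have [_ _ _] := Kok (n + n0)%N; apply.
have [n nL] := phi (fun n => sat N (adj (K (n + n0)%N) a)) (fun n => 
  let: And4 K1 K2 K3 K4 := Kok (n + n0)%N in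
  And4 (gideal_sat HN (gideal_adj K1 ha))
    (sat_mono (adj_min (adj_ideal a (gideal_ideal K1))
      (subset_trans K2 (@sub_adj _ a)) (mem_adj a (gideal_ideal K1))))
    (@sat_sat N _ HN)
    (sat_mono (adj_min (adj_ideal a (gideal_ideal K1))
      (subset_trans K4 (@sub_adj _ a)) (mem_adj a (gideal_ideal K1))))).
exists (n + n0)%N => x Kx.
have [K1 K2 K3 K4] := Kok (n + n0)%N.
have [K1' K2' K3' K4'] := Kok (n.+1 + n0)%N.
have [s [hs Ns [y [c [Ky E]]]]] : sat N (adj (K (n.+1 + n0)%N) a) x.
  by apply: nL; apply: sub_sat => //; exact: sub_adj.
apply: (sat_fix K3' hs Ns); rewrite E; apply: is_idealD => //; first exact: gideal_ideal.
apply: K2'; apply: Na.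
have : colon (K (n + n0)%N) a `<=` N.
  apply: sat_proper => //; first exact: gideal_colon.
    move=> z [t [ht Nt]]; rewrite /colon /= -mulrA => Ktz.
    exact: (sat_fix K3 ht Nt).
  by rewrite /colon /= mul1r.
apply; rewrite /colon /=.
have -> : c * a = s * x - y by rewrite E addrC addKr.
by apply: is_idealB; [exact: gideal_ideal|apply: is_idealM => //; exact: gideal_ideal|exact: K4].
Qed.

(** Primality is only assumed for homogeneous factors; the factor [b] may be arbitrary
    because [(P : a)] is a graded ideal. *)
Lemma gprime_cancel P a b : gprime P -> homogen a -> ~ P a -> P (a * b) -> P b.
Proof.
move=> HP ha Pa Pab; have gP : gideal P by case: HP.
have : colon P a b by rewrite /colon /= mulrC.
apply: (gideal_sub (gideal_colon gP ha)); first exact: gideal_ideal.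
by move=> z hz; rewrite /colon /=; have [_ _ H] := HP; move=> /(H _ _ hz ha)[].
Qed.

Lemma gprimeX N x n : gprime N -> homogen x -> N (x ^+ n) -> N x.
Proof.
move=> HN hx; elim: n => [|n IH]; first by rewrite expr0; case: HN.
by rewrite exprS => Nx; have [_ _ /(_ _ _ hx (homogenX n hx) Nx)[]] := HN.
Qed.

(** Krull's principal ideal theorem. If no prime between [P] and [N] contained [u],
    then [N] would be minimal over [P + (u)] and [sat_dcc] would apply. Take [x] in
    [Q] but not in [P], and let [q n] be the contraction of [P + (x ^ n)] from the
    localisation at [Q]. The chain of the [q n + (u)] stops at [N], so [q n] lies in
    [q (n+1) + u (q n)] because [u] is not in [Q]; Nakayama gives [q n = q (n+1)],
    that is [x ^ n] in [P + (x ^ (n+1))] up to a factor outside [Q], which forces [x]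
    into [P]. *)
Lemma principal_ideal P Q N u : gprime P -> gprime Q -> gprime N ->
  P `<` Q -> Q `<` N -> homogen u -> N u ->
  exists Q', [/\ gprime Q', P `<` Q', Q' `<` N & Q' u].
Proof.
move=> HP HQ HN PQ QN hu Nu.
have [Qu|Qu] := pselect (Q u); first by exists Q.
apply: contrapT => nQ'.
have HP' : gideal P by case: HP.
have HQ' : gideal Q by case: HQ.
have HN' : gideal N by case: HN.
have [x [hx Qx Px]] := gideal_witness HQ' (gprime_ideal HP) (proj2 PQ).
have Pu : ~ P u by move=> /(proj1 PQ).
have minN Q' : gprime Q' -> adj P u `<=` Q' -> Q' `<=` N -> Q' = N.
  move=> HQ1 PQ1 Q1N; apply: contrapT => nE; apply: nQ'; exists Q'; split=> //.
  - split; first by apply: subset_trans PQ1; exact: sub_adj.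
    by move=> /(_ u) H; apply: Pu; apply: H; apply: PQ1; apply: mem_adj; exact: gprime_ideal.
  - by split=> // NQ; apply: nE; apply/seteqP.
  - by apply: PQ1; apply: mem_adj; exact: gprime_ideal.
pose q n := sat Q (adj P (x ^+ n)).
have Hq n : gideal (q n) by apply: gideal_sat => //; apply: gideal_adj => //; exact: homogenX.
have Hqi n := gideal_ideal (Hq n).
have Pq n : P `<=` q n by apply: subset_trans (sub_sat HQ); exact: sub_adj.
have qS n : q n.+1 `<=` q n.
  apply: sat_mono; apply: adj_min; [|exact: sub_adj|].
    by apply: adj_ideal; exact: gprime_ideal.
  rewrite exprS; apply: is_idealM; first by apply: adj_ideal; exact: gprime_ideal.
  by apply: mem_adj; exact: gprime_ideal.
have [|n Hn] := @sat_dcc N (adj P u) (fun n => sat N (adj (q n) u)) HN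
  (gideal_adj HP' hu) minN.
  move=> n; split.
  - by apply: gideal_sat => //; exact: gideal_adj.
  - apply: subset_trans (sub_sat HN); apply: adj_min; first exact: adj_ideal.
      by apply: subset_trans (Pq n) _; exact: sub_adj.
    exact: mem_adj.
  - exact: sat_sat.
  - apply: sat_mono; apply: adj_min; [exact: adj_ideal| |exact: mem_adj].
    by apply: subset_trans (qS n) _; exact: sub_adj.
have [l hl lE] : fin_gen (q n) by apply/fin_genP; exact: noeth.
have sub : q n `<=` sat N (q n.+1).
  apply: (nakayama HN (Hq n) (Hq n.+1) Nu hl lE) => y qy.
  have [s [hs Ns [z [c [qz E]]]]] : sat N (adj (q n.+1) u) y.
    by apply: Hn; apply: sub_sat => //; exact: sub_adj.
  exists s; split=> //; exists z, c; split=> //; last by rewrite E mulrC.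
  apply: (sat_fix (sat_sat (I := _) HQ) hu Qu).
  have -> : u * c = s * y - z by rewrite E addrC addKr mulrC.
  by apply: is_idealB (Hqi n) _ _ _ _; [exact: is_idealM|exact: qS].
have [t [ht Qt [y [c [Py E]]]]] : q n.+1 (x ^+ n).
  apply: (sat_sat HQ).
  have [s [hs Ns qs]] : sat N (q n.+1) (x ^+ n).
    by apply: sub; apply: sub_sat => //; apply: mem_adj; exact: gprime_ideal.
  by exists s; split=> // /(proj1 QN).
have Pt : P ((t - c * x) * x ^+ n).
  by rewrite mulrBl E exprS mulrA addrK.
have [d dt] := ht; have [e ex] := homogenX n hx.
have [k [dk Qk Pk]] := homogenize HP' HQ' dt ex (is_idealM (gprime_ideal HQ) c Qx) Pt.
have htk : homogen (t - k) by exists d; exact: (gradingB AP).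
have [_ _ /(_ _ _ htk (homogenX n hx) Pk)[]] := HP; last first.
  by move=> /(gprimeX HP hx).
move=> /(proj1 PQ) Qtk; apply: Qt; rewrite -[t](subrK k).
by apply: is_idealD => //; exact: gprime_ideal.
Qed.

Definition pchain (P : nat -> set A) (e : nat) :=
  (forall i, (i <= e)%N -> gprime (P i)) /\ (forall i, (i < e)%N -> P i `<` P i.+1).

Lemma pchain_sub (P : nat -> set A) e i j : pchain P e -> (i <= j <= e)%N -> P i `<=` P j.
Proof.
move=> [_ H] /andP[]; elim: j => [|j IH]; first by rewrite leqn0 => /eqP -> _ x.
rewrite leq_eqVlt => /orP[/eqP -> _ x //|ij] je.
by apply: subset_trans (IH _ (ltnW je)) (proj1 (H _ je)).
Qed.

(** The element [u] is pushed down the chain one prime at a time by [principal_ideal],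
    at the cost of the lowest prime. *)
Lemma pchain_move (P : nat -> set A) e u : homogen u -> pchain P e.+1 -> P e.+1 u ->
  exists P' : nat -> set A, [/\ pchain P' e, P 0%N `<=` P' 0%N, P' 0%N u & P' e = P e.+1].
Proof.
move=> hu; elim: e P => [|e IH] P HP Pu.
  exists (fun=> P 1%N); split=> //.
    by split=> // i _; exact: (proj1 HP).
  exact: proj1 (proj2 HP 0%N _).
(* [P (e+1)] is replaced by a prime between [P e] and [P (e+2)] that contains [u]. *)
have [Q [HQ PQ QN Qu]] := principal_ideal (proj1 HP e (leqW (leqnSn e)))
  (proj1 HP e.+1 (leqnSn _)) (proj1 HP e.+2 (leqnn _)) (proj2 HP e (leqnSn _))
  (proj2 HP e.+1 (leqnn _)) hu Pu.
have [|/=|P' [HP' PP' P'u P'e]] := IH (fun i => if (i <= e)%N then P i else Q).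
- split=> i ie.
    by case: ifP => // ie'; apply: (proj1 HP); apply: leqW; exact: leqW.
  rewrite -ltnS ie; case: ifP => ie'.
    by apply: (proj2 HP); apply: leqW; exact: ltnW.
  by have -> : i = e by lia.
- by rewrite ltnn.
exists (fun i => if (i <= e)%N then P' i else P e.+2); split=> //=; last by rewrite ltnn.
split=> i ie.
  by case: ifP => // ie'; [exact: (proj1 HP')|exact: (proj1 HP)].
rewrite -ltnS ie; case: ifP => ie'; first exact: (proj2 HP').
have -> : i = e by lia.
by rewrite P'e ltnn.
Qed.

End Noetherian.

(** * Regular local rings *)

Definition hchain J e := exists2 P : nat -> set A, pchain P e & J `<=` P 0%N.

Lemma hchain_sub I J e : I `<=` J -> hchain J e -> hchain I e.
Proof. by move=> IJ [P HP JP]; exists P => //; exact: subset_trans JP. Qed.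

Record noeth_local (M : set A) : Prop := NoethLocal {
  nl_noeth : gnoetherian A;
  nl_ideal : gideal M;
  nl_proper : ~ M 1;
  nl_max : forall I, gideal I -> ~ I 1 -> I `<=` M }.

Section Local.
Variable M : set A.
Hypothesis AM : noeth_local M.
Let noeth := nl_noeth AM.
Let M_gideal := nl_ideal AM.
Let M1 := nl_proper AM.
Let M_max := nl_max AM.

Lemma M_prime : gprime M.
Proof.
split=> // a b ha hb Mab; apply: contrapT => /not_orP[Ma Mb].
have HM := gideal_ideal M_gideal.
have : adj M a 1.
  apply: contrapT => n1; apply: Ma.
  by apply: (M_max (gideal_adj M_gideal ha) n1); exact: mem_adj.
move=> [y [c [My E]]]; apply: Mb.
rewrite -[b]mul1r E mulrDl -mulrA; apply: is_idealD => //; [exact: is_idealMr|exact: is_idealM].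
Qed.

Lemma sub_M_prime P : gprime P -> P `<=` M.
Proof. by move=> [HP P1 _]; exact: M_max. Qed.

(** The ideal generated by [x] is not contained in [M], so it is not proper. *)
Lemma hom_notM x : homogen x -> ~ M x -> exists c, c * x = 1.
Proof.
move=> hx Mx; have [H1|n1] := pselect (adj [set 0] x 1); last first.
  exfalso; apply: Mx; apply: (M_max (gideal_adj gideal0 hx) n1).
  by apply: mem_adj; exact: gideal_ideal gideal0.
by have [_ [c [-> E]]] := H1; exists c; rewrite E add0r.
Qed.

Lemma satM I : is_ideal I -> sat M I `<=` I.
Proof.
move=> HI x [s [hs Ms Is]]; have [c cs] := hom_notM hs Ms.
by rewrite -[x]mul1r -cs -mulrA; exact: is_idealM.
Qed.

(** Nakayama's lemma for one generator: [1 - c] is a unit, or rather its component of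
    degree 0 is. *)
Lemma nakayama1 I x c : gideal I -> homogen x -> M c -> I (x - c * x) -> I x.
Proof.
move=> HI [e ex] Mc; rewrite -{1}[x]mul1r -mulrBl => Ix.
have [k [dk Mk Ik]] := homogenize HI M_gideal (grading1 AP) ex Mc Ix.
apply: (satM (gideal_ideal HI)); exists (1 - k); split=> //.
  by exists 0; apply: (gradingB AP) => //; exact: (grading1 AP).
move=> M1k; apply: M1; rewrite -[1](subrK k); apply: is_idealD => //.
exact: gideal_ideal.
Qed.

(** The top of the chain may be replaced by [M], which contains [u]; then
    [pchain_move] applies. *)
Lemma hchain_adj J u e : homogen u -> M u -> hchain J e.+1 -> hchain (adj J u) e.
Proof.
move=> hu Mu [P HP JP].
have [||P' [HP' PP' P'u _]] := @pchain_move noeth (fun i => if (i <= e)%N then P i else M) e u hu.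
- split=> i ie.
    by case: ifP => // ie'; [exact: (proj1 HP)|exact: M_prime].
  rewrite -ltnS ie; case: ifP => ie'; first by apply: (proj2 HP).
  have -> : i = e by lia.
  have [sub nsub] := proj2 HP e (leqnn _); split.
    by apply: sub_M_prime; exact: (proj1 HP).
  move=> MP; apply: nsub; apply: subset_trans MP.
  by apply: sub_M_prime; exact: (proj1 HP).
- by rewrite ltnn.
exists P' => //; apply: adj_min => //.
- by apply: gprime_ideal; exact: (proj1 HP').
- by apply: subset_trans JP PP'.
Qed.

(** Krull's height theorem: each generator of [M] modulo [J] shortens a chain above
    [J] by at most one. *)
Lemma hchain_le J s e : gideal J -> (forall a, a \in s -> homogen a) ->
  M = adjs J s -> hchain J e -> (e <= size s)%N.
Proof.
elim: s J e => [|u s IH] J e HJ' hs ME.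
  case: e => // e [P HP JP]; have [sub nsub] := proj2 HP 0%N isT.
  exfalso; apply: nsub; apply: subset_trans JP.
  rewrite /= in ME; rewrite -ME.
  by apply: sub_M_prime; exact: (proj1 HP).
have hu : homogen u by apply: hs; rewrite mem_head.
case: e => // e HJ; rewrite ltnS; apply: (IH (adj J u)) => //.
- exact: gideal_adj.
- by move=> a as_; apply: hs; rewrite inE as_ orbT.
apply: hchain_adj => //.
by rewrite ME; apply: mem_adjs; [exact: gideal_ideal|rewrite mem_head].
Qed.

(** A regular local ring is a domain. Let [u] be the first parameter and [P 0] the
    bottom of a chain of maximal length. By induction [J + (u)] and [P 0 + (u)] are
    prime; they coincide, because otherwise a chain above [J + (u)] would be too long.
    Hence [P 0] is contained in [J + (u)], and as [u] is not in [P 0] this gives [P 0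
    = J + u (P 0)]. By Nakayama [P 0 = J]. *)
Lemma regular_prime J s : gideal J -> (forall a, a \in s -> homogen a) ->
  M = adjs J s -> hchain J (size s) -> gprime J.
Proof.
elim: s J => [|u s IH] J HJ hs ME; first by move=> _; rewrite /= in ME; rewrite -ME; exact: M_prime.
move=> HC; have [P HP JP] := HC.
have hu : homogen u by apply: hs; rewrite mem_head.
have hs' a : a \in s -> homogen a by move=> as_; apply: hs; rewrite inE as_ orbT.
have HJ' := gideal_ideal HJ.
have Mu : M u by rewrite ME; apply: mem_adjs => //; rewrite mem_head.
have HP0 : gprime (P 0%N) by exact: (proj1 HP).
have gP0 : gideal (P 0%N) by case: HP0.
have HP0' := gprime_ideal HP0.
have HPu : hchain (adj (P 0%N) u) (size s) by apply: hchain_adj => //; exists P.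
have JPu : adj J u `<=` adj (P 0%N) u.
  by apply: adj_min; [exact: adj_ideal| |exact: mem_adj];
     apply: subset_trans JP _; exact: sub_adj.
have gJu := gideal_adj HJ hu.
have MJ : M = adjs (adj J u) s by [].
have prJ : gprime (adj J u) by apply: IH => //; exact: hchain_sub HPu.
have Pu : ~ P 0%N u.
  move=> Pu; have : hchain (adj J u) (size s).+1.
    by exists P => //; exact: adj_min.
  by move=> /(hchain_le gJu hs' MJ); rewrite ltnn.
have P0J : P 0%N `<=` adj J u.
  apply: contrapT => nP; have [P' HP' PP'] := HPu.
  have : hchain (adj J u) (size s).+1.
    exists (fun i => if i is i'.+1 then P' i' else adj J u) => //.
    split; first by case=> // i ie; exact: (proj1 HP').
    case=> [_|i ie]; last exact: (proj2 HP').
    split; first exact: subset_trans PP'.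
    move=> sub; apply: nP; apply: subset_trans sub.
    by apply: subset_trans PP'; exact: sub_adj.
  by move=> /(hchain_le gJu hs' MJ); rewrite ltnn.
suff -> : J = P 0%N by [].
apply/seteqP; split=> //.
have [l hl lE] : fin_gen (P 0%N) by apply/fin_genP; exact: noeth.
apply: subset_trans (satM HJ').
apply: (nakayama M_prime gP0 HJ Mu hl lE) => x Px.
apply: (sub_sat M_prime).
have [y [c [Jy E]]] := P0J _ Px.
exists y, c; split=> //; last by rewrite mulrC.
apply: (gprime_cancel HP0 hu Pu).
by rewrite mulrC -[c * u](addKr y) -E addrC; apply: is_idealB => //; exact: JP.
Qed.

End Local.
End GradedIdeals.

(** * Filtrations with cyclic quotients *)

Section Filtrations.
Variables (A : gradedRing) (leaf : set A -> Prop).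
Implicit Types (x y a b c u : A) (I J K N P Q : set A).

(** The ideals of a chain from [J] up to the whole ring, each obtained from the
    previous one by adding one element; the successive quotients are the cyclic
    modules [A / (J : b)], whose annihilators are required to be leaves. *)
Inductive filtered : set A -> Prop :=
| FilteredT : filtered setT
| FilteredStep J b : gideal J -> homogen b -> leaf (colon J b) ->
    filtered (adj J b) -> filtered J.

(** The exact sequence [0 -> A/J2 -> A/J0 -> A/J1 -> 0] whose first map is
    multiplication by [b]. *)
Definition dissection J0 J1 J2 b := J1 = adj J0 b /\ J2 = colon J0 b.

(** A filtration of [A/J2] is carried into [A/J0] by multiplication by [b] and is
    continued by the filtration of [A/J1]. *)
Lemma dissection_filtered J0 J1 J2 b : gideal J0 -> homogen b ->
  dissection J0 J1 J2 b -> filtered J1 -> filtered J2 -> filtered J0.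
Proof.
move=> HJ0 hb [J1E J2E] F1 F2; move: F2 J0 HJ0 J1E J2E; elim.
  move=> J0 HJ0 J1E J2E; suff <- : J1 = J0 by [].
  rewrite J1E; apply/seteqP; split; last exact: sub_adj.
  apply: adj_min => //; first exact: gideal_ideal.
  have : colon J0 b 1 by rewrite -J2E.
  by rewrite /colon /= mul1r.
move=> J b' HJ hb' lJ _ IH J0 HJ0 J1E JE.
have HJ0' := gideal_ideal HJ0.
have hbb : homogen (b' * b) by exact: homogenM.
apply: (FilteredStep HJ0 hbb).
  suff -> : colon J0 (b' * b) = colon J b' by [].
  by rewrite JE; apply/seteqP; split=> x; rewrite /colon /= mulrA.
apply: IH; first exact: gideal_adj.
  rewrite J1E; apply/seteqP; split.
    apply: adj_min; first by do 2!apply: adj_ideal.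
      by apply: subset_trans (@sub_adj _ _ _); exact: sub_adj.
    by apply: mem_adj; exact: adj_ideal.
  apply: adj_min; [exact: adj_ideal| |exact: mem_adj].
  apply: adj_min; [exact: adj_ideal|exact: sub_adj|].
  by apply: is_idealM; [exact: adj_ideal|exact: mem_adj].
rewrite JE; apply/seteqP; split.
  move=> _ [y [c [Jy ->]]]; rewrite /colon /= in Jy *; rewrite mulrDl -mulrA.
  by exists (y * b), c.
move=> x [y [c [Jy E]]]; exists (x - c * b'), c; rewrite subrK; split=> //.
by rewrite /colon /= mulrBl E -mulrA addrK.
Qed.

Definition nzd J a := forall s, J (s * a) -> J s.

Fixpoint regseq J (s : seq A) : Prop :=
  if s is a :: s' then nzd J a /\ regseq (adj J a) s' else True.

(** An element acting injectively on the two ends of an exact sequence acts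
    injectively on the middle. *)
Lemma dissection_nzd J0 J1 J2 b a : gideal J0 -> dissection J0 J1 J2 b ->
  nzd J1 a -> nzd J2 a -> nzd J0 a.
Proof.
move=> /gideal_ideal HJ0 [-> ->] n1 n2 s Js.
have [y [c [Jy E]]] := n1 _ (@sub_adj _ _ b _ Js).
rewrite E; apply: is_idealD => //; apply: n2; rewrite /colon /=.
have -> : c * a * b = s * a - y * a by rewrite E mulrDl addrC addKr mulrAC.
by apply: is_idealB => //; exact: is_idealMr.
Qed.

(** The snake lemma: reduction modulo an element that acts injectively on the right
    end keeps the sequence exact. *)
Lemma dissection_adj J0 J1 J2 b a : gideal J0 -> dissection J0 J1 J2 b ->
  nzd J1 a -> dissection (adj J0 a) (adj J1 a) (adj J2 a) b.
Proof.
move=> /gideal_ideal HJ0 [-> ->] n1; split; first exact: (adjs_adj b [:: a]).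
apply/seteqP; split.
  move=> _ [y [c [Jy ->]]]; exists (y * b), (c * b).
  by split=> //; rewrite mulrDl mulrAC.
move=> s [y [c [Jy E]]].
have [z [d [Jz econst]]] : adj J0 b c.
  apply: n1; have -> : c * a = s * b - y by rewrite E addrC addKr.
  apply: is_idealB; first exact: adj_ideal.
    by apply: is_idealM; [exact: adj_ideal|exact: mem_adj].
  exact: sub_adj.
exists (s - d * a), d; rewrite subrK; split=> //.
rewrite /colon /= mulrBl E econst mulrDl mulrAC addrA addrK.
by apply: is_idealD => //; exact: is_idealMr.
Qed.

Lemma dissection_adjs J0 J1 J2 b s : gideal J0 ->
  (forall a, a \in s -> homogen a) -> dissection J0 J1 J2 b ->
  regseq J1 s -> regseq J2 s ->
  regseq J0 s /\ dissection (adjs J0 s) (adjs J1 s) (adjs J2 s) b.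
Proof.
elim: s J0 J1 J2 => [|a s IH] J0 J1 J2 HJ0 hs D //= [n1 r1] [n2 r2].
have n0 := dissection_nzd HJ0 D n1 n2.
have hs' c : c \in s -> homogen c by move=> cs; apply: hs; rewrite inE cs orbT.
have [r0 D'] := IH _ _ _ (gideal_adj HJ0 (hs _ (mem_head _ _))) hs'
  (dissection_adj HJ0 D n1) r1 r2.
by [].
Qed.

(** The two properties that must be carried along together: without the regularity of
    [s] a filtration of the factors would not give one of the product. *)
Definition good J s := regseq J s /\ filtered (adjs J s).

(** The quotients by [b] and by [c] are the ends of an exact sequence with the
    quotient by [c b] in the middle. *)
Lemma good_mul J b c s : gideal J -> homogen b -> homogen c ->
  (forall a, a \in s -> homogen a) -> nzd J b ->
  good (adj J b) s -> good (adj J c) s -> good (adj J (c * b)) s.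
Proof.
move=> HJ hb hc hs nb [r1 F1] [r2 F2].
have HJ' := gideal_ideal HJ.
have HJ0 := gideal_adj HJ (homogenM hc hb).
have D : dissection (adj J (c * b)) (adj J b) (adj J c) b.
  split.
    apply/seteqP; split.
      apply: adj_min; [by do 2!apply: adj_ideal| |by apply: mem_adj; exact: adj_ideal].
      by apply: subset_trans (@sub_adj _ _ _); exact: sub_adj.
    apply: adj_min; [exact: adj_ideal| |exact: mem_adj].
    apply: adj_min; [exact: adj_ideal|exact: sub_adj|].
    by apply: is_idealM; [exact: adj_ideal|exact: mem_adj].
  apply/seteqP; split.
    move=> _ [y [d [Jy ->]]]; exists (y * b), d; split; first exact: is_idealMr.
    by rewrite mulrDl mulrA.
  move=> x [y [d [Jy E]]]; exists (x - d * c), d; rewrite subrK; split=> //.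
  by apply: nb; rewrite mulrBl E -mulrA addrK.
have [r0 D'] := dissection_adjs HJ0 hs D r1 r2; split=> //.
by apply: (dissection_filtered _ hb D') => //; exact: gideal_adjs.
Qed.

Lemma regseqT s : regseq setT s.
Proof.
elim: s => //= a s IH; split=> //; rewrite (_ : adj _ _ = setT) //.
by apply/seteqP; split=> // x _; exact: sub_adj.
Qed.

Lemma adjsT s : adjs [set: A] s = setT.
Proof. by apply/seteqP; split=> // x _; exact: sub_adjs. Qed.

Lemma goodT s : good setT s.
Proof. by split; [exact: regseqT|rewrite adjsT; exact: FilteredT]. Qed.

Lemma good_prod J (fs : seq A) s : gideal J ->
  (forall a, a \in s -> homogen a) ->
  (forall f, f \in fs -> [/\ homogen f, nzd J f & good (adj J f) s]) ->
  good (adj J (\prod_(f <- fs) f)) s.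
Proof.
move=> HJ hs; elim: fs => [|f fs IH] H.
  rewrite big_nil (_ : adj J 1 = setT); first exact: goodT.
  by apply: ideal1T; [apply: adj_ideal|apply: mem_adj]; exact: gideal_ideal.
have Hfs g : g \in fs -> [/\ homogen g, nzd J g & good (adj J g) s].
  by move=> gfs; apply: H; rewrite inE gfs orbT.
have [hf nf gf] := H _ (mem_head _ _).
rewrite big_cons mulrC; apply: good_mul => //; last exact: IH.
elim: fs Hfs {IH H} => [|g fs IH] H; first by rewrite big_nil; exact: homogen1.
rewrite big_cons; apply: homogenM; first by have [] := H _ (mem_head _ _).
by apply: IH => k kfs; apply: H; rewrite inE kfs orbT.
Qed.

End Filtrations.

(** * Quotients by graded ideals *)

Section QuotientTransfer.
Variables (S : gradedRing).
Implicit Types (D I J K : set S).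

Lemma gqidealE D : gideal D -> gqideal D = D.
Proof.
move=> HD; have HD' := gideal_ideal HD; apply/seteqP; split.
  by apply: ideal_gen_min => // x [].
apply: gideal_sub => //; first exact: gideal_ideal (gideal_gen D).
by move=> x hx Dx; apply: sub_ideal_gen.
Qed.

Variables (D : set S).
Notation R := (gquot D).
Definition qpi : {rmorphism S -> R} := @gq_pi S D.

Lemma qpi_eq x y : qpi x = qpi y <-> gqideal D (x - y).
Proof. exact: gq_eq. Qed.

Lemma qpi_eq0 x : qpi x = 0 <-> gqideal D x.
Proof. by rewrite -(rmorph0 qpi) qpi_eq subr0. Qed.

Lemma qpi_surj (y : R) : exists x, qpi x = y.
Proof. by exists (gq_repr y); exact: gq_reprK. Qed.

Lemma qpi_hom d x : ghom d x -> ghom d (qpi x).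
Proof. by move=> dx; exists x. Qed.

Lemma qpi_homogen x : homogen x -> homogen (qpi x).
Proof. by move=> [d /qpi_hom]; exists d. Qed.

Lemma qpi_hom_surj d (y : R) : ghom d y -> exists2 x, ghom d x & qpi x = y.
Proof. by []. Qed.

Lemma preimage_ideal (I : set R) : is_ideal I -> is_ideal (qpi @^-1` I).
Proof.
move=> HI; split=> [|x y Ix Iy|a x Ix]; rewrite /preimage /=.
- by rewrite rmorph0; exact: (is_ideal0 HI).
- by rewrite rmorphD; exact: (is_idealD HI).
- by rewrite rmorphM; exact: (is_idealM HI).
Qed.

Lemma preimage_gideal (I : set R) : gideal I -> gideal (qpi @^-1` I).
Proof.
move=> HI; apply: gidealI; first by apply: preimage_ideal; exact: gideal_ideal.
move=> x Ix; have [s [f [us fh f0 xE]]] := hom_dec x.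
exists s, f; split=> // d; case: (boolP (d \in s)) => [ds|/f0 ->]; last first.
  by rewrite /preimage /= rmorph0; exact: is_ideal0 (gideal_ideal HI).
apply: (gideal_comp HI us (fun k => qpi_hom (fh k)) _ ds).
by rewrite -rmorph_sum -xE.
Qed.

Lemma preimage_sub (I : set R) : is_ideal I -> gqideal D `<=` qpi @^-1` I.
Proof. by move=> HI x /qpi_eq0 E; rewrite /preimage /= E; exact: is_ideal0. Qed.

Lemma image_preimage (I : set R) : qpi @` (qpi @^-1` I) = I.
Proof.
apply/seteqP; split; first by move=> _ [x Ix <-].
by move=> y Iy; have [x E] := qpi_surj y; exists x; rewrite /preimage /= E.
Qed.

Lemma image_in (K : set S) x : is_ideal K -> gqideal D `<=` K ->
  (qpi @` K) (qpi x) <-> K x.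
Proof.
move=> HK DK; split=> [[y Ky /qpi_eq/DK Kxy]|Kx]; last by exists x.
rewrite -[x](subKr y); exact: is_idealB.
Qed.

Lemma image_gideal (K : set S) : gideal K -> gideal (qpi @` K).
Proof.
move=> HK; have HK' := gideal_ideal HK; apply: gidealI.
  split.
  - by exists 0; [exact: is_ideal0|exact: rmorph0].
  - by move=> _ _ [x Kx <-] [y Ky <-]; exists (x + y); [exact: is_idealD|exact: rmorphD].
  - move=> a _ [x Kx <-]; have [b <-] := qpi_surj a.
    by exists (b * x); [exact: is_idealM|exact: rmorphM].
move=> _ [x Kx <-]; have [s [f [fh fK ->]]] := gideal_dec HK Kx.
exists s, (fun d => qpi (f d)); split.
- by move=> d; exact: qpi_hom.
- by move=> d; exists (f d).
- exact: rmorph_sum.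
Qed.

Lemma image_adjs (K : set S) s :
  qpi @` (adjs K s) = adjs (qpi @` K) (map qpi s).
Proof.
elim: s K => //= a s IH K; rewrite IH.
suff -> : qpi @` adj K a = adj (qpi @` K) (qpi a) by [].
apply/seteqP; split.
  move=> _ [_ [y [c [Ky ->]]] <-]; exists (qpi y), (qpi c); rewrite rmorphD rmorphM.
  by split=> //; exists y.
move=> _ [_ [c [[y Ky <-] ->]]]; have [d <-] := qpi_surj c.
by exists (y + d * a); [exists y, d|rewrite rmorphD rmorphM].
Qed.

Lemma image_D : gideal D -> qpi @` D = [set 0].
Proof.
move=> HD; apply/seteqP; split.
  by move=> _ [x Dx <-] /=; apply/qpi_eq0; rewrite gqidealE.
by move=> _ ->; exists 0; [exact: is_ideal0 (gideal_ideal HD)|exact: rmorph0].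
Qed.

Lemma preimage_prime (P : set R) : gprime P -> gprime (qpi @^-1` P).
Proof.
move=> [HP P1 H]; split; first exact: preimage_gideal.
  by rewrite /preimage /= rmorph1.
move=> a b ha hb; rewrite /preimage /= rmorphM.
by apply: H; exact: qpi_homogen.
Qed.

Lemma image_prime (P : set S) : gqideal D `<=` P -> gprime P -> gprime (qpi @` P).
Proof.
move=> DP HP; have HP' := gprime_ideal HP; have [gP P1 H] := HP; split.
- exact: image_gideal.
- by rewrite -(rmorph1 qpi) image_in.
- move=> _ _ [d [a da <-]] [e [b eb <-]]; rewrite -[gq_pi D a]/(qpi a) -[gq_pi D b]/(qpi b).
  rewrite -rmorphM !image_in //.
  by apply: H; [exists d|exists e].
Qed.

Lemma preimage_inj (I K : set R) : qpi @^-1` I `<=` qpi @^-1` K -> I `<=` K.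
Proof.
by move=> IK y; have [x <-] := qpi_surj y; exact: IK.
Qed.

Section Regular.
Variable M : set S.
Hypothesis SM : noeth_local M.
Hypothesis HD : gideal D.

(** Prime ideals of the quotient are the prime ideals above [D], so its Krull
    dimension is computed by chains above [D]. *)
Lemma quotient_regular (s : seq S) : (forall a, a \in s -> homogen a) ->
  M = adjs D s -> hchain D (size s) -> regular_local R (size s).
Proof.
move=> hs ME HC; have HD' := gideal_ideal HD; have DE := gqidealE HD.
have DM : D `<=` M by rewrite ME; exact: sub_adjs.
split.
- move=> I HI; have [l hl lE] : fin_gen (qpi @^-1` I).
    by apply/fin_genP; apply: (nl_noeth SM); exact: preimage_gideal.
  apply/fin_genP; exists (map qpi l).
    by move=> _ /mapP[a al ->]; apply: qpi_homogen; exact: hl.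
  rewrite -(image_preimage I) lE image_adjs; congr adjs.
  apply/seteqP; split; first by move=> _ [_ -> <-] /=; rewrite rmorph0.
  by move=> _ ->; exists 0; [|exact: rmorph0].
- split.
    have [P HP DP] := HC; exists (fun i => qpi @` (P i)).
    have DPi i : (i <= size s)%N -> gqideal D `<=` P i.
      by move=> ie; rewrite DE; apply: subset_trans DP (pchain_sub HP _); rewrite leq0n.
    split=> i ie; first by apply: image_prime; [exact: DPi|exact: (proj1 HP)].
    have [sub nsub] := proj2 HP i ie; split; first exact: image_subset.
    move=> sub'; apply: nsub => x Px.
    apply/(image_in _ (gprime_ideal (proj1 HP i (ltnW ie))) (DPi _ (ltnW ie))).
    by apply: sub'; exists x.
  move=> e [P [HP PP]].
  apply: (hchain_le SM HD hs ME).
  exists (fun i => qpi @^-1` (P i)).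
    split=> i ie; first by apply: preimage_prime; exact: HP.
    have [sub nsub] := PP i ie; split; first by move=> x; exact: sub.
    by move=> /preimage_inj.
  by rewrite -{1}DE; apply: preimage_sub; apply: gprime_ideal; exact: HP.
- exists (qpi @` M).
  have MP := M_prime SM.
  have DM' : gqideal D `<=` M by rewrite DE.
  have [gM' M1' _] := image_prime DM' MP.
  have maxM (I : set R) : gideal I -> ~ I 1 -> I `<=` qpi @` M.
    move=> HI I1; rewrite -(image_preimage I); apply: image_subset.
    apply: (nl_max SM); first exact: preimage_gideal.
    by rewrite /preimage /= rmorph1.
  split; last first.
    rewrite -(size_map qpi s); exists (fun i => (map qpi s)`_i); split=> [i|].
      have /mapP[a al ->] := mem_nth 0 (ltn_ord i).
      by apply: qpi_homogen; exact: hs.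
    rewrite ME image_adjs image_D //.
    by rewrite adjs_ideal_gen.
  split.
    split=> // I HI I1 MI; apply/seteqP; split=> //; exact: maxM.
  move=> N [HN N1 maxN]; apply: maxN => //; exact: maxM.
Qed.

End Regular.
End QuotientTransfer.

Section FreeQuotient.
Variables (S : gradedRing) (Q : set S).
Notation A := (gquot Q).
Notation pi := (qpi Q).

Lemma gquot_lift (D : set S) : gideal D -> gqideal Q `<=` D ->
  exists rho : {rmorphism A -> gquot D}, graded_map rho /\ forall x, rho (pi x) = qpi D x.
Proof.
move=> HD QD.
pose r (y : A) : gquot D := qpi D (gq_repr y).
have rE x : r (pi x) = qpi D x.
  apply/qpi_eq; rewrite gqidealE //; apply: QD.
  by apply/qpi_eq; exact: gq_reprK.
have rB : zmod_morphism r.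
  move=> x y; have [a <-] := qpi_surj x; have [b <-] := qpi_surj y.
  by rewrite -rmorphB !rE rmorphB.
have rM : monoid_morphism r.
  split; first by rewrite -(rmorph1 pi) rE rmorph1.
  move=> x y; have [a <-] := qpi_surj x; have [b <-] := qpi_surj y.
  by rewrite -rmorphM !rE rmorphM.
pose ra := GRing.isZmodMorphism.Build A (gquot D) r rB.
pose rm := GRing.isMonoidMorphism.Build A (gquot D) r rM.
pose rho : {rmorphism A -> gquot D} := HB.pack r ra rm.
exists rho; split=> // d y /qpi_hom_surj[x dx <-].
by rewrite [rho _]rE; exact: qpi_hom.
Qed.

(** Sending [y + c b], for [y] in [J], to the class of [c] identifies the quotient [(J
    + (b)) / J] with a shift of the ring [S / (J : b)]. The coefficient [c] is only
    determined modulo the colon ideal, so it is chosen; for homogeneous elements it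
    may be taken homogeneous. *)
Lemma adj_free (J : set S) (b : S) : gideal J -> gqideal Q `<=` J -> homogen b ->
  free_quotient (gquot (colon J b)) (pi @` (adj J b)) (pi @` J).
Proof.
move=> HJ QJ hb; have HJ' := gideal_ideal HJ.
have HC := gideal_colon HJ hb.
have QC : gqideal Q `<=` colon J b.
  by move=> x /QJ Jx; rewrite /colon /=; exact: is_idealMr.
have [rho [rho_gr rhoE]] := gquot_lift HC QC.
have QJb : gqideal Q `<=` adj J b by apply: subset_trans QJ _; exact: sub_adj.
have HJb := adj_ideal b HJ'.
exists rho; split=> //.
have [e eb] := hb.
have /choice[c cP] : forall y : A, exists c : S,
    forall x, pi x = y -> adj J b x -> J (x - c * b).
  move=> y; have [[x E Jx]|n] := pselect (exists2 x, pi x = y & adj J b x); last first.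
    by exists 0 => x E Jx; case: n; exists x.
  have [z [c [Jz xE]]] := Jx; exists c => x' E' _.
  have -> : x' - c * b = (x' - x) + z by rewrite xE; ring.
  by apply: is_idealD => //; apply: QJ; apply/qpi_eq; rewrite E'.
have econst x k : adj J b x -> J (x - k * b) -> qpi (colon J b) (c (pi x)) = qpi (colon J b) k.
  move=> Jx Jk; apply/qpi_eq; rewrite gqidealE // /colon /= mulrBl.
  have -> : c (pi x) * b - k * b = (x - k * b) - (x - c (pi x) * b).
    by ring.
  by apply: is_idealB => //; exact: cP.
exists 1%N, (fun=> e), (fun y => const_mx (qpi (colon J b) (c y))); split.
- move=> _ _ [x Jx <-] [y Jy <-]; rewrite -rmorphD (@econst _ (c (pi x) + c (pi y))).
  + by rewrite rmorphD; apply/matrixP => i j; rewrite !mxE.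
  + exact: is_idealD.
  + have -> : x + y - (c (pi x) + c (pi y)) * b = (x - c (pi x) * b) + (y - c (pi y) * b).
      by rewrite mulrDl opprD addrACA.
    by apply: is_idealD => //; exact: cP.
- move=> k _ [x Jx <-]; have [a <-] := qpi_surj k.
  rewrite -rmorphM (@econst _ (a * c (pi x))).
  + by rewrite rmorphM rhoE; apply/matrixP => i j; rewrite !mxE.
  + exact: is_idealM.
  + by rewrite -mulrA -mulrBr; apply: is_idealM => //; exact: cP.
- move=> _ [x Jx <-]; rewrite image_in //.
  have E0 : (const_mx (qpi (colon J b) (c (pi x))) = 0 :> 'rV[gquot (colon J b)]_1)
     <-> colon J b (c (pi x)).
    split=> [/matrixP/(_ ord0 ord0)|E].
      by rewrite !mxE => /qpi_eq0; rewrite gqidealE.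
    by apply/matrixP => i j; rewrite !mxE; apply/qpi_eq0; rewrite gqidealE.
  rewrite E0 /colon /=; have Jc := cP (pi x) x erefl Jx; split=> H.
    by rewrite -[x](subrK (c (pi x) * b)); exact: is_idealD.
  rewrite -[_ * b](subKr x); exact: is_idealB.
- move=> u; have [k uE] := qpi_surj (u ord0 ord0).
  exists (pi (k * b)).
    by exists (k * b) => //; apply: is_idealM => //; exact: mem_adj.
  rewrite (@econst _ k).
  + by rewrite uE; apply/matrixP => i j; rewrite !mxE !ord1.
  + by apply: is_idealM => //; exact: mem_adj.
  + by rewrite subrr; exact: is_ideal0.
- move=> d _ /qpi_hom_surj[x dx <-]; rewrite image_in // => Jx i.
  have [y [k [Jy xE]]] := Jx.
  have [|k' [dk' _ Jk']] := @hom_coef S J d e x b k HJ dx eb.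
    by rewrite xE addrK.
  by rewrite mxE (@econst _ k') //; exact: qpi_hom.
Qed.

Variable w : nat.

Lemma filtered_quotient J : gideal J -> gqideal Q `<=` J ->
  filtered (fun D => regular_local (gquot D) w) J ->
  exists (N : nat) (I : nat -> set A),
    [/\ I 0%N = pi @` J,
        I N = setT,
        (forall j, (j <= N)%N -> gideal (I j))
      & forall j, (j < N)%N ->
          I j `<=` I j.+1 /\
          exists R : gradedRing,
            regular_local R w /\ free_quotient R (I j.+1) (I j)].
Proof.
move=> HJ QJ F; elim: F HJ QJ => [_ _|{}J b HJ hb lJ F IH _ QJ].
  exists 0%N, (fun=> setT); split=> //.
    apply/seteqP; split=> // y _; have [x <-] := qpi_surj y; by exists x.
  by move=> j _; exact: gidealT.
have [||N [I [I0 IN Ig If]]] := IH.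
- exact: gideal_adj.
- by apply: subset_trans QJ _; exact: sub_adj.
exists N.+1, (fun j => if j is j'.+1 then I j' else pi @` J); split=> //.
  by case=> [_|j jN]; [exact: image_gideal|exact: Ig].
case=> [_|j jN]; last exact: If.
rewrite I0; split; first by apply: image_subset; exact: sub_adj.
by exists (gquot (colon J b)); split=> //; exact: adj_free.
Qed.

End FreeQuotient.

(** * Regular systems of parameters *)

Section Congruences.
Variable S : gradedRing.
Implicit Types (a b c f g h x y z : S) (I J : set S).

Lemma congr_sym J a b : is_ideal J -> J (a - b) -> J (b - a).
Proof. by move=> HJ Jab; rewrite -opprB; exact: is_idealN. Qed.

Lemma congr_trans J b a c : is_ideal J -> J (a - b) -> J (b - c) -> J (a - c).
Proof. by move=> HJ Jab Jbc; rewrite -[a](subrK b) -addrA; exact: is_idealD. Qed.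

Lemma congr_mul J a b c d : is_ideal J -> J (a - b) -> J (c - d) -> J (a * c - b * d).
Proof.
move=> HJ Jab Jcd.
have -> : a * c - b * d = (a - b) * c + b * (c - d) by ring.
by apply: is_idealD => //; [exact: is_idealMr|exact: is_idealM].
Qed.

Lemma congr_exp J a b n : is_ideal J -> J (a - b) -> J (a ^+ n - b ^+ n).
Proof.
move=> HJ Jab; elim: n => [|n IH]; first by rewrite !expr0 subrr; exact: is_ideal0.
by rewrite !exprS; exact: congr_mul.
Qed.

Lemma adj_congr J a b : is_ideal J -> J (a - b) -> adj J a = adj J b.
Proof.
move=> HJ Jab; apply/seteqP; split; apply: adj_min; try exact: adj_ideal; try exact: sub_adj.
  by exists (a - b), 1; rewrite mul1r subrK.
by exists (b - a), 1; rewrite mul1r subrK; split=> //; exact: congr_sym.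
Qed.

Lemma adj_in J a : is_ideal J -> J a -> adj J a = J.
Proof. by move=> HJ Ja; apply/seteqP; split; [exact: adj_min|exact: sub_adj]. Qed.

Lemma gprime_nzd J a : gprime J -> homogen a -> ~ J a -> nzd J a.
Proof. by move=> HJ ha Ja s; rewrite mulrC; exact: gprime_cancel. Qed.

(** In the domain [S/J] the primes [g i] do not divide one another, so an element
    divisible by each [g i ^ q] is divisible by their product. *)
Lemma prime_power_divides J (T : eqType) (g : T -> S) (s : seq T) q P :
  gprime J -> (forall i, homogen (g i)) -> (forall i, ~ J (g i)) ->
  (forall i, gprime (adj J (g i))) ->
  (forall i j, i != j -> ~ adj J (g i) (g j)) ->
  (forall i, exists h, J (P - g i ^+ q * h)) -> uniq s ->
  exists h, J (P - (\prod_(i <- s) g i ^+ q) * h).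
Proof.
move=> HJ hg Jg prg ng dg; have HJ' := gprime_ideal HJ.
elim: s => [_|i s IH /= /andP[is_ us]].
  by exists P; rewrite big_nil mul1r subrr; exact: is_ideal0.
have [h Jh] := IH us; have [h1 Jh1] := dg i.
set G := \prod_(i <- s) _ in Jh *.
have hG : homogen G /\ ~ adj J (g i) G.
  rewrite /G; elim: (s) is_ => [|j t IHt]; rewrite ?inE.
    by rewrite big_nil; split; [exact: homogen1|case: (prg i)].
  rewrite negb_or => /andP[ij it]; have [h2 n2] := IHt it; rewrite big_cons; split.
    by apply: homogenM => //; exact: homogenX.
  apply: gprimeM => //; first exact: homogenX.
  by move=> /(gprimeX (prg i) (hg j)); exact: ng.
have [{}hG nG] := hG.
have GhE : J (G * h - g i ^+ q * h1).
  by apply: (congr_trans HJ' (congr_sym HJ' Jh) Jh1).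
have H r : (r <= q)%N -> exists h', J (h - g i ^+ r * h').
  elim: r => [_|r IHr rq]; first by exists h; rewrite mul1r subrr; exact: is_ideal0.
  have [h' Jh'] := IHr (ltnW rq).
  have : J (g i ^+ r * (G * h' - g i ^+ (q - r) * h1)).
    have -> : g i ^+ r * (G * h' - g i ^+ (q - r) * h1) =
        (G * h - g i ^+ r * g i ^+ (q - r) * h1) - G * (h - g i ^+ r * h') by ring.
    rewrite -exprD subnKC 1?ltnW //; apply: is_idealB => //; exact: is_idealM.
  move=> /(gprime_cancel HJ (homogenX r (hg i)) (fun H => Jg i (gprimeX HJ (hg i) H))).
  move=> H.
  have : adj J (g i) (G * h').
    exists (G * h' - g i ^+ (q - r) * h1), (g i ^+ (q - r.+1) * h1); split=> //.
    by rewrite mulrAC -exprSr subnSK // subrK.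
  move=> /(gprime_cancel (prg i) hG nG)[y [c [Jy econst]]].
  exists c; rewrite exprSr -mulrA [g i * c]mulrC.
  have -> : h - g i ^+ r * (c * g i) = (h - g i ^+ r * h') + g i ^+ r * y by rewrite econst; ring.
  by apply: is_idealD => //; exact: is_idealM.
have [h' Jh'] := H q (leqnn q).
exists h'; rewrite big_cons -/G.
have -> : P - g i ^+ q * G * h' = (P - G * h) + G * (h - g i ^+ q * h') by ring.
by apply: is_idealD => //; exact: is_idealM.
Qed.

End Congruences.

Section RegularSystems.
Variables (S : gradedRing) (M : set S).
Hypothesis SM : noeth_local M.
Implicit Types (a b c f g h x y z : S) (I J : set S).

(** [S/J] is a regular local ring of dimension [size l], and [l] is a regular system
    of parameters. *)
Definition params J (l : seq S) : Prop :=
  [/\ gideal J, forall a, a \in l -> homogen a, M = adjs J l & hchain J (size l)].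

Lemma params_prime J l : params J l -> gprime J.
Proof. by move=> [HJ hl ME HC]; exact: (regular_prime SM HJ hl ME HC). Qed.

Lemma params_in J l a : params J l -> a \in l -> homogen a /\ M a.
Proof.
move=> [HJ hl ME HC] al; split; first exact: hl.
by rewrite ME; apply: mem_adjs => //; exact: gideal_ideal.
Qed.

Lemma params_sub J l : params J l -> J `<=` M.
Proof. by move=> [_ _ -> _]; exact: sub_adjs. Qed.

Lemma params_adj J a l : params J (a :: l) -> params (adj J a) l.
Proof.
move=> Pal; have [ha Ma] := params_in Pal (mem_head _ _).
have [HJ hl ME HC] := Pal.
split=> //; first exact: gideal_adj.
- by move=> b bl; apply: hl; rewrite inE bl orbT.
- exact: (hchain_adj SM).
Qed.

(** If [a] were in [J], then the maximal ideal would have too few generators for the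
    length of the chain. *)
Lemma params_notin J a l : params J (a :: l) -> ~ J a.
Proof.
move=> [HJ hl ME HC] Ja.
rewrite /= adj_in // in ME; last exact: gideal_ideal.
have := hchain_le SM HJ _ ME HC.
by rewrite ltnn => H; have : false by apply: H => b bl; apply: hl; rewrite inE bl orbT.
Qed.

Lemma params_adjs J l1 l2 : params J (l1 ++ l2) -> params (adjs J l1) l2.
Proof. by elim: l1 J => //= a l IH J /params_adj/IH. Qed.

(** The new list generates the old one and therefore [M]; the length of the chain
    above [J] does not depend on the list. *)
Lemma params_change J l l' : params J l -> size l' = size l ->
  (forall a, a \in l' -> homogen a /\ M a) ->
  (forall a, a \in l -> adjs J l' a) -> params J l'.
Proof.
move=> Pl sl hl' H; have [HJ hl ME HC] := Pl.
have HJ' := gideal_ideal HJ; split=> //; last by rewrite sl.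
  by move=> a /hl'[].
apply/seteqP; split.
  by rewrite ME; apply: adjs_min => //; [exact: adjs_ideal|exact: sub_adjs].
apply: adjs_min; [exact: gideal_ideal (nl_ideal SM)| |by move=> a /hl'[]].
exact: params_sub Pl.
Qed.

Lemma params_leaf J l : params J l -> regular_local (gquot J) (size l).
Proof. by move=> [HJ hl ME HC]; exact: (quotient_regular SM HJ hl ME HC). Qed.

End RegularSystems.

(** * The tower of torsion points *)

Section Tower.
Variables (S : gradedRing) (M : set S) (p m w : nat).
Hypothesis p_pr : prime p.
Hypothesis SM : noeth_local M.
Implicit Types (a b c f g h y z : S) (I J : set S) (K : seq nat).

Variables (x v : nat -> S) (pt : set S) (fadd : S -> S -> S).
Local Notation nmul n f := (iter n (fadd f) 0).
Local Notation ps f := (nmul p f).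

Hypothesis Hparams : params M [set 0] (map v (iota 0 w) ++ map x (iota 0 w)).
Hypothesis Mp : M p%:R.
Hypothesis pt_hom : forall f, pt f -> ghom 2 f.
Hypothesis pt0 : pt 0.
Hypothesis ptx : forall i, (i < w)%N -> pt (x i).
Hypothesis ptD : forall f g, pt f -> pt g -> pt (fadd f g).
Hypothesis faddC : forall f g, pt f -> pt g -> fadd f g = fadd g f.
Hypothesis faddA : forall f g h, pt f -> pt g -> pt h ->
  fadd f (fadd g h) = fadd (fadd f g) h.
Hypothesis fadd0 : forall f, pt f -> fadd f 0 = f.
Hypothesis faddE : forall f g, pt f -> pt g -> exists h, fadd f g = f + g + f * g * h.
Hypothesis faddB : forall f f' g, pt f -> pt f' -> pt g ->
  exists h, fadd f g - fadd f' g = (f - f') * h.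
Hypothesis psE : forall f, pt f -> exists h, ps f = f ^+ (p ^ m) * h.
Hypothesis psxE : forall i k, (i < w)%N -> (k < w)%N -> exists c c' h,
  let Jk := adjs [set 0] (map v (iota 0 k)) in
  [/\ Jk c, Jk c' & ps (x i) = c + x i ^+ (p ^ (m + k)) * (v k + c' + x i * h)].

Let pt_homogen f : pt f -> homogen f.
Proof. by move=> /pt_hom; exists 2. Qed.

Lemma pt_nmul n f : pt f -> pt (nmul n f).
Proof. by move=> ptf; elim: n => //= n IH; exact: ptD. Qed.

(** The interchange law of a commutative group, which makes multiplication by [n]
    additive. *)
Lemma faddACA a b c d : pt a -> pt b -> pt c -> pt d ->
  fadd (fadd a b) (fadd c d) = fadd (fadd a c) (fadd b d).
Proof.
move=> pa pb pc pd.
rewrite -faddA //; last exact: ptD.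
rewrite [fadd b (fadd c d)]faddA // [fadd b c]faddC // -faddA // faddA //.
exact: ptD.
Qed.

Lemma nmul_fadd n f g : pt f -> pt g ->
  nmul n (fadd f g) = fadd (nmul n f) (nmul n g).
Proof.
move=> pf pg; elim: n => [|n IH] /=; first by rewrite fadd0.
by rewrite IH faddACA //; exact: pt_nmul.
Qed.

Lemma nmul0 n : nmul n 0 = 0.
Proof. by elim: n => //= n ->; exact: fadd0. Qed.

Lemma fadd_in J f g : is_ideal J -> pt f -> pt g -> J f -> J g -> J (fadd f g).
Proof.
move=> HJ pf pg Jf Jg; have [h ->] := faddE pf pg.
by apply: is_idealD => //; [exact: is_idealD|rewrite -mulrA; exact: is_idealMr].
Qed.

Lemma fadd_congr J f g : is_ideal J -> pt f -> pt g -> J g -> J (fadd f g - f).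
Proof.
move=> HJ pf pg Jg; have [h ->] := faddE pf pg.
have -> : f + g + f * g * h - f = g * (1 + f * h) by ring.
exact: is_idealMr.
Qed.

Lemma nmul_in J n f : is_ideal J -> pt f -> J f -> J (nmul n f).
Proof.
move=> HJ pf Jf; elim: n => [|n IH] /=; first exact: is_ideal0.
by apply: fadd_in => //; exact: pt_nmul.
Qed.

Definition torsion J f := pt f /\ J (ps f).

Lemma torsion0 J : is_ideal J -> torsion J 0.
Proof. by move=> HJ; split=> //; rewrite nmul0; exact: is_ideal0. Qed.

Lemma torsionD J f g : is_ideal J -> torsion J f -> torsion J g -> torsion J (fadd f g).
Proof.
move=> HJ [pf Jf] [pg Jg]; split; first exact: ptD.
by rewrite nmul_fadd //; apply: fadd_in => //; exact: pt_nmul.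
Qed.

Lemma torsion_nmul J n f : is_ideal J -> torsion J f -> torsion J (nmul n f).
Proof.
by move=> HJ Jf; elim: n => [|n IH] /=; [exact: torsion0|exact: torsionD].
Qed.

(** The p-series is invariant under translation by the torsion point [y], and the
    translate [t] of [z] by [- y] is divisible by [z - y]. As the p-series of [t] is
    divisible by [t ^ (p ^ m)], so is that of [z] by [(z - y) ^ (p ^ m)], all modulo
    [J]. The inverse of [y] for the formal group law is [[p - 1](y)]. *)
Lemma torsion_root J y z : is_ideal J -> torsion J y -> pt z ->
  exists h, J (ps z - (z - y) ^+ (p ^ m) * h).
Proof.
move=> HJ [py Jy] pz.
have pE : p = p.-1.+1 by rewrite prednK // prime_gt0.
have psyE : ps y = fadd y (nmul p.-1 y) by rewrite {1}pE.
have py' := pt_nmul p.-1 py.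
have pp f : pt f -> pt (ps f) by exact: pt_nmul.
pose t := fadd z (nmul p.-1 y).
have pt_t : pt t by exact: ptD.
have ytE : fadd y t = fadd z (ps y).
  by rewrite /t psyE faddA // [fadd y z]faddC // -faddA.
have [h hE] := psE pt_t; have [h' h'E] := faddB pz py py'.
rewrite -psyE -/t in h'E.
have Jt : J (t - (z - y) * h').
  by rewrite -h'E opprB addrC subrK.
exists (h' ^+ (p ^ m) * h); rewrite mulrA -exprMn.
apply: (@congr_trans _ _ (ps t)) => //; last first.
  rewrite hE; apply: congr_mul => //; first exact: congr_exp.
  by rewrite subrr; exact: is_ideal0.
apply: (@congr_trans _ _ (ps (fadd y t))) => //.
  rewrite ytE nmul_fadd //; last exact: pp.
  apply: congr_sym => //; apply: fadd_congr => //; [exact: pp|by apply: (pp); exact: (pp)|].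
  by apply: nmul_in => //; exact: (pp).
rewrite nmul_fadd // faddC; [|exact: pp|exact: pp].
by apply: fadd_congr => //; exact: pp.
Qed.

(** The point is [sum (al l) x_l] up to coefficients in [M], that is, modulo the
    square of the maximal ideal when the [x_l] are in it. *)
Definition linear_point K f (al : nat -> S) := pt f /\
  exists c : nat -> S, (forall l, M (c l)) /\
    f = \sum_(l < size K) (al l + c l) * x (nth 0%N K l).

Let HM := gideal_ideal (nl_ideal SM).

Lemma linear_in K f al J : is_ideal J -> (forall j, j \in K -> J (x j)) ->
  linear_point K f al -> J f.
Proof.
move=> HJ JK [_ [c [_ ->]]]; apply: is_ideal_sum => // l _; apply: is_idealM => //.
by apply: JK; exact: mem_nth.
Qed.

Lemma xM i : (i < w)%N -> M (x i).
Proof.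
move=> iw; apply: (proj2 (params_in Hparams _)).
by rewrite mem_cat map_f ?orbT // mem_iota.
Qed.

Lemma vM i : (i < w)%N -> homogen (v i) /\ M (v i).
Proof.
move=> iw; apply: (params_in Hparams).
by rewrite mem_cat map_f // mem_iota.
Qed.

Lemma linear_pointD K f g al be : (forall j, j \in K -> (j < w)%N) ->
  linear_point K f al -> linear_point K g be ->
  linear_point K (fadd f g) (fun l => al l + be l).
Proof.
move=> Kw Lf Lg.
have Mg : M g by apply: (linear_in HM _ Lg) => j /Kw/xM.
have [pf [c [Mc fE]]] := Lf; have [pg [d [Md gE]]] := Lg.
split; first exact: ptD.
have [h ->] := faddE pf pg.
exists (fun l => c l + d l + (al l + c l) * (g * h)); split=> [l|].
  by apply: is_idealD => //; [exact: is_idealD|apply: is_idealM => //; exact: is_idealMr].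
transitivity (f * (1 + g * h) + g); first by ring.
rewrite {1}fE {2}gE big_distrl -big_split /=; apply: eq_bigr => l _.
by ring.
Qed.

Lemma linear_point0 K : linear_point K 0 (fun=> 0).
Proof.
split=> //; exists (fun=> 0); split=> [l|]; first exact: is_ideal0.
by rewrite big1 // => l _; rewrite addr0 mul0r.
Qed.

Lemma linear_pointx K j n : (forall j, j \in K -> (j < w)%N) -> (j < size K)%N ->
  linear_point K (nmul n (x (nth 0%N K j))) (fun l => (if l == j then n else 0%N)%:R).
Proof.
move=> Kw jK; elim: n => [|n IH] /=.
  have := linear_point0 K; congr (linear_point _ _ _).
  by apply/funext => l; case: ifP.
have Lx : linear_point K (x (nth 0%N K j)) (fun l => (l == j)%:R).
  split; first by apply: ptx; apply: Kw; exact: mem_nth.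
  exists (fun=> 0); split=> [l|]; first exact: is_ideal0.
  rewrite (bigD1 (Ordinal jK)) //= eqxx addr0 mul1r big1 ?addr0 // => l lj.
  by rewrite (negbTE (_ : nat_of_ord l != j)) ?addr0 ?mul0r.
have := linear_pointD Kw Lx IH; congr (linear_point _ _ _).
by apply/funext => l; rewrite -natrD; case: eqP.
Qed.

(** The combination [sum_F [al j](x_j)] of the variables indexed by [K]; these are the
    [p ^ (size K)] points of an elementary abelian group. *)
Definition point K (al : {ffun 'I_(size K) -> 'I_p}) : S :=
  \big[fadd/0]_(j < size K) nmul (al j) (x (nth 0%N K j)).

Lemma point_linear K al : (forall j, j \in K -> (j < w)%N) ->
  linear_point K (@point K al) (fun l => if insub l is Some j then (al j : nat)%:R else 0).
Proof.
move=> Kw.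
pose be (s : seq 'I_(size K)) (l : nat) : S :=
  \sum_(j <- s) (if l == j then (al j : nat) else 0%N)%:R.
have H (s : seq 'I_(size K)) : linear_point K
   (\big[fadd/0]_(j <- s) nmul (al j) (x (nth 0%N K j))) (be s).
  elim: s => [|j s IH].
    rewrite big_nil; have := linear_point0 K; congr (linear_point _ _ _).
    by apply/funext => l; rewrite /be big_nil.
  rewrite big_cons.
  have := linear_pointD Kw (linear_pointx (al j) Kw (ltn_ord j)) IH.
  by congr (linear_point _ _ _); apply/funext => l; rewrite /be big_cons.
have := H (index_enum 'I_(size K)); congr (linear_point _ _ _).
apply/funext => l; rewrite /be; case: insubP => [j jK jE|lK].
  rewrite (bigD1 j) //= jE eqxx big1 ?addr0 // => i ij.
  by rewrite -jE (negbTE (_ : nat_of_ord j != i)) // eq_sym.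
rewrite big1 // => i _; case: eqP => // E; move: lK; rewrite E ltn_ord.
by [].
Qed.

Lemma point_torsion K al J : is_ideal J -> (forall j, j \in K -> (j < w)%N) ->
  (forall j, j \in K -> J (ps (x j))) -> torsion J (@point K al).
Proof.
move=> HJ Kw JK; rewrite /point; elim/big_ind: _ => [||j _].
- exact: torsion0.
- by move=> f g; exact: torsionD.
- apply: torsion_nmul => //; split; first by apply: ptx; apply: Kw; exact: mem_nth.
  by apply: JK; exact: mem_nth.
Qed.

(** The integer [a - b] is prime to [p] and [p] is in [M], so Bezout gives an inverse. *)
Lemma unit_modM (a b : nat) : (a < p)%N -> (b < p)%N -> a != b ->
  exists t : S, M (t * (a%:R - b%:R) - 1).
Proof.
move=> ap bp ab.
have cp : coprimez (a%:Z - b%:Z) p%:Z.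
  have -> : coprimez (a%:Z - b%:Z) p%:Z = coprime `|a%:Z - b%:Z|%N p by [].
  rewrite coprime_sym prime_coprime //; apply/negP => /dvdn_leq; lia.
have /coprimezP[[s t] /= E] := cp.
exists (s%:~R).
have E' : s%:~R * (a%:R - b%:R) + t%:~R * p%:R = 1 :> S.
  have -> : a%:R - b%:R = (a%:Z - b%:Z)%:~R :> S by rewrite intrB.
  by rewrite -[p%:R]/(p%:Z%:~R) -!intrM -intrD E.
have -> : s%:~R * (a%:R - b%:R) - 1 = - (t%:~R * p%:R) :> S.
  by apply/eqP; rewrite -subr_eq0 opprK addrAC E' subrr.
by apply: is_idealN => //; exact: is_idealM.
Qed.

(** The state reached after the variables [x_0, ..., x_(i-1)] have been treated. The
    domain [S/J] is regular, of dimension [2w - i]; [K] lists those variables that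
    became new independent torsion points, and each of these has replaced one of the
    parameters [v_m, v_(m+1), ...], which now lies in the ideal of the [x_j] for [j]
    in [K]. *)
Record stage (i : nat) J K : Prop := Stage {
  stage_iw : (i <= w)%N;
  stage_Ki : (size K <= i)%N;
  stage_K : forall j, j \in K -> (j < i)%N;
  stage_uniq : uniq K;
  stage_params : params M J (map x K ++ map v (iota (size K) (w - size K))
                             ++ map x (iota i (w - i)));
  stage_torsion : forall j, j \in K -> J (ps (x j));
  stage_v : forall l, (l < size K)%N -> adjs J (map x K) (v l) }.

Lemma stage0 : stage 0 [set 0] [::].
Proof. by split=> //=; rewrite subn0. Qed.

Section Step.
Variables (i : nat) (J : set S) (K : seq nat).
Hypotheses (st : stage i J K) (iw : (i < w)%N).
Local Notation k := (size K).
Local Notation rest := (map x (iota i.+1 (w - i.+1))).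
Local Notation vs := (map v (iota k (w - k))).

Let Kw j : j \in K -> (j < w)%N.
Proof. by move=> /(stage_K st) ji; exact: ltn_trans ji iw. Qed.
Let Kk : (k < w)%N. Proof. exact: leq_ltn_trans (stage_Ki st) iw. Qed.

Let stP : params M J (map x K ++ vs ++ x i :: rest).
Proof.
by have := stage_params st; rewrite -(subnSK iw).
Qed.

Let HJ : gideal J. Proof. by case: stP. Qed.
Let HJ' := gideal_ideal HJ.

Lemma step_homM a : a \in map x K ++ vs ++ x i :: rest -> homogen a /\ M a.
Proof. by move/(params_in stP). Qed.

Let g (al : {ffun 'I_k -> 'I_p}) := x i - point al.

Lemma point_in al L : is_ideal L -> (forall j, j \in K -> L (x j)) -> L (@point K al).
Proof. by move=> HL LK; apply: (linear_in HL LK (point_linear al Kw)). Qed.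

Lemma point_pt al : pt (@point K al).
Proof. by case: (point_linear al Kw). Qed.

Lemma g_hom al : ghom 2 (g al).
Proof.
by apply: (gradingB (ghomP S)); apply: pt_hom; [exact: ptx|exact: point_pt].
Qed.

Lemma gM al : M (g al).
Proof.
apply: is_idealB => //; first exact: xM.
by apply: point_in => // j /Kw/xM.
Qed.

(** The element [x_i - y] may replace the parameter [x_i], since [y] is in the ideal
    of the other variables. *)
Lemma step_g al : params M J (g al :: map x K ++ vs ++ rest).
Proof.
apply: (params_change SM stP); first by rewrite /= !size_cat /= !addnS.
  move=> a; rewrite inE => /orP[/eqP ->|al']; first by split; [exists 2; exact: g_hom|exact: gM].
  apply: step_homM; move: al'; rewrite !mem_cat inE => /or3P[->|->|->]; by rewrite ?orbT.
have HL : is_ideal (adjs J (g al :: map x K ++ vs ++ rest)) by exact: adjs_ideal.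
have in_ a : a \in map x K ++ vs ++ rest -> adjs J (g al :: map x K ++ vs ++ rest) a.
  by move=> al'; apply: mem_adjs => //; rewrite inE al' orbT.
move=> a; rewrite !mem_cat inE => /or4P[aK|av|/eqP ->|ar].
- by apply: in_; rewrite mem_cat aK.
- by apply: in_; rewrite !mem_cat av orbT.
- rewrite -(subrK (point al) (x i)); apply: is_idealD => //.
    by apply: mem_adjs => //; rewrite mem_head.
  by apply: point_in => // j jK; apply: in_; rewrite mem_cat map_f.
- by apply: in_; rewrite !mem_cat ar !orbT.
Qed.

(** The difference of two points is, modulo the square of [M], a nonzero linear form
    in the [x_j] for [j] in [K]. Hence it may replace one of these parameters, next to
    [x_i - y], and so it is not in the ideal of [x_i - y]. *)
Lemma g_distinct al be : al != be -> ~ adj J (g al) (g be).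
Proof.
move=> ab.
have [j abj] : exists j, al j != be j.
  apply: contrapT => H; move/eqP: ab; apply; apply/ffunP => j.
  by apply/eqP/negPn/negP => n; apply: H; exists j.
pose d : S := point al - point be.
have [_ [c [Mc econst]]] := point_linear al Kw.
have [_ [e [Me eE]]] := point_linear be Kw.
have Md : M d by apply: is_idealB => //; apply: point_in => // l /Kw/xM.
have dE : d = \sum_(l < k) ((al l : nat)%:R - (be l : nat)%:R + (c l - e l)) * x (nth 0%N K l).
  rewrite /d econst eE -sumrB; apply: eq_bigr => l _; rewrite !valK; ring.
pose K' := rem (nth 0%N K j) K.
have jK : nth 0%N K j \in K by exact: mem_nth.
have sK' : (size K').+1 = k by rewrite size_rem // prednK // (leq_ltn_trans (leq0n j)).
have K'K a : a \in map x K' ++ vs ++ rest -> a \in map x K ++ vs ++ x i :: rest.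
  rewrite !mem_cat inE => /or3P[/mapP[r /mem_rem rK ->]|->|->]; rewrite ?orbT //.
  by rewrite map_f.
pose l := g al :: d :: map x K' ++ vs ++ rest.
have Pl : params M J l.
  apply: (params_change SM (step_g al)).
    by rewrite /= !size_cat !size_map /= -sK' !addSn.
  move=> a; rewrite !inE => /or3P[/eqP ->|/eqP ->|/K'K/step_homM //].
    by split; [exists 2; exact: g_hom|exact: gM].
  split=> //; exists 2; apply: (gradingB (ghomP S)); apply: pt_hom; exact: point_pt.
  have HL : gideal (adjs J l).
    apply: gideal_adjs => // a; rewrite !inE => /or3P[/eqP ->|/eqP ->|/K'K/step_homM[] //].
      by exists 2; exact: g_hom.
    by exists 2; apply: (gradingB (ghomP S)); apply: pt_hom; exact: point_pt.
  have HL' := gideal_ideal HL.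
  have inl a : a \in l -> adjs J l a by exact: mem_adjs.
  have inK' r : r \in K -> r != nth 0%N K j -> adjs J l (x r).
    move=> rK rj; apply: inl; rewrite !inE mem_cat map_f ?orbT //.
    by rewrite /K'; have := perm_to_rem jK => /perm_mem/(_ r); rewrite rK inE (negbTE rj).
  (* The coefficient of [x_j] in [d] is a unit modulo [M], with inverse [t]; so [t d]
     recovers [x_j] up to the other generators. *)
  have xj : adjs J l (x (nth 0%N K j)).
    have [t Mt] := unit_modM (ltn_ord (al j)) (ltn_ord (be j)) abj.
    apply: (@nakayama1 _ M SM _ _
      (1 - t * ((al j : nat)%:R - (be j : nat)%:R + (c j - e j)))) => //.
    - by apply: pt_homogen; apply: ptx; exact: Kw.
    - have -> : 1 - t * ((al j : nat)%:R - (be j : nat)%:R + (c j - e j)) =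
        - (t * ((al j : nat)%:R - (be j : nat)%:R) - 1) - t * (c j - e j) by ring.
      apply: is_idealB => //; first exact: is_idealN.
      by apply: is_idealM => //; exact: is_idealB.
    have -> : x (nth 0%N K j) - (1 - t * ((al j : nat)%:R - (be j : nat)%:R + (c j - e j)))
       * x (nth 0%N K j) =
       t * (((al j : nat)%:R - (be j : nat)%:R + (c j - e j)) * x (nth 0%N K j)) by ring.
    apply: is_idealM => //; move: dE; rewrite (bigD1 j) //= => /eqP.
    rewrite -subr_eq => /eqP <-.
    apply: is_idealB => //; first by apply: inl; rewrite !inE eqxx orbT.
    elim/big_ind: _ => [||r rj]; [exact: is_ideal0|by move=> ? ?; exact: is_idealD|].
    apply: is_idealM => //; apply: inK'; first exact: mem_nth.
    by rewrite nth_uniq // (stage_uniq st).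
  move=> a; rewrite inE !mem_cat => /or4P[/eqP ->|/mapP[r rK ->]|av|ar].
  - by apply: inl; rewrite mem_head.
  - by case: (eqVneq r (nth 0%N K j)) => [->//|]; exact: inK'.
  - by apply: inl; rewrite !inE !mem_cat av !orbT.
  - by apply: inl; rewrite !inE !mem_cat ar !orbT.
have nd := params_notin SM
  (params_adj SM Pl).
move=> gab; apply: nd.
have -> : d = g be - g al by rewrite /d /g; ring.
apply: is_idealB => //; [exact: adj_ideal|exact: mem_adj].
Qed.

Lemma g_prime al : gprime (adj J (g al)).
Proof. exact: (params_prime SM (params_adj SM (step_g al))). Qed.

Lemma J_prime : gprime J.
Proof. exact: (params_prime SM stP). Qed.

Lemma g_notin al : ~ J (g al).
Proof. exact: (params_notin SM (step_g al)). Qed.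

Lemma stage_g al : stage i.+1 (adj J (g al)) K.
Proof.
have JJ := @sub_adj S J (g al); split.
- by [].
- by apply: leq_trans (stage_Ki st) _.
- by move=> j /(stage_K st) ji; exact: ltnW.
- exact: (stage_uniq st).
- exact: (params_adj SM (step_g al)).
- by move=> j /(stage_torsion st)/JJ.
- move=> l /(stage_v st); apply: adjs_mono => //; exact: adj_ideal.
Qed.

Local Notation L := (adjs J (map x K)).

Let G := \prod_(al : {ffun 'I_k -> 'I_p}) g al ^+ (p ^ m).

Lemma G_hom : homogen G.
Proof.
rewrite /G; elim/big_ind: _ => [|a b|al _].
- exact: homogen1.
- exact: homogenM.
- by apply: homogenX; exists 2; exact: g_hom.
Qed.

Lemma ps_hom f : pt f -> homogen (ps f).
Proof. by move=> pf; apply: pt_homogen; exact: pt_nmul. Qed.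

(** The p-series of [x_i] is divisible by [G]: each point is a root of multiplicity [p
    ^ m], and distinct points give distinct primes. *)
Lemma cofactor : exists f, homogen f /\ J (ps (x i) - G * f).
Proof.
have [h Jh] : exists h, J (ps (x i) - G * h).
  apply: (prime_power_divides J_prime) => //.
  - by move=> al; exists 2; exact: g_hom.
  - exact: g_notin.
  - exact: g_prime.
  - exact: g_distinct.
  - move=> al; apply: torsion_root => //; last exact: ptx.
    by apply: point_torsion => //; exact: stage_torsion st.
  - exact: index_enum_uniq.
have [d dG] := G_hom; have [e ep] := ps_hom (ptx iw).
rewrite mulrC in Jh; have [f [df _ Jf]] := hom_coef HJ ep dG Jh.
by exists f; rewrite mulrC; split=> //; exists (e - d).
Qed.

(** All the points vanish modulo [L], and there are [p ^ k] of them. *)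
Lemma G_mod : L (G - x i ^+ (p ^ (m + k))).
Proof.
have HL : is_ideal L by exact: adjs_ideal.
have -> : x i ^+ (p ^ (m + k)) = \prod_(al : {ffun 'I_k -> 'I_p}) x i ^+ (p ^ m).
  by rewrite prodr_const card_ffun !card_ord -exprM expnD.
rewrite /G; elim/big_ind2: _ => [|a b c d|al _].
- by rewrite subrr; exact: is_ideal0.
- exact: congr_mul.
- apply: congr_exp => //; have -> : g al - x i = - point al by rewrite /g; ring.
  apply: is_idealN => //; apply: point_in => // j jK.
  by apply: mem_adjs => //; exact: map_f.
Qed.

Lemma L_params : params M L (x i :: vs ++ rest).
Proof.
apply: (params_adjs SM); apply: (params_change SM stP).
  by rewrite !size_cat /= !size_cat !addnS addnA.
  by move=> a ha; apply: step_homM; move: ha; rewrite !mem_cat !inE !mem_cat => /or4P[->|->|->|->]; rewrite ?orbT.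
move=> a ha; apply: mem_adjs => //; move: ha.
by rewrite !mem_cat !inE !mem_cat => /or4P[->|->|->|->]; rewrite ?orbT.
Qed.

(** Modulo [L] the p-series of [x_i] starts with [v_(m+k) x_i ^ (p ^ (m+k))], since
    [v_0, ..., v_(m+k-1)] vanish there, while [G] becomes [x_i ^ (p ^ (m+k))]. As
    [x_i] is a nonzerodivisor modulo [L], this power may be cancelled. *)
Lemma cofactor_mod f : J (ps (x i) - G * f) -> exists h, L (v k + x i * h - f).
Proof.
move=> Jf; have HL : is_ideal L by exact: adjs_ideal.
have [c [c' [h [/= Jc Jc' E]]]] := psxE iw Kk.
have sub : adjs [set 0] (map v (iota 0 k)) `<=` L.
  apply: adjs_min => //; first by move=> _ ->; exact: is_ideal0.
  by move=> _ /mapP[l + ->]; rewrite mem_iota => /andP[_ lk]; exact: (stage_v st).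
have LP := params_prime SM L_params; have nx := params_notin SM L_params.
have hx : homogen (x i) by apply: pt_homogen; exact: ptx.
exists h.
suff : L (x i ^+ (p ^ (m + k)) * (v k + c' + x i * h - f)).
  move=> /(gprime_cancel LP (homogenX _ hx) (fun H => nx (gprimeX LP hx H))) H.
  have -> : v k + x i * h - f = (v k + c' + x i * h - f) - c' by ring.
  by apply: is_idealB => //; exact: sub.
have LJf := @sub_adjs S J (map x K) _ Jf.
have -> : x i ^+ (p ^ (m + k)) * (v k + c' + x i * h - f) =
    (ps (x i) - G * f) - c + (G - x i ^+ (p ^ (m + k))) * f.
  by rewrite E; ring.
apply: is_idealD => //; last by apply: is_idealMr => //; exact: G_mod.
by apply: is_idealB => //; exact: sub.
Qed.

(** By [cofactor_mod], adding the cofactor [f] to [J] puts [v_(m+k)] into the ideal of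
    the variables indexed by [K] and [i]; so [f] may replace the parameter [v_(m+k)]. *)
Lemma step_f f : homogen f -> J (ps (x i) - G * f) ->
  params M J (f :: map x (rcons K i) ++ map v (iota k.+1 (w - k.+1)) ++ rest).
Proof.
move=> hf Jf; have [h Lh] := cofactor_mod Jf.
have HL : is_ideal L by exact: adjs_ideal.
have vsE : vs = v k :: map v (iota k.+1 (w - k.+1)) by rewrite -(subnSK Kk).
have LM : L `<=` M.
  apply: adjs_min; first exact: gideal_ideal (nl_ideal SM).
    exact: params_sub stP.
  by move=> _ /mapP[j /Kw jw ->]; exact: xM.
have Mf : M f.
  have -> : f = (v k + x i * h) - (v k + x i * h - f) by ring.
  apply: is_idealB => //; last exact: LM.
  by apply: is_idealD => //; [exact: (vM Kk).2|apply: is_idealMr => //; exact: xM].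
apply: (params_change SM stP).
  rewrite vsE /= !size_cat /= !size_cat /= !size_map !size_rcons !size_iota; lia.
  move=> a; rewrite inE => /orP[/eqP -> //|].
  rewrite map_rcons !mem_cat mem_rcons inE => ha; apply: step_homM; move: ha.
  rewrite vsE !mem_cat !inE.
  by move=> /or3P[/orP[->|->]|->|->]; rewrite ?orbT.
set l' := f :: _.
have HL' : is_ideal (adjs J l') by exact: adjs_ideal.
have in_ a : a \in l' -> adjs J l' a by exact: mem_adjs.
have xi : adjs J l' (x i).
  by apply: in_; rewrite /l' map_rcons inE mem_cat mem_rcons mem_head orbT.
have LL' : L `<=` adjs J l'.
  apply: adjs_min => //; first exact: sub_adjs.
  move=> a aK; apply: in_.
  by rewrite /l' map_rcons inE mem_cat mem_rcons inE aK !orbT.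
move=> a; rewrite vsE mem_cat => /orP[aK|]; first exact/LL'/mem_adjs.
rewrite mem_cat inE => /orP[/orP[/eqP ->|av]|].
- have -> : v k = (v k + x i * h - f) - x i * h + f by ring.
  apply: is_idealD => //; last by apply: in_; rewrite mem_head.
  by apply: is_idealB => //; [exact: LL'|exact: is_idealMr].
- by apply: in_; rewrite /l' inE !mem_cat av !orbT.
rewrite inE => /orP[/eqP -> //|ar].
by apply: in_; rewrite /l' inE !mem_cat ar !orbT.
Qed.

Lemma stage_f f : homogen f -> J (ps (x i) - G * f) -> stage i.+1 (adj J f) (rcons K i).
Proof.
move=> hf Jf; have JJ := @sub_adj S J f; split.
- by [].
- by rewrite size_rcons ltnS; exact: stage_Ki st.
- move=> j; rewrite mem_rcons inE => /orP[/eqP ->//|/(stage_K st)]; exact: ltnW.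
- rewrite rcons_uniq (stage_uniq st) andbT; apply/negP => /(stage_K st).
  by rewrite ltnn.
- rewrite size_rcons; exact: (params_adj SM (step_f hf Jf)).
- move=> j; rewrite mem_rcons inE => /orP[/eqP ->|/(stage_torsion st)/JJ //].
  by exists (ps (x i) - G * f), G; rewrite subrK.
- have HJf : is_ideal (adj J f) by exact: adj_ideal.
  have HL2 : is_ideal (adjs (adj J f) (map x (rcons K i))) by exact: adjs_ideal.
  have LL2 : L `<=` adjs (adj J f) (map x (rcons K i)).
    apply: adjs_min => //; first by apply: subset_trans JJ _; exact: sub_adjs.
    move=> a aK; apply: mem_adjs => //.
    by rewrite map_rcons mem_rcons inE aK orbT.
  move=> l; rewrite size_rcons ltnS leq_eqVlt => /orP[/eqP ->|/(stage_v st)/LL2 //].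
  have [h Lh] := cofactor_mod Jf.
  have -> : v k = (v k + x i * h - f) - x i * h + f by ring.
  apply: is_idealD => //; last by apply: sub_adjs; exact: mem_adj.
  apply: is_idealB => //; first exact: LL2.
  apply: is_idealMr => //; apply: mem_adjs => //.
  by rewrite map_rcons mem_rcons mem_head.
Qed.

End Step.

Definition leaf (D : set S) := regular_local (gquot D) w.

(** Descending induction on the number of variables left. The relation [[p](x_i)] is
    the product of the primes [x_i - y] and of [f], each of which leads to a stage
    with one variable less, so [good_prod] assembles the filtration. When no variable
    is left the ring is regular of dimension [w]. *)
Lemma tower_good d i J K : (i + d)%N = w -> stage i J K ->
  good leaf J (map (fun j => ps (x j)) (iota i d)).
Proof.
elim: d i J K => [|d IH] i J K iE st.
  have P := stage_params st; have [HJ _ _ _] := P; split=> //=.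
  have s : size (map x K ++ map v (iota (size K) (w - size K)) ++ map x (iota i (w - i))) = w.
    rewrite !size_cat !size_map !size_iota; have := stage_Ki st; lia.
  apply: (@FilteredStep _ _ J 1) => //; first exact: homogen1.
    rewrite (_ : colon J 1 = J); first by have := params_leaf SM P; rewrite s.
    by apply/seteqP; split=> z; rewrite /colon /= mulr1.
  rewrite (_ : adj J 1 = setT); first exact: FilteredT.
  by apply: ideal1T; [apply: adj_ideal|apply: mem_adj]; exact: gideal_ideal.
have iw : (i < w)%N by lia.
have P := stage_params st; have [HJ _ _ _] := P.
have HJ' := gideal_ideal HJ.
have JP := params_prime SM P.
have [f [hf Jf]] := cofactor st iw.
pose gs := [seq x i - point al | al : {ffun 'I_(size K) -> 'I_p}].
pose fs := f :: flatten [seq nseq (p ^ m) g | g <- gs].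
have fsE : J (ps (x i) - \prod_(a <- fs) a).
  rewrite /fs big_cons big_flatten big_map big_map big_enum /= mulrC.
  under eq_bigr do rewrite big_nseq iter_mulr_1.
  exact: Jf.
have hs a : a \in map (fun j => ps (x j)) (iota i.+1 d) -> homogen a.
  move=> /mapP[j + ->]; rewrite mem_iota => /andP[_ jd].
  by apply: ps_hom; apply: ptx; lia.
have H a : a \in fs -> [/\ homogen a, ~ J a &
    good leaf (adj J a) (map (fun j => ps (x j)) (iota i.+1 d))].
  rewrite inE => /orP[/eqP ->|/flattenP[_ /mapP[_ /mapP[al _ ->] ->]]].
    split=> //; first exact: (params_notin SM (step_f st iw hf Jf)).
    by apply: IH (stage_f st iw hf Jf); lia.
  rewrite mem_nseq => /andP[_ /eqP ->]; split.
  - by exists 2; exact: (g_hom st iw).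
  - exact: (g_notin st iw).
  - by apply: IH (stage_g st iw al); lia.
rewrite /=.
have [r F] : good leaf (adj J (ps (x i))) (map (fun j => ps (x j)) (iota i.+1 d)).
  rewrite (adj_congr HJ' fsE); apply: good_prod => // a /H[ha na ga]; split=> //.
  exact: gprime_nzd.
split=> //; split=> //; apply: gprime_nzd => //; first by apply: ps_hom; exact: ptx.
move=> Jp; have : J (\prod_(a <- fs) a).
  by rewrite -[\prod_(a <- fs) a](subKr (ps (x i))); exact: is_idealB.
suff [] : homogen (\prod_(a <- fs) a) /\ ~ J (\prod_(a <- fs) a) by [].
elim: (fs) H => [|a s IHs] H; first by rewrite big_nil; split; [exact: homogen1|case: JP].
have [|hp np] := IHs; first by move=> b bs; apply: H; rewrite inE bs orbT.
have [ha na _] := H _ (mem_head _ _).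
by rewrite big_cons; split; [exact: homogenM|exact: gprimeM].
Qed.

Theorem tower_filtered :
  filtered leaf (adjs [set 0] (map (fun j => ps (x j)) (iota 0 w))).
Proof. by have [_] := tower_good (add0n w) stage0. Qed.

End Tower.

(** * Noetherianity from completeness *)

Section Cohen.
Variable S : gradedRing.
Implicit Types (a b c t x y z : S) (I J : set S).

Let H0 := gideal_ideal (gideal0 S).

(** The coefficients that express a homogeneous element in terms of homogeneous
    generators may be taken homogeneous, by [hom_coef]. *)
Lemma hom_adjs J (s : seq S) (dg : nat -> int) d z : gideal J ->
  (forall j, (j < size s)%N -> ghom (dg j) s`_j) -> ghom d z -> adjs J s z ->
  exists al : nat -> S, (forall j, (j < size s)%N -> ghom (d - dg j) (al j)) /\
    J (z - \sum_(j < size s) al j * s`_j).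
Proof.
move=> HJ; elim: s dg z => [|a s IH] dg z hs dz.
  by move=> Jz; exists (fun=> 0); split=> //; rewrite big_ord0 subr0.
rewrite /= adjs_adj; last exact: gideal_ideal.
have hs' j : (j < size s)%N -> ghom (dg j.+1) s`_j by move=> /(hs j.+1).
have HJs : gideal (adjs J s).
  apply: gideal_adjs => // b /(nthP 0)[j js <-]; exists (dg j.+1); exact: hs'.
move=> [y [c [Jy zE]]].
have [|k [dk _ Jk]] := hom_coef (k := c) HJs dz (hs 0%N isT); first by rewrite zE addrK.
have [|al [hal Jal]] := IH (fun j => dg j.+1) (z - k * a) hs' _ Jk.
  by apply: (gradingB (ghomP S)) => //; rewrite -[d](subrK (dg 0%N)); apply: (gradingM (ghomP S)) => //; exact: (hs 0%N).
exists (fun j => if j is j'.+1 then al j' else k); split.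
  by case=> [_|j js]; [exact: dk|exact: hal].
by rewrite big_ord_recl opprD addrA.
Qed.

Lemma adjs0_mul (s : seq S) a c :
  adjs [set 0] s c -> adjs [set 0] [seq r * a | r <- s] (c * a).
Proof.
have HK : is_ideal (adjs [set 0] [seq r * a | r <- s]) by exact: adjs_ideal.
apply: (@adjs_min _ _ _ [set c | adjs [set 0] [seq r * a | r <- s] (c * a)]).
- split=> /=; first by rewrite mul0r; exact: is_ideal0.
    by move=> x y ? ?; rewrite mulrDl; exact: is_idealD.
  by move=> k x ?; rewrite -mulrA; exact: is_idealM.
- by move=> _ -> /=; rewrite mul0r; exact: is_ideal0.
- by move=> r rs /=; apply: mem_adjs => //; exact: map_f.
Qed.

(** Each generator of [I + (a)] is corrected by a multiple of [a] to lie in [I]. *)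
Lemma fin_gen_adj I a : gideal I -> homogen a -> fin_gen (adj I a) ->
  exists2 ys : seq S, forall y, y \in ys -> homogen y /\ I y
    & adj I a = adj (adjs [set 0] ys) a.
Proof.
move=> HI [e ea] [s hs sE].
have /choice[f fP] : forall b, exists k, b \in s -> homogen (b - k * a) /\ I (b - k * a).
  move=> b; case: (boolP (b \in s)) => [bs|_]; last by exists 0.
  have [d db] := hs _ bs.
  have [y [c [Iy bE]]] : adj I a b by rewrite sE; exact: mem_adjs.
  have [|k [dk _ Ik]] := hom_coef (k := c) HI db ea; first by rewrite bE addrK.
  exists k => _; split=> //; exists d; apply: (gradingB (ghomP S)) => //.
  by rewrite -[d](subrK e); apply: (gradingM (ghomP S)).
exists [seq b - f b * a | b <- s].
  by move=> _ /mapP[b /fP ? ->].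
have HK : is_ideal (adj (adjs [set 0] [seq b - f b * a | b <- s]) a).
  by apply: adj_ideal; exact: adjs_ideal.
have HI' := gideal_ideal HI.
apply/seteqP; split.
  rewrite sE; apply: adjs_min => //; first by move=> _ ->; exact: is_ideal0.
  move=> b bs; rewrite -(subrK (f b * a) b); apply: is_idealD => //.
    by apply: sub_adj; apply: mem_adjs => //; apply/mapP; exists b.
  by apply: is_idealM => //; apply: mem_adj; exact: adjs_ideal.
apply: adj_min; [exact: adj_ideal| |exact: mem_adj].
apply: adjs_min; [exact: adj_ideal| |].
  by move=> _ ->; apply: is_ideal0; exact: adj_ideal.
by move=> _ /mapP[b /fP[_ Ib] ->]; exact: sub_adj.
Qed.

(** The step of Cohen's theorem. If [a b] is in [I] but neither factor is, then [I +
    (a)] and [(I : a)] are larger than [I], hence finitely generated, and generators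
    of [I] are obtained from those of both. *)
Lemma cohen_prime I (L : set S) : gideal I -> L `<=` I -> ~ fin_gen I ->
  (forall J, gideal J -> L `<=` J -> ~ fin_gen J -> I `<=` J -> J = I) -> gprime I.
Proof.
move=> HI LI nI maxI; have HI' := gideal_ideal HI; split=> //.
  move=> I1; apply: nI; exists [:: 1].
    by move=> a; rewrite inE => /eqP ->; exact: homogen1.
  rewrite (ideal1T HI' I1) /= (ideal1T (adj_ideal _ _)) //; exact: mem_adj.
move=> a b ha hb Iab; apply: contrapT => /not_orP[Ia Ib].
have big J : gideal J -> I `<=` J -> (exists2 x, J x & ~ I x) -> fin_gen J.
  move=> HJ IJ [x Jx Ix]; apply: contrapT => nJ; apply: Ix.
  rewrite -(maxI J) //; exact: subset_trans IJ.
have [ys ysI E] : exists2 ys : seq S, forall y, y \in ys -> homogen y /\ I y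
    & adj I a = adj (adjs [set 0] ys) a.
  apply: fin_gen_adj => //; apply: big; [exact: gideal_adj|exact: sub_adj|].
  by exists a => //; exact: mem_adj.
have [r hr rE] : fin_gen (colon I a).
  apply: big; first exact: gideal_colon.
    by move=> x Ix; rewrite /colon /=; exact: is_idealMr.
  by exists b => //; rewrite /colon /= mulrC.
have yI : adjs [set 0] ys `<=` I.
  by apply: adjs_min => //; [move=> _ ->; exact: is_ideal0|move=> y /ysI[]].
apply: nI; exists (ys ++ [seq c * a | c <- r]).
  move=> y; rewrite mem_cat => /orP[/ysI[]//|/mapP[c cr ->]].
  by apply: homogenM => //; exact: hr.
rewrite adjs_cat; have HK := adjs_ideal ys H0; apply/seteqP; split.
  move=> z Iz; have [y [c [yy zE]]] : adj (adjs [set 0] ys) a z.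
    by rewrite -E; exact: sub_adj.
  have : colon I a c.
    by rewrite /colon /= -[c * a](addKr y) -zE addrC; apply: is_idealB => //; exact: yI.
  rewrite rE => /(adjs0_mul a) ca; rewrite zE.
  apply: is_idealD; first exact: adjs_ideal.
    exact: sub_adjs.
  by move: ca; apply: adjs_mono => // _ ->; exact: is_ideal0.
apply: adjs_min => // _ /mapP[c cr ->].
by rewrite -[I (c * a)]/(colon I a c) rE; exact: mem_adjs.
Qed.

(** The ring is separated and complete in each degree for the powers of [t]: the
    operator [L d] sums the series [sum a_i t^i] of degree [d], and is described by
    its first term and its tail. *)
Definition complete (t : S) : Prop := exists e : int, [/\ ghom e t,
  forall z, (forall N, exists c, z = t ^+ N * c) -> z = 0
  & exists L : int -> (nat -> S) -> S, forall d (a : nat -> S),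
     (forall i, ghom (d - e *+ i) (a i)) ->
     ghom d (L d a) /\ L d a = a 0%N + t * L (d - e) (fun i => a i.+1)].

Lemma complete_sum t e L d (a : nat -> S) N :
  (forall d (a : nat -> S), (forall i, ghom (d - e *+ i) (a i)) ->
     ghom d (L d a) /\ L d a = a 0%N + t * L (d - e) (fun i => a i.+1)) ->
  (forall i, ghom (d - e *+ i) (a i)) ->
  exists c, L d a = \sum_(i < N) a i * t ^+ i + t ^+ N * c.
Proof.
move=> LP; elim: N d a => [|N IH] d a ha.
  by exists (L d a); rewrite big_ord0 add0r mul1r.
have ha' i : ghom (d - e - e *+ i) (a i.+1).
  by have := ha i.+1; rewrite mulrS opprD addrA.
have [c econst] := IH _ _ ha'; exists c; rewrite (proj2 (LP _ _ ha)) econst.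
rewrite big_ord_recl expr0 mulr1 mulrDr mulrA -exprS addrA big_distrr /=.
congr (_ + _ + _); apply: eq_bigr => i _; rewrite /bump /= add1n exprS; ring.
Qed.

(** By [cohen_prime] only a prime ideal [I] must be considered. If it contains [t],
    the hypothesis applies. Otherwise finitely many elements [ys] of [I] generate it
    together with [t]; as [I] is prime, writing [z = sum al_j y_j + t z'] gives [z']
    in [I] again, and the coefficients of the iterated expansions are summed by
    completeness. *)
Lemma cohen_step t (T : seq S) : complete t ->
  (forall I, gideal I -> adjs [set 0] (t :: T) `<=` I -> fin_gen I) ->
  forall I, gideal I -> adjs [set 0] T `<=` I -> fin_gen I.
Proof.
move=> [e [et sep [L LP]]] Ht I0 HI0 TI0; apply: contrapT => nI0.
pose Q : set (set S) := [set I | [/\ gideal I, adjs [set 0] T `<=` I & ~ fin_gen I]].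
have [||I [[HI TI nI] _ maxI]] := @zorn_above S Q I0.
- by split.
- move=> F FQ F0 Ft.
  have HU : gideal (\bigcup_(X in F) X).
    by apply: gideal_bigcup => // X /FQ[].
  split=> //.
    by have [X FX] := F0; have [_ TX _] := FQ _ FX; move=> z /TX Xz; exists X.
  move=> [s hs sE].
  have [X FX Xs] : exists2 X, F X & forall a, a \in s -> X a.
    by apply: chain_seq => // a as_; rewrite sE; exact: mem_adjs.
  have [HX _ nX] := FQ _ FX; have HX' := gideal_ideal HX; apply: nX; exists s => //.
  rewrite -sE; apply/seteqP; split; first by move=> x Xx; exists X.
  by rewrite sE; apply: adjs_min => // _ ->; exact: is_ideal0.
have prI : gprime I.
  apply: (@cohen_prime I (adjs [set 0] T)) => // J HJ TJ nJ; exact: maxI.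
have HI' := gideal_ideal HI.
have ht : homogen t by exists e.
have [It|It] := pselect (I t).
  apply: nI; apply: Ht => //=; rewrite adjs_adj //.
  by apply: adj_min.
have [ys ysI E] : exists2 ys : seq S, forall y, y \in ys -> homogen y /\ I y
    & adj I t = adj (adjs [set 0] ys) t.
  apply: fin_gen_adj => //; apply: Ht; first exact: gideal_adj.
  rewrite /= adjs_adj //; apply: adj_min; [exact: adj_ideal| |exact: mem_adj].
  by apply: subset_trans TI _; exact: sub_adj.
apply: nI; exists ys; first by move=> y /ysI[].
have HY := adjs_ideal ys H0.
apply/seteqP; split; last first.
  by apply: adjs_min => //; [move=> _ ->; exact: is_ideal0|move=> y /ysI[]].
apply: gideal_sub => // z [d dz] Iz.
have /choice[dg dgP] : forall j, exists k : int, (j < size ys)%N -> ghom k ys`_j.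
  move=> j; have [js|_] := ltnP j (size ys); last by exists 0.
  by have [[k kj] _] := ysI _ (mem_nth 0 js); exists k.
(* One division: an element of [I] with its degree gives the coefficients on [ys] and
   the next element of [I]. *)
have step (u : int * S) : exists ac : (nat -> S) * S, ghom u.1 u.2 -> I u.2 ->
    [/\ forall j, (j < size ys)%N -> ghom (u.1 - dg j) (ac.1 j),
        ghom (u.1 - e) ac.2, I ac.2
      & u.2 = \sum_(j < size ys) ac.1 j * ys`_j + t * ac.2].
  have [H|n] := pselect (ghom u.1 u.2 /\ I u.2); last first.
    by exists (fun=> 0, 0) => ? ?; case: n.
  case: u H => {d z dz Iz}[d z] /= [dz Iz].
  have Yz : adjs (adj [set 0] t) ys z.
    by rewrite adjs_adj // -E; exact: sub_adj.
  have [al [hal Jal]] := hom_adjs (gideal_adj (gideal0 S) ht) dgP dz Yz.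
  set u := z - _ in Jal.
  have du : ghom d u.
    apply: (gradingB (ghomP S)) => //; apply: ghom_sum => j _.
    by rewrite -[d](subrK (dg j)); apply: (gradingM (ghomP S)); [exact: hal|exact: dgP].
  have Iu : I u.
    apply: is_idealB => //; apply: is_ideal_sum => // j _; apply: is_idealM => //.
    by have [] := ysI _ (mem_nth 0 (ltn_ord j)).
  have [_ [c [-> uE]]] := Jal; rewrite add0r in uE.
  have [|k [dk _ uk]] := hom_coef (k := c) (gideal0 S) du et; first by rewrite uE subrr.
  have {}uk : u = t * k by move/eqP: uk; rewrite subr_eq0 mulrC => /eqP.
  exists (al, k) => _ _; split=> //.
    by apply: (gprime_cancel prI ht It); rewrite -uk.
  by rewrite /= -uk addrC subrK.
have /choice[ac acP] := step.
pose zs := fix zs i := if i is i'.+1 then (ac (d - e *+ i', zs i')).2 else z.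
have zsP i : ghom (d - e *+ i) (zs i) /\ I (zs i).
  elim: i => [|i [IH1 IH2]]; first by rewrite subr0.
  have [_ h1 h2 _] := acP (d - e *+ i, zs i) IH1 IH2; split=> //=.
  by rewrite mulrSr opprD addrA.
pose al i j := (ac (d - e *+ i, zs i)).1 j.
have alP i j : (j < size ys)%N -> ghom (d - dg j - e *+ i) (al i j).
  have [h1 h2] := zsP i; have [h _ _ _] := acP (d - e *+ i, zs i) h1 h2.
  by move=> /h /=; rewrite addrAC.
have zE N : z = \sum_(j < size ys) (\sum_(i < N) al i j * t ^+ i) * ys`_j + t ^+ N * zs N.
  elim: N => [|N IH].
    by rewrite big1 ?add0r ?mul1r // => j _; rewrite big_ord0 mul0r.
  have [h1 h2] := zsP N; have [_ _ _ /= zN] := acP (d - e *+ N, zs N) h1 h2.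
  rewrite {1}IH {1}zN mulrDr addrA [t ^+ N * (t * _)]mulrA -exprSr; congr (_ + _).
  rewrite big_distrr -big_split /=; apply: eq_bigr => j _.
  by rewrite big_ord_recr /= /al; ring.
pose b j := L (d - dg j) (fun i => al i j).
(* The difference is divisible by every power of [t]. *)
have zb : z - \sum_(j < size ys) b j * ys`_j = 0.
  apply: sep => N.
  have /choice[c cP] : forall j, exists c, (j < size ys)%N ->
      b j = \sum_(i < N) al i j * t ^+ i + t ^+ N * c.
    move=> j; have [js|_] := ltnP j (size ys); last by exists 0.
    have [c econst] := @complete_sum t e L (d - dg j) (fun i => al i j) N LP (fun i => alP i j js).
    by exists c.
  exists (zs N - \sum_(j < size ys) c j * ys`_j).
  rewrite {1}(zE N) mulrBr big_distrr /=.
  under [X in _ - X = _]eq_bigr => j _ do rewrite (cP j (ltn_ord j)) mulrDl -mulrA.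
  by rewrite big_split /= opprD addrACA subrr add0r.
move/eqP: zb; rewrite subr_eq0 => /eqP ->.
by apply: is_ideal_sum => // j _; apply: is_idealM => //; apply: mem_adjs => //; exact: mem_nth.
Qed.

(** The variables are removed from the list one at a time. *)
Theorem noeth_of_complete (T : seq S) : (forall t, t \in T -> complete t) ->
  (forall I, gideal I -> adjs [set 0] T `<=` I -> fin_gen I) -> gnoetherian S.
Proof.
elim: T => [|t T IH] HT H.
  move=> I HI; apply/fin_genP; apply: H => // _ ->.
  exact: is_ideal0 (gideal_ideal HI).
apply: IH; first by move=> s sT; apply: HT; rewrite inE sT orbT.
by apply: (@cohen_step t) => //; apply: HT; rewrite mem_head.
Qed.

End Cohen.

(** * Power series and substitution *)

Lemma big_uniq_sub (V : nmodType) (T : eqType) (s t : seq T) (F : T -> V) :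
  uniq s -> uniq t -> {subset s <= t} ->
  (forall a, a \in t -> a \notin s -> F a = 0) ->
  \sum_(a <- t) F a = \sum_(a <- s) F a.
Proof.
move=> us ut st F0; rewrite (bigID (mem s)) /= [X in _ + X]big_seq_cond.
rewrite [X in _ + X]big1 ?addr0 => [|a /andP[]]; last exact: F0.
rewrite -big_filter; apply: perm_big; apply: uniq_perm => //; first exact: filter_uniq.
by move=> a; rewrite mem_filter; apply: andb_idr; exact: st.
Qed.

Section FpsBasics.
Variables (R : comPzRingType) (n : nat).
Implicit Types (f g h : fps n R) (a b c : 'X_{1..n}).

Lemma fpsME f g c : (f * g) c = \sum_(a <- mdivs c) f a * g (c - a)%MM.
Proof. by []. Qed.

Lemma fps1E c : (1 : fps n R) c = (c == 0%MM)%:R.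
Proof. by []. Qed.

Lemma fps_sumE (T : Type) (s : seq T) (P : pred T) (F : T -> fps n R) c :
  (\sum_(i <- s | P i) F i) c = \sum_(i <- s | P i) F i c.
Proof. by elim/big_rec2: _ => // i y z _ <-. Qed.

Lemma fpsP f g : (forall c, f c = g c) -> f = g.
Proof. by move=> E; apply/funext. Qed.

Definition order_ge N f := forall c, (mdeg c < N)%N -> f c = 0.

Lemma order_geM N K f g : order_ge N f -> order_ge K g -> order_ge (N + K) (f * g).
Proof.
move=> fN gK c cNK; rewrite fpsME big_seq big1 // => a; rewrite mem_mdivs => ac.
have dc : mdeg c = (mdeg (c - a) + mdeg a)%N by rewrite -mdegD submK.
have [aN|Na] := ltnP (mdeg a) N; first by rewrite fN // mul0r.
by rewrite gK ?mulr0 //; lia.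
Qed.

Lemma order_geX i f : order_ge 1 f -> order_ge i (f ^+ i).
Proof.
move=> f1; elim: i => [|i IH]; first by move=> c; rewrite ltn0.
by rewrite exprS -add1n; exact: order_geM.
Qed.

Lemma order_ge1 f : f 0%MM = 0 -> order_ge 1 f.
Proof. by move=> f0 c; rewrite ltnS leqn0 mdeg_eq0 => /eqP ->. Qed.

Definition eq_below N f g := forall c, (mdeg c < N)%N -> f c = g c.

Lemma eq_belowM N f f' g g' :
  eq_below N f f' -> eq_below N g g' -> eq_below N (f * g) (f' * g').
Proof.
move=> ff gg c cN; rewrite !fpsME big_seq [RHS]big_seq; apply: eq_bigr => a.
rewrite mem_mdivs => ac; have dc : mdeg c = (mdeg (c - a) + mdeg a)%N by rewrite -mdegD submK.
by rewrite ff ?gg //; lia.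
Qed.

Lemma eq_belowD N f f' g g' :
  eq_below N f f' -> eq_below N g g' -> eq_below N (f + g) (f' + g').
Proof. by move=> ff gg c cN; rewrite !fps_addE ff // gg. Qed.

Lemma eq_below_sym N f g : eq_below N f g -> eq_below N g f.
Proof. by move=> fg c /fg. Qed.

Lemma eq_below_trans N f g h : eq_below N f g -> eq_below N g h -> eq_below N f h.
Proof. by move=> fg gh c cN; rewrite fg ?gh. Qed.

Lemma eq_below_all f g : (forall N, eq_below N f g) -> f = g.
Proof. by move=> fg; apply: fpsP => c; apply: (fg (mdeg c).+1). Qed.

Definition fps_mono a : fps n R := fun c => (c == a)%:R.

Lemma fps_varE i : fps_var R i = fps_mono U_(i). Proof. by []. Qed.

Lemma fps_mono0 : fps_mono 0%MM = 1. Proof. by []. Qed.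

Lemma fps_monoM a f c : (fps_mono a * f) c = if (a <= c)%MM then f (c - a)%MM else 0.
Proof.
rewrite fpsME; case: ifP => ac.
  rewrite (bigD1_seq a) ?mdivs_uniq ?mem_mdivs //= /fps_mono eqxx mul1r.
  by rewrite big1 ?addr0 // => b /negPf ->; rewrite mul0r.
rewrite big_seq big1 // => b; rewrite mem_mdivs /fps_mono => bc.
by case: eqP => [E|]; [rewrite E ac in bc|rewrite mul0r].
Qed.

Lemma fps_monoD a b : fps_mono (a + b) = fps_mono a * fps_mono b.
Proof.
apply: fpsP => c; rewrite fps_monoM /fps_mono; case: ifP => ac.
  by rewrite -{1}(submK ac) addmC eqm_add2l.
by case: eqP => // E; rewrite E lem_addr in ac.
Qed.

Lemma fps_monoX a i : fps_mono (a *+ i) = fps_mono a ^+ i.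
Proof. by elim: i => [//|i IH]; rewrite mulmS fps_monoD IH exprS. Qed.

Definition fps_const (r : R) : fps n R := fun c => if c == 0%MM then r else 0.

Lemma fps_const_mul r f : fps_const r * f = fps_scale r f.
Proof.
apply: fpsP => c; rewrite fpsME (bigD1_seq 0%MM) ?mdivs_uniq ?mem_mdivs //=; last first.
  by apply/mnm_lepP => i; rewrite mnm0E.
rewrite /fps_const eqxx subm0 big1 ?addr0 // => b /negPf ->; exact: mul0r.
Qed.

Lemma fps_oppE f c : (- f) c = - f c. Proof. by []. Qed.

Lemma fps_constM r s : fps_const (r * s) = fps_const r * fps_const s.
Proof.
by rewrite fps_const_mul; apply: fpsP => c; rewrite /fps_scale /fps_const; case: ifP; rewrite ?mulr0.
Qed.

Lemma fps_const1 : fps_const 1 = 1.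
Proof. by apply: fpsP => c; rewrite /fps_const fps1E; case: eqP. Qed.

Definition mbelow N : seq 'X_{1..n} := map val (enum {: 'X_{1..n < N}}).

Lemma mem_mbelow N a : (a \in mbelow N) = (mdeg a < N)%N.
Proof.
apply/mapP/idP => [[[b bN] _ ->] //|aN].
by exists (BMultinom aN); rewrite ?mem_enum.
Qed.

Lemma mbelow_uniq N : uniq (mbelow N).
Proof. by rewrite map_inj_uniq ?enum_uniq //; exact: val_inj. Qed.

End FpsBasics.

Section Substitution.
Variables (R : comPzRingType) (n k : nat).
Variable u : 'I_n -> fps k R.
Hypothesis u1 : forall i, order_ge 1 (u i).
Implicit Types (f g h : fps n R) (a b : 'X_{1..n}) (c : 'X_{1..k}).

Definition mono_at a : fps k R := \prod_(i < n) u i ^+ a i.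

Lemma mono_at0 : mono_at 0%MM = 1.
Proof. by rewrite /mono_at big1 // => i _; rewrite mnm0E. Qed.

Lemma mono_atD a b : mono_at (a + b)%MM = mono_at a * mono_at b.
Proof. by rewrite /mono_at -big_split; apply: eq_bigr => i _; rewrite mnmDE exprD. Qed.

Lemma mono_at1 i : mono_at U_(i)%MM = u i.
Proof.
rewrite /mono_at (bigD1 i) //= mnm1E eqxx expr1 big1 ?mulr1 // => j ji.
by rewrite mnm1E eq_sym (negPf ji).
Qed.

(** As the [u i] have no constant term, the monomials of large degree do not
    contribute to a given coefficient; this makes substitution well defined. *)
Lemma order_mono_at a : order_ge (mdeg a) (mono_at a).
Proof.
rewrite mdegE /mono_at; elim/big_rec2: _ => [c //|i d f _ IH].
by apply: order_geM => //; exact: order_geX.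
Qed.

(** The series [f(u_0, ..., u_(n-1))]: by [order_mono_at] the truncated sum gives the
    exact coefficient. *)
Definition subst f : fps k R := fun c =>
  \sum_(a <- mbelow n (mdeg c).+1) f a * mono_at a c.

Lemma substE N f c : (mdeg c < N)%N ->
  subst f c = \sum_(a <- mbelow n N) f a * mono_at a c.
Proof.
move=> cN; apply/esym; apply: big_uniq_sub; try exact: mbelow_uniq.
  by move=> a; rewrite !mem_mbelow => ac; exact: leq_trans ac cN.
move=> a _; rewrite mem_mbelow -leqNgt => ca.
by rewrite order_mono_at ?mulr0.
Qed.

Lemma substD f g : subst (f + g) = subst f + subst g.
Proof.
apply: fpsP => c; rewrite fps_addE /subst -big_split; apply: eq_bigr => a _.
by rewrite fps_addE mulrDl.
Qed.

Lemma subst0 : subst 0 = 0.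
Proof. by apply: fpsP => c; rewrite /subst big1 // => a _; rewrite mul0r. Qed.

Lemma subst_scale r f : subst (fps_scale r f) = fps_scale r (subst f).
Proof.
apply: fpsP => c; rewrite /subst /fps_scale big_distrr; apply: eq_bigr => a _ /=.
by rewrite mulrA.
Qed.

Lemma subst_sum (T : Type) (s : seq T) (F : T -> fps n R) :
  subst (\sum_(i <- s) F i) = \sum_(i <- s) subst (F i).
Proof. by apply: (big_morph _ substD subst0). Qed.

Lemma subst_mono a : subst (fps_mono R a) = mono_at a.
Proof.
apply: fpsP => c; pose N := maxn (mdeg c).+1 (mdeg a).+1.
rewrite (@substE N) ?leq_maxl // (bigD1_seq a) ?mbelow_uniq ?mem_mbelow ?leq_maxr //=.
rewrite /fps_mono eqxx mul1r big1 ?addr0 // => b /negPf ->; exact: mul0r.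
Qed.

Lemma subst1 : subst 1 = 1.
Proof. by rewrite -(fps_mono0 R n) subst_mono mono_at0. Qed.

Lemma subst_var i : subst (fps_var R i) = u i.
Proof. by rewrite fps_varE subst_mono mono_at1. Qed.

(** Both sides expand into the sum of [f_a g_b u ^ (a + b)] over pairs of exponents
    below a common degree. *)
Lemma substM f g : subst (f * g) = subst f * subst g.
Proof.
apply: fpsP => c; pose N := (mdeg c).+1; pose s := mbelow n N.
transitivity (\sum_(a <- s) \sum_(b <- s) f a * g b * mono_at (a + b)%MM c).
  rewrite /subst -/N -/s.
  transitivity (\sum_(d <- s) \sum_(a <- s | (a <= d)%MM)
      f a * g (d - a)%MM * mono_at d c).
    rewrite big_seq [RHS]big_seq; apply: eq_bigr => d; rewrite mem_mbelow => dN.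
    rewrite fpsME big_distrl -[RHS]big_filter; apply: perm_big.
    apply: uniq_perm; [exact: mdivs_uniq|by rewrite filter_uniq ?mbelow_uniq|].
    move=> a; rewrite mem_mdivs mem_filter mem_mbelow; apply/esym/andb_idr => ad.
    by apply: leq_ltn_trans dN; rewrite -(submK ad) mdegD leq_addl.
  rewrite (exchange_big_dep xpredT) //=; apply: eq_bigr => a _.
  pose F d := f a * g (d - a)%MM * mono_at d c.
  rewrite -big_filter -[LHS](@big_uniq_sub _ _ [seq d <- s | (a <= d)%MM] (map (fun b => a + b)%MM s) F).
  - by rewrite big_map; apply: eq_bigr => b _; rewrite /F addmC addmK.
  - by rewrite filter_uniq ?mbelow_uniq.
  - by rewrite map_inj_uniq ?mbelow_uniq //; exact: addmI.
  - move=> d; rewrite mem_filter mem_mbelow => /andP[ad dN]; apply/mapP.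
    exists (d - a)%MM; last by rewrite addmC submK.
    by rewrite mem_mbelow; apply: leq_ltn_trans dN; exact: mdegB.
  - move=> _ /mapP[b _ ->]; rewrite mem_filter lem_addr mem_mbelow -leqNgt => cab.
    by rewrite /F order_mono_at ?mulr0.
rewrite fpsME.
transitivity (\sum_(e <- mdivs c) \sum_(a <- s) \sum_(b <- s)
    f a * g b * (mono_at a e * mono_at b (c - e)%MM)).
  rewrite [RHS]exchange_big; apply: eq_bigr => a _; rewrite [RHS]exchange_big.
  by apply: eq_bigr => b _; rewrite mono_atD fpsME big_distrr.
rewrite big_seq [RHS]big_seq; apply: eq_bigr => e; rewrite mem_mdivs => ec.
have dc : mdeg c = (mdeg (c - e) + mdeg e)%N by rewrite -mdegD submK.
rewrite !(@substE N) ?ltnS /N; [|lia..].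
rewrite big_distrl; apply: eq_bigr => a _; rewrite big_distrr.
by apply: eq_bigr => b _ /=; ring.
Qed.

Lemma substX f i : subst (f ^+ i) = subst f ^+ i.
Proof. by elim: i => [|i IH]; rewrite ?expr0 ?subst1 // !exprS substM IH. Qed.

Lemma subst_const r : subst (fps_const r) = fps_const r.
Proof.
have -> : fps_const r = fps_scale r 1 :> fps n R.
  by rewrite -fps_const_mul mulr1.
by rewrite subst_scale subst1 -fps_const_mul mulr1.
Qed.

Lemma subst_below N f g : eq_below N f g -> eq_below N (subst f) (subst g).
Proof.
move=> fg c cN; rewrite /subst big_seq [RHS]big_seq; apply: eq_bigr => a.
by rewrite mem_mbelow ltnS => ac; rewrite fg //; exact: leq_ltn_trans ac cN.
Qed.

Lemma subst_order N f : order_ge N f -> order_ge N (subst f).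
Proof. by move=> fN c cN; rewrite (@subst_below N f 0) // subst0. Qed.

End Substitution.

(** * Formal group laws *)

Section FormalSums.
Variables (R : comPzRingType) (F : nat -> nat -> R).

(** A polynomial in [f] and [g] that agrees with [F(f, g)] below degree [N], which
    reduces identities between formal sums to polynomial ones. *)
Definition fgl_trunc k N (f g : fps k R) : fps k R :=
  \sum_(i < N) \sum_(j < N) fps_scale (F i j) (f ^+ i * g ^+ j).

Lemma double_sum_widen (V : nmodType) N K (T : nat -> nat -> V) : (N <= K)%N ->
  (forall i j, (N <= i + j)%N -> T i j = 0) ->
  \sum_(i < K) \sum_(j < K) T i j = \sum_(i < N) \sum_(j < N) T i j.
Proof.
move=> NK T0.
have H (G : nat -> V) : (forall i, (N <= i)%N -> G i = 0) -> \sum_(i < K) G i = \sum_(i < N) G i.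
  move=> G0; rewrite (big_ord_widen K G NK) [LHS](bigID (fun i : 'I_K => (i < N)%N)) /=.
  by rewrite [X in _ + X]big1 ?addr0 // => i; rewrite -leqNgt => /G0.
rewrite (H (fun i => \sum_(j < K) T i j)) => [|i Ni].
  by apply: eq_bigr => i _; apply: H => j Nj; apply: T0; exact: leq_trans Nj (leq_addl _ _).
by rewrite big1 // => j _; apply: T0; exact: leq_trans Ni (leq_addr _ _).
Qed.

Lemma fgl_term_order k (f g : fps k R) i j : order_ge 1 f -> order_ge 1 g ->
  order_ge (i + j) (fps_scale (F i j) (f ^+ i * g ^+ j)).
Proof.
move=> f1 g1 c cN; rewrite /fps_scale (order_geM (order_geX (i := i) f1) (order_geX (i := j) g1)) //.
exact: mulr0.
Qed.

Lemma fgl_addE k (f g : fps k R) N : order_ge 1 f -> order_ge 1 g ->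
  eq_below N (fgl_add F f g) (fgl_trunc N f g).
Proof.
move=> f1 g1 c cN; rewrite /fgl_trunc fps_sumE.
under eq_bigr do rewrite fps_sumE.
rewrite (@double_sum_widen _ _ _ (fun i j => fps_scale (F i j) (f ^+ i * g ^+ j) c) cN) // => i j Nij.
by apply: fgl_term_order.
Qed.

Lemma fgl_add_order k (f g : fps k R) : F 0%N 0%N = 0 ->
  order_ge 1 f -> order_ge 1 g -> order_ge 1 (fgl_add F f g).
Proof.
move=> F00 f1 g1 c c1; rewrite (fgl_addE f1 g1 c1) /fgl_trunc !big_ord1.
by rewrite /fps_scale F00 mul0r.
Qed.

Lemma subst_fgl_trunc n k (u : 'I_n -> fps k R) N (f g : fps n R) :
  (forall i, order_ge 1 (u i)) ->
  subst u (fgl_trunc N f g) = fgl_trunc N (subst u f) (subst u g).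
Proof.
move=> u1; rewrite subst_sum; apply: eq_bigr => i _.
rewrite subst_sum; apply: eq_bigr => j _.
by rewrite subst_scale substM // !substX.
Qed.

(** Substitution is a continuous ring homomorphism; with it the axioms of a formal
    group law, stated for variables, extend to all series without constant term. *)
Lemma subst_fgl_add n k (u : 'I_n -> fps k R) (f g : fps n R) :
  (forall i, order_ge 1 (u i)) -> order_ge 1 f -> order_ge 1 g ->
  subst u (fgl_add F f g) = fgl_add F (subst u f) (subst u g).
Proof.
move=> u1 f1 g1; apply: eq_below_all => N.
have H : eq_below N (fgl_add F f g) (fgl_trunc N f g) by exact: fgl_addE.
apply: (eq_below_trans (subst_below u H)).
rewrite subst_fgl_trunc //; apply: eq_below_sym; apply: fgl_addE; exact: subst_order.
Qed.

Hypothesis HF : is_fgl F.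

Let xvar (n : nat) (i : 'I_n) : order_ge 1 (fps_var R i).
Proof.
apply: order_ge1; rewrite fps_varE /fps_mono eq_sym -mdeg_eq0 mdeg1 //.
Qed.

Let order0 n : order_ge 1 (0 : fps n R). Proof. by []. Qed.

Let tup k (s : seq (fps k R)) (n : nat) (i : 'I_n) := nth (0 : fps k R) s i.

Let tup1 k (s : seq (fps k R)) n : (forall f, f \in s -> order_ge 1 f) ->
  forall i : 'I_n, order_ge 1 (tup s i).
Proof.
move=> H i; rewrite /tup; have [is_|si] := ltnP i (size s); first by apply: H; exact: mem_nth.
by rewrite nth_default.
Qed.

Section Points.
Variable k : nat.
Implicit Types f g h : fps k R.

Lemma fgl_add0 f : order_ge 1 f -> fgl_add F f 0 = f.
Proof.
move=> f1; have [/= H _ _] := HF.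
have u1 : forall i : 'I_1, order_ge 1 (tup [:: f] i).
  by apply: tup1 => h; rewrite inE => /eqP ->.
have := congr1 (subst (fun i : 'I_1 => tup [:: f] i)) H.
rewrite subst_fgl_add // subst_var // subst0 //.
Qed.

Lemma fgl_addC f g : order_ge 1 f -> order_ge 1 g -> fgl_add F f g = fgl_add F g f.
Proof.
move=> f1 g1; have [_ /= H _] := HF.
have u1 : forall i : 'I_2, order_ge 1 (tup [:: f; g] i).
  by apply: tup1 => h; rewrite !inE => /orP[] /eqP ->.
have := congr1 (subst (fun i : 'I_2 => tup [:: f; g] i)) H.
by rewrite !subst_fgl_add // !subst_var // /tup inordK.
Qed.

Lemma fgl00 : F 0%N 0%N = 0.
Proof.
have [/= H _ _] := HF; have := congr1 (fun s : fps 1 R => s 0%MM) H.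
rewrite (xvar _ (c := 0%MM)) ?mdeg0 //.
rewrite /fgl_add mdeg0 !big_ord1 !expr0 mulr1 fps1E eqxx mulr1.
by [].
Qed.

Lemma fgl_addA f g h : order_ge 1 f -> order_ge 1 g -> order_ge 1 h ->
  fgl_add F f (fgl_add F g h) = fgl_add F (fgl_add F f g) h.
Proof.
move=> f1 g1 h1; have [_ _ /= H] := HF.
have u1 : forall i : 'I_3, order_ge 1 (tup [:: f; g; h] i).
  by apply: tup1 => l; rewrite !inE => /or3P[] /eqP ->.
have := congr1 (subst (fun i : 'I_3 => tup [:: f; g; h] i)) H.
have add1 (a b : fps 3 R) : order_ge 1 a -> order_ge 1 b -> order_ge 1 (fgl_add F a b).
  by apply: fgl_add_order; exact: fgl00.
rewrite !subst_fgl_add //; [|exact: add1..].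
by rewrite !subst_var // /tup !inordK.
Qed.

End Points.

Lemma fgl_trunc0 k N (f : fps k R) : fgl_trunc N.+1 f 0 = \sum_(i < N.+1) fps_scale (F i 0%N) (f ^+ i).
Proof.
rewrite /fgl_trunc; apply: eq_bigr => i _.
rewrite big_ord_recl expr0 mulr1 big1 ?addr0 // => j _.
by rewrite exprS mul0r mulr0; apply: fpsP => c; rewrite /fps_scale mulr0.
Qed.

Let coef_pow (i j : nat) : ((fps_var R ord0 : fps 1 R) ^+ j) (U_(ord0) *+ i)%MM = (i == j)%:R.
Proof.
rewrite fps_varE -fps_monoX /fps_mono; congr (_%:R); congr (nat_of_bool _).
apply/eqP/eqP => [/mnmP/(_ ord0)|-> //]; by rewrite !mulmnE mnm1E eqxx !mul1n.
Qed.

Let coef_sum (G : nat -> R) (i : nat) :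
  (\sum_(j < i.+1) fps_scale (G j) ((fps_var R ord0 : fps 1 R) ^+ j)) (U_(ord0) *+ i)%MM = G i.
Proof.
rewrite fps_sumE (bigD1 ord_max) //= big1 => [|j ji].
  by rewrite addr0 /fps_scale coef_pow eqxx mulr1.
rewrite /fps_scale coef_pow; case: eqP => [E|]; last by rewrite mulr0.
by case/eqP: ji; apply: val_inj.
Qed.

(** This is the axiom [F(x, 0) = x], read off coefficientwise. *)
Lemma fgl_coef_l i : F i 0%N = (i == 1%N)%:R.
Proof.
have X1 := xvar (ord0 : 'I_1).
have /(congr1 (fun s : fps 1 R => s (U_(ord0) *+ i)%MM)) := fgl_add0 X1.
have -> : fps_var R (ord0 : 'I_1) (U_(ord0) *+ i)%MM = (i == 1%N)%:R by rewrite -coef_pow expr1.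
rewrite (fgl_addE X1 (@order0 1) (N := i.+1)); last by rewrite mdegMn mdeg1 mul1n.
by rewrite fgl_trunc0 (coef_sum (fun j => F j 0%N)).
Qed.

Lemma fgl_trunc0l k N (f : fps k R) : fgl_trunc N.+1 0 f = \sum_(i < N.+1) fps_scale (F 0%N i) (f ^+ i).
Proof.
rewrite /fgl_trunc big_ord_recl [X in _ + X]big1 ?addr0 => [|i _].
  by apply: eq_bigr => i _; rewrite expr0 mul1r.
rewrite big1 // => j _; rewrite exprS !mul0r.
by apply: fpsP => c; rewrite /fps_scale mulr0.
Qed.

Lemma fgl_coef_r i : F 0%N i = (i == 1%N)%:R.
Proof.
have X1 := xvar (ord0 : 'I_1).
have := fgl_add0 X1; rewrite fgl_addC // => /(congr1 (fun s : fps 1 R => s (U_(ord0) *+ i)%MM)).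
have -> : fps_var R (ord0 : 'I_1) (U_(ord0) *+ i)%MM = (i == 1%N)%:R by rewrite -coef_pow expr1.
rewrite (fgl_addE (@order0 1) X1 (N := i.+1)); last by rewrite mdegMn mdeg1 mul1n.
by rewrite fgl_trunc0l (coef_sum (F 0%N)).
Qed.

End FormalSums.

Section FormalSumForms.
Variables (R : comPzRingType) (F : nat -> nat -> R).
Hypothesis HF : is_fgl F.
Variable k : nat.
Implicit Types f g h : fps k R.

Lemma scale_is_const r f : fps_scale r f = fps_const r * f.
Proof. by rewrite fps_const_mul. Qed.

Lemma fgl_trunc_form N f g : fgl_trunc F N.+2 f g =
  f + g + f * g * fgl_trunc (fun i j => F i.+1 j.+1) N.+1 f g.
Proof.
rewrite /fgl_trunc big_ord_recl.
have D h (G : nat -> R) : (forall i, G i = (i == 1%N)%:R) ->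
   \sum_(i < N.+2) fps_scale (G i) (h ^+ i) = h.
  move=> GE; rewrite !big_ord_recl big1 => [|i _]; last first.
    by rewrite GE; apply: fpsP => c; rewrite /fps_scale mul0r.
  rewrite !GE; apply: fpsP => c; rewrite !fps_addE /fps_scale mul0r add0r mul1r addr0.
  by rewrite expr1.
under eq_bigr do rewrite expr0 mul1r.
rewrite (D g (F 0%N)); last exact: fgl_coef_r.
rewrite [f + g]addrC -addrA; congr (_ + _).
under eq_bigr => i _ do rewrite big_ord_recl expr0 mulr1.
rewrite big_split /=; congr (_ + _).
  have := D f (fun i => F i 0%N) (fgl_coef_l HF); rewrite big_ord_recl.
  have -> : fps_scale (F 0%N 0%N) (f ^+ 0) = 0.
    by rewrite (fgl_coef_l HF) /=; apply: fpsP => c; rewrite /fps_scale mul0r.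
  by rewrite add0r.
rewrite big_distrr; apply: eq_bigr => i _; rewrite big_distrr; apply: eq_bigr => j _ /=.
rewrite /bump /= !add1n !scale_is_const !exprS; ring.
Qed.

(** The terms of [F(f, g)] that involve only one of the two series are [f] and [g] by
    the unit axiom; all others are divisible by [f g]. *)
Lemma fgl_add_form f g : order_ge 1 f -> order_ge 1 g ->
  fgl_add F f g = f + g + f * g * fgl_add (fun i j => F i.+1 j.+1) f g.
Proof.
move=> f1 g1; apply: eq_below_all => N.
have low K h h' : (N <= K)%N -> eq_below K h h' -> eq_below N h h'.
  by move=> NK H c cN; apply: H; exact: leq_trans NK.
have H1 : eq_below N (fgl_add F f g) (fgl_trunc F N.+2 f g).
  by apply: (low N.+2); [lia|exact: fgl_addE].
have H2 : eq_below N (fgl_add (fun i j => F i.+1 j.+1) f g)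
    (fgl_trunc (fun i j => F i.+1 j.+1) N.+1 f g).
  by apply: (low N.+1); [lia|exact: fgl_addE].
apply: (eq_below_trans H1); rewrite fgl_trunc_form.
by apply: eq_belowD => //; apply: eq_belowM => //; exact: eq_below_sym.
Qed.

Let quo_term f f' g i j : fps k R :=
  fps_scale (F i j) ((\sum_(l < i) f ^+ (i.-1 - l) * f' ^+ l) * g ^+ j).

(** The quotient of [F(f, g) - F(f', g)] by [f - f'], obtained from that of [f ^ i -
    f' ^ i] term by term. *)
Definition fgl_quo f f' g : fps k R := fun c =>
  \sum_(i < (mdeg c).+2) \sum_(j < (mdeg c).+2) quo_term f f' g i j c.

Lemma fgl_quoE f f' g N : order_ge 1 f -> order_ge 1 f' -> order_ge 1 g ->
  eq_below N (fgl_quo f f' g) (\sum_(i < N.+1) \sum_(j < N.+1) quo_term f f' g i j).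
Proof.
move=> f1 f'1 g1 c cN; rewrite fps_sumE; under [RHS]eq_bigr do rewrite fps_sumE.
rewrite (@double_sum_widen _ _ _ (fun i j => quo_term f f' g i j c) (cN : (_.+2 <= N.+1)%N)) //.
move=> i j Nij; rewrite /quo_term /fps_scale.
rewrite (@order_geM _ _ i.-1 j) ?mulr0 //; last by lia.
  move=> a ai; rewrite fps_sumE big1 // => l _.
  apply: (@order_geM _ _ (i.-1 - l) l); [exact: order_geX|exact: order_geX|].
  by apply: leq_trans ai _; lia.
exact: order_geX.
Qed.

Lemma fgl_add_sub f f' g : order_ge 1 f -> order_ge 1 f' -> order_ge 1 g ->
  fgl_add F f g - fgl_add F f' g = (f - f') * fgl_quo f f' g.
Proof.
move=> f1 f'1 g1; apply: eq_below_all => N.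
have E : fgl_trunc F N.+1 f g - fgl_trunc F N.+1 f' g =
    (f - f') * \sum_(i < N.+1) \sum_(j < N.+1) quo_term f f' g i j.
  rewrite /fgl_trunc -sumrB big_distrr; apply: eq_bigr => i _ /=.
  rewrite -sumrB big_distrr; apply: eq_bigr => j _ /=.
  rewrite /quo_term !scale_is_const -mulrBr -mulrBl subrXX mulrA [fps_const _ * _]mulrC.
  by ring.
have low h h' : eq_below N.+1 h h' -> eq_below N h h'.
  by move=> H c cN; apply: H; exact: ltnW.
have H1 : eq_below N (fgl_add F f g) (fgl_trunc F N.+1 f g) by apply: low; exact: fgl_addE.
have H2 : eq_below N (fgl_add F f' g) (fgl_trunc F N.+1 f' g) by apply: low; exact: fgl_addE.
have H3 : eq_below N (fgl_quo f f' g) (\sum_(i < N.+1) \sum_(j < N.+1) quo_term f f' g i j).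
  exact: fgl_quoE.
have H4 : eq_below N ((f - f') * fgl_quo f f' g)
    ((f - f') * \sum_(i < N.+1) \sum_(j < N.+1) quo_term f f' g i j).
  exact: eq_belowM.
move=> c cN; rewrite H4 // -E !fps_addE !fps_oppE H1 // H2 //.
Qed.

End FormalSumForms.

Section OneVariable.
Variables (R : comPzRingType) (k : nat).
Local Notation X := (fps_var R (ord0 : 'I_1)).

Definition fps_shift (f : fps 1 R) : fps 1 R := fun c => f (c + U_(ord0))%MM.

Lemma fps_shiftE (f : fps 1 R) : f = fps_const (f 0%MM) + X * fps_shift f.
Proof.
apply: fpsP => c; rewrite fps_addE fps_varE fps_monoM lep1mP /fps_const.
have [->|c0] := eqVneq c 0%MM; first by rewrite mnm0E eqxx addr0.
rewrite add0r; have c1 : c ord0 != 0%N.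
  by apply: contra c0 => /eqP c0; apply/eqP/mnmP => i; rewrite mnm0E ord1.
by rewrite c1 /fps_shift submK // lep1mP.
Qed.

Lemma iter_shiftE i (f : fps 1 R) c : iter i fps_shift f c = f (c + U_(ord0) *+ i)%MM.
Proof.
elim: i c => [|i IH] c; first by rewrite mulm0n addm0.
by rewrite iterS /fps_shift IH mulmS addmA.
Qed.

(** The expansion of a series in one variable to order [i], with the point [u]
    substituted. *)
Lemma subst_shift (u : fps k R) (f : fps 1 R) i : order_ge 1 u ->
  subst (fun=> u) f = \sum_(j < i) fps_const (f (U_(ord0) *+ j)%MM) * u ^+ j
    + u ^+ i * subst (fun=> u) (iter i fps_shift f).
Proof.
move=> u1; elim: i => [|i IH]; first by rewrite big_ord0 add0r mul1r.
rewrite {1}IH big_ord_recr -addrA; congr (_ + _).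
rewrite {1}[iter i _ _]fps_shiftE substD substM // subst_const // subst_var //.
by rewrite iter_shiftE add0m iterS exprS; ring.
Qed.

End OneVariable.

(** * Prime ideals of power series rings *)

Section FacePrimes.

Definition prime_set (R : comPzRingType) (P : set R) : Prop :=
  [/\ is_ideal P, ~ P 1 & forall x y, P (x * y) -> P x \/ P y].

Definition face (n j : nat) (c : 'X_{1..n}) : Prop :=
  forall l : 'I_n, (l < j)%N -> c l = 0%N.

(** For finitely generated [P] this is the ideal generated by the first [j] variables
    and [P]. *)
Definition face_set (R : comPzRingType) (n j : nat) (P : set R) : set (fps n R) :=
  [set f | forall c, face j c -> P (f c)].

Variables (R : comPzRingType) (n j : nat) (P : set R).
Hypothesis HP : prime_set P.

Lemma face_sub (a c : 'X_{1..n}) : (a <= c)%MM -> face j c -> face j a.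
Proof.
by move=> /mnm_lepP ac fc l lj; apply/eqP; rewrite -leqn0 -(fc l lj); exact: ac.
Qed.

Lemma face_least (f : fps n R) : ~ face_set j P f ->
  exists c, [/\ face j c, ~ P (f c) & forall a, face j a -> (a < c)%O -> P (f a)].
Proof.
move=> /existsNP[c]; elim/(@ltmwf n): c => c IH /not_implyP[fc Pc].
have [[a [fa ac Pa]]|H] := pselect (exists a, [/\ face j a, (a < c)%O & ~ P (f a)]).
  by apply: (IH a ac); apply/not_implyP.
by exists c; split=> // a fa ac; apply: contrapT => Pa; apply: H; exists a.
Qed.

(** For the least exponents [c], [d] of the face at which [f] and [g] are not in [P],
    the coefficient of [f g] at [c + d] is the product of these two modulo [P], as the
    order is additive. *)
Lemma face_prime : prime_set (@face_set R n j P).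
Proof.
have [[P0 PD PM] P1 PP] := HP.
have Psum (s : seq 'X_{1..n}) (Q : pred 'X_{1..n}) (F : 'X_{1..n} -> R) :
    (forall a, a \in s -> Q a -> P (F a)) -> P (\sum_(a <- s | Q a) F a).
  by move=> H; rewrite big_seq_cond; elim/big_ind: _ => // a /andP[]; exact: H.
split.
- split=> [c _ //|f g Pf Pg c fc|f g Pg c fc].
  + by rewrite fps_addE; apply: PD; [exact: Pf|exact: Pg].
  + rewrite fpsME; apply: (Psum _ xpredT) => a; rewrite mem_mdivs => ac _.
    by apply: PM; apply: Pg; apply: face_sub fc; exact: lem_subr.
- move=> /(_ 0%MM); rewrite fps1E eqxx => H; apply: P1; apply: H => l _.
  exact: mnm0E.
move=> f g Pfg; apply: contrapT => /not_orP[/face_least[c [fc Pc cmin]] /face_least[d [fd Pd dmin]]].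
have fcd : face j (c + d)%MM by move=> l lj; rewrite mnmDE fc // fd.
have := Pfg _ fcd; rewrite fpsME (bigD1_seq c) ?mdivs_uniq ?mem_mdivs ?lem_addr //=.
set s := \sum_(a <- _ | _) _ => Ps.
have Pss : P s.
  apply: Psum => a; rewrite mem_mdivs => acd ac.
  have fa : face j a by exact: face_sub fcd.
  have fb : face j (c + d - a)%MM by apply: face_sub fcd; exact: lem_subr.
  case: (Order.TotalTheory.ltgtP a c) ac => // [ac _|ca _].
    by rewrite mulrC; apply: PM; exact: cmin.
  apply: PM; apply: dmin => //.
  by rewrite -(ltmc_add2l _ _ a) submK // addmC ltmc_add2r.
have : P (f c * g (c + d - c)%MM).
  rewrite -[X in P X](addrK s); apply: PD => //.
  by rewrite -mulN1r; exact: PM.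
by rewrite addmC addmK => /PP[].
Qed.

End FacePrimes.

(** * Graded power series *)

Section GradedSeries.
Variables (E : gradedRing) (w : nat).
Local Notation S := (gfps E w).
Let EP := ghomP E.

(** Homogeneous series lie in the graded ring; a total function avoids carrying the
    proofs of homogeneity in formulas. *)
Definition gfps_of (f : fps w E) : S := insubd (0 : gfps_car E w) f.

Lemma gfps_ofE d f : fps_hom d f -> gfps_val (gfps_of f) = f.
Proof.
move=> df; rewrite /gfps_of; apply: (@insubdK _ _ (gfps_car E w)).
by apply/asboolP; exists [:: f]; rewrite big_seq1; split=> // g; rewrite inE => /eqP ->; exists d.
Qed.

Lemma gfps_of_hom d f : fps_hom d f -> ghom d (gfps_of f).
Proof. by move=> df; rewrite /ghom /= /gfps_hom /= (gfps_ofE df). Qed.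

Lemma gfps_val_hom d (f : S) : ghom d f -> fps_hom d (gfps_val f).
Proof. by []. Qed.

Lemma gfps_val_inj (f g : S) : gfps_val f = gfps_val g -> f = g.
Proof. exact: val_inj. Qed.

Lemma gfps_valD (f g : S) : gfps_val (f + g) = gfps_val f + gfps_val g. Proof. by []. Qed.
Lemma gfps_valB (f g : S) : gfps_val (f - g) = gfps_val f - gfps_val g. Proof. by []. Qed.
Lemma gfps_valM (f g : S) : gfps_val (f * g) = gfps_val f * gfps_val g. Proof. by []. Qed.
Lemma gfps_val0 : gfps_val (0 : S) = 0. Proof. by []. Qed.
Lemma gfps_val1 : gfps_val (1 : S) = 1. Proof. by []. Qed.
Lemma gfps_valX (f : S) i : gfps_val (f ^+ i) = gfps_val f ^+ i.
Proof. by elim: i => [//|i IH]; rewrite !exprS gfps_valM IH. Qed.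
Lemma gfps_val_sum (T : Type) (s : seq T) (G : T -> S) :
  gfps_val (\sum_(i <- s) G i) = \sum_(i <- s) gfps_val (G i).
Proof. by apply: (big_morph _ gfps_valD gfps_val0). Qed.

Lemma fps_homD n d (f g : fps n E) : fps_hom d f -> fps_hom d g -> fps_hom d (f + g).
Proof. by move=> df dg c; apply: ghomD; [exact: df|exact: dg]. Qed.

Lemma fps_hom0 n d : fps_hom d (0 : fps n E).
Proof. by move=> c; exact: (grading0 EP). Qed.

Lemma fps_hom_sum n d (T : Type) (s : seq T) (G : T -> fps n E) :
  (forall i, fps_hom d (G i)) -> fps_hom d (\sum_(i <- s) G i).
Proof. by move=> H; elim/big_ind: _ => //; [exact: fps_hom0|exact: fps_homD]. Qed.

Lemma fps_homX n d (f : fps n E) i : fps_hom d f -> fps_hom (d *+ i) (f ^+ i).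
Proof.
move=> df; elim: i => [|i IH]; first by rewrite expr0; exact: fps_hom1.
by rewrite exprS mulrS; exact: fps_homM.
Qed.

Lemma fps_hom_const n d (r : E) : ghom d r -> fps_hom d (fps_const r : fps n E).
Proof.
move=> dr c; rewrite /fps_const; case: eqP => [->|_]; last exact: (grading0 EP).
by rewrite mdeg0 muln0 subr0.
Qed.

Lemma fps_hom_mono n (a : 'X_{1..n}) : fps_hom (2 * mdeg a)%:Z (fps_mono E a).
Proof.
move=> c; rewrite /fps_mono; case: eqP => [->|_]; last exact: (grading0 EP).
by rewrite subrr; exact: (grading1 EP).
Qed.

Lemma fps_hom_var n (i : 'I_n) : fps_hom 2 (fps_var E i).
Proof. by rewrite fps_varE; have := fps_hom_mono U_(i)%MM; rewrite mdeg1. Qed.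

Lemma ghom_val d (f : S) c : ghom d f -> ghom (d - (2 * mdeg c)%:Z) (gfps_val f c).
Proof. exact. Qed.

(** A constant is the sum of its homogeneous components. *)
Lemma const_mem (r : E) : (fps_const r : fps w E) \in @gfps_pred E w.
Proof.
apply/asboolP; have [s [f [_ fh _ ->]]] := hom_dec r.
exists [seq fps_const (f d) | d <- s]; split.
  by move=> _ /mapP[d _ ->]; exists d; apply: fps_hom_const.
rewrite big_map; apply: fpsP => c; rewrite fps_sumE /fps_const.
by case: ifP => // _; rewrite big1.
Qed.

Definition gfps_const (r : E) : S := GFps (const_mem r).

Lemma gfps_constD r s : gfps_const (r + s) = gfps_const r + gfps_const s.
Proof. by apply: gfps_val_inj; apply: fpsP => c; rewrite gfps_valD fps_addE /= /fps_const; case: ifP; rewrite ?addr0. Qed.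
Lemma gfps_constM r s : gfps_const (r * s) = gfps_const r * gfps_const s.
Proof. by apply: gfps_val_inj; rewrite gfps_valM; exact: fps_constM. Qed.
Lemma gfps_const0 : gfps_const 0 = 0.
Proof. by apply: gfps_val_inj; apply: fpsP => c; rewrite /= /fps_const; case: ifP. Qed.
Lemma gfps_const1 : gfps_const 1 = 1.
Proof. by apply: gfps_val_inj; exact: fps_const1. Qed.
Lemma gfps_const_nat k : gfps_const k%:R = k%:R.
Proof. by elim: k => [|k IH]; rewrite ?gfps_const0 // -addn1 !natrD gfps_constD IH gfps_const1. Qed.
Lemma gfps_constX r i : gfps_const (r ^+ i) = gfps_const r ^+ i.
Proof. by elim: i => [|i IH]; rewrite ?expr0 ?gfps_const1 // !exprS gfps_constM IH. Qed.
Lemma gfps_const_sum (T : Type) (s : seq T) (G : T -> E) :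
  gfps_const (\sum_(i <- s) G i) = \sum_(i <- s) gfps_const (G i).
Proof. by apply: (big_morph _ gfps_constD gfps_const0). Qed.
Lemma gfps_const_hom d r : ghom d r -> ghom d (gfps_const r).
Proof. by move=> dr; apply: (fps_hom_const (n := w) dr). Qed.
Lemma gfps_constE r c : gfps_val (gfps_const r) c = if c == 0%MM then r else 0. Proof. by []. Qed.
Lemma gfps_const_mulE r (f : S) c : gfps_val (gfps_const r * f) c = r * gfps_val f c.
Proof. by rewrite gfps_valM /= fps_const_mul. Qed.

Definition gfps_var (i : 'I_w) : S := gfps_of (fps_var E i).

Lemma gfps_varE i : gfps_val (gfps_var i) = fps_var E i.
Proof. exact: gfps_ofE (fps_hom_var i). Qed.

Lemma gfps_var_hom i : ghom 2 (gfps_var i).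
Proof. by apply: gfps_of_hom; exact: fps_hom_var. Qed.

(** The coefficients of [sum a_i x_j^i] are finite sums, as [x_j^i] only involves
    exponents divisible by it. *)
Lemma gfps_var_complete j : complete (gfps_var j).
Proof.
exists 2; split; first exact: gfps_var_hom.
  move=> z H; apply: gfps_val_inj; apply: fpsP => c.
  have [d ->] := H (c j).+1; rewrite gfps_valM gfps_valX gfps_varE fps_varE -fps_monoX fps_monoM.
  case: ifP => // /mnm_lepP/(_ j); rewrite mulmnE mnm1E eqxx mul1n ltnn.
  by [].
exists (fun (_ : int) (a : nat -> S) => gfps_of (fun c => \sum_(i < (c j).+1) gfps_val (a i) (c - U_(j) *+ i)%MM)).
move=> d a ha.
have Hh d' (b : nat -> S) : (forall i, ghom (d' - 2 *+ i) (b i)) ->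
    fps_hom d' (fun c => \sum_(i < (c j).+1) gfps_val (b i) (c - U_(j) *+ i)%MM).
  move=> hb c; apply: ghom_sum => i _.
  have ic : (U_(j) *+ i <= c)%MM.
    by apply/mnm_lepP => l; rewrite mulmnE mnm1E; case: eqP => [<-|_]; rewrite ?mul1n // -ltnS ltn_ord.
  have := hb i (c - U_(j) *+ i)%MM.
  have dc : mdeg c = (mdeg (c - U_(j) *+ i) + i)%N.
    by rewrite -{1}(submK ic) mdegD mdegMn mdeg1 mul1n.
  have -> // : d' - 2 *+ i - (2 * mdeg (c - U_(j) *+ i))%:Z = d' - (2 * mdeg c)%:Z.
  by rewrite dc; lia.
split; first by apply: gfps_of_hom; exact: Hh.
have ha' i : ghom (d - 2 - 2 *+ i) (a i.+1) by have := ha i.+1; rewrite mulrS opprD addrA.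
apply: gfps_val_inj; rewrite gfps_valD gfps_valM (gfps_ofE (Hh _ _ ha)) (gfps_ofE (Hh _ _ ha')) gfps_varE.
apply: fpsP => c; rewrite fps_addE fps_varE fps_monoM big_ord_recl mulm0n subm0; congr (_ + _).
rewrite lep1mP; case: eqP => [->|c0] /=; first by rewrite big_ord0.
rewrite mnmBE mnm1E eqxx subn1 prednK ?lt0n; last exact/eqP.
apply: eq_bigr => i _; rewrite /bump add1n; congr (gfps_val _ _).
by rewrite submDA -mulmS.
Qed.

Local Notation xs := [seq gfps_var i | i <- enum 'I_w].

Lemma gfps_vars_hom a : a \in xs -> homogen a.
Proof. by move=> /mapP[i _ ->]; exists 2; exact: gfps_var_hom. Qed.

(** The terms in which the variables before [x_i] do not occur, but [x_i] does, are
    collected into a multiple of [x_i]. *)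
Lemma series_mod_vars (f : S) : adjs [set 0] xs (f - gfps_const (gfps_val f 0%MM)).
Proof.
have HX : is_ideal (adjs [set 0] xs) by apply: adjs_ideal; exact: gideal_ideal (gideal0 S).
suff H d (g : S) : ghom d g -> adjs [set 0] xs (g - gfps_const (gfps_val g 0%MM)).
  have [s [g [_ gh _ ->]]] := hom_dec f.
  rewrite gfps_val_sum fps_sumE gfps_const_sum -sumrB.
  by apply: is_ideal_sum => // k _; exact: H (gh k).
move=> dg.
pose res (i : nat) : fps w E := fun c =>
  if [forall l : 'I_w, (l < i)%N ==> (c l == 0%N)] then gfps_val g c else 0.
have resh i : fps_hom d (res i).
  by move=> c; rewrite /res; case: ifP => _; [exact: dg|exact: (grading0 EP)].
have H i : (i <= w)%N -> adjs [set 0] xs (g - gfps_of (res i)).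
  elim: i => [_|i IH iw].
    have -> : gfps_of (res 0%N) = g.
      apply: gfps_val_inj; rewrite (gfps_ofE (resh _)); apply: fpsP => c; rewrite /res.
      by case: forallP => // n; case: n.
    by rewrite subrr; exact: is_ideal0.
  have -> : g - gfps_of (res i.+1) = (g - gfps_of (res i)) + (gfps_of (res i) - gfps_of (res i.+1)).
    by rewrite addrA subrK.
  apply: is_idealD => //; first exact: IH (ltnW iw).
  pose o := Ordinal iw.
  pose h : fps w E := fun c => res i (c + U_(o))%MM.
  have hh : fps_hom (d - 2) h.
    move=> c; have := resh i (c + U_(o))%MM; rewrite /h mdegD mdeg1.
    have -> // : d - (2 * (mdeg c + 1))%:Z = d - 2 - (2 * mdeg c)%:Z by lia.
  have -> : gfps_of (res i) - gfps_of (res i.+1) = gfps_of h * gfps_var o.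
    apply: gfps_val_inj; rewrite mulrC gfps_valM gfps_valB !(gfps_ofE (resh _)) (gfps_ofE hh) gfps_varE.
    apply: fpsP => c; rewrite fps_varE fps_monoM fps_addE fps_oppE lep1mP.
    have [c0|c0] := eqVneq (c o) 0%N => /=.
      rewrite /res.
      have -> : [forall l : 'I_w, (l < i.+1)%N ==> (c l == 0%N)] =
                [forall l : 'I_w, (l < i)%N ==> (c l == 0%N)].
        apply/forallP/forallP => Hc l; apply/implyP => li.
          by apply: (implyP (Hc l)); exact: ltnW.
        move: li; rewrite ltnS leq_eqVlt => /orP[/eqP li|]; last exact: (implyP (Hc l)).
        by have -> : l = o; [exact: val_inj|rewrite c0].
      by rewrite subrr.
    rewrite /h submK ?lep1mP // {2}/res; case: forallP => [Hc|_]; last by rewrite subr0.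
    by move: (implyP (Hc o) (ltnSn i)); rewrite (negPf c0).
  by apply: is_idealM => //; apply: mem_adjs; [exact: gideal_ideal (gideal0 S)|rewrite map_f // mem_enum].
have := H w (leqnn w); congr (adjs _ _ (_ - _)).
apply: gfps_val_inj; rewrite (gfps_ofE (resh _)); apply: fpsP => c; rewrite /res /= /fps_const.
case: forallP => [Hc|nc].
  have -> : c = 0%MM by apply/mnmP => l; rewrite mnm0E; apply/eqP; exact: (implyP (Hc l)).
  by rewrite eqxx.
by case: eqP => // c0; case: nc => l; rewrite c0 mnm0E eqxx implybT.
Qed.

Lemma mono_at_hom n (u : 'I_n -> fps w E) a : (forall i, fps_hom 2 (u i)) ->
  fps_hom (2 * mdeg a)%:Z (mono_at u a).
Proof.
move=> hu; rewrite mdegE /mono_at; elim/big_rec2: _ => [|i f d _ IH].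
  by rewrite muln0; exact: fps_hom1.
have -> : (2 * (a i + d))%:Z = 2 *+ a i + (2 * d)%:Z by lia.
by apply: fps_homM => //; exact: fps_homX.
Qed.

Lemma subst_hom n (u : 'I_n -> fps w E) d f : (forall i, fps_hom 2 (u i)) ->
  fps_hom d f -> fps_hom d (subst u f).
Proof.
move=> hu df c; rewrite /subst; apply: ghom_sum => a _.
have -> : d - (2 * mdeg c)%:Z = (d - (2 * mdeg a)%:Z) + ((2 * mdeg a)%:Z - (2 * mdeg c)%:Z).
  by rewrite addrA subrK.
by apply: (gradingM EP); [exact: df|exact: mono_at_hom].
Qed.

Lemma scale_hom n d e (r : E) (f : fps n E) : ghom d r -> fps_hom e f ->
  fps_hom (d + e) (fps_scale r f).
Proof. by move=> dr ef; rewrite -fps_const_mul; apply: fps_homM => //; exact: fps_hom_const. Qed.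

Lemma fgl_add_hom n e (F : nat -> nat -> E) (f g : fps n E) :
  (forall i j, ghom (e - (2 * (i + j))%:Z) (F i j)) ->
  fps_hom 2 f -> fps_hom 2 g -> fps_hom e (fgl_add F f g).
Proof.
move=> HF hf hg c; rewrite /fgl_add; apply: ghom_sum => i _; apply: ghom_sum => j _.
have -> : e - (2 * mdeg c)%:Z =
    (e - (2 * (i + j))%:Z) + (2 *+ i + 2 *+ j) - (2 * mdeg c)%:Z by lia.
apply: (scale_hom (HF i j)); apply: fps_homM; exact: fps_homX.
Qed.

Lemma fgl_quo_hom n (F : nat -> nat -> E) (f f' g : fps n E) :
  (forall i j, ghom (2 - (2 * (i + j))%:Z) (F i j)) ->
  fps_hom 2 f -> fps_hom 2 f' -> fps_hom 2 g -> fps_hom 0 (fgl_quo F f f' g).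
Proof.
move=> HF hf hf' hg c; rewrite /fgl_quo; apply: ghom_sum => i _; apply: ghom_sum => j _.
case: i => [[|i] ii] /=.
  rewrite /fps_scale big_ord0 mul0r mulr0; exact: (grading0 EP).
have -> : 0 - (2 * mdeg c)%:Z =
    (2 - (2 * (i.+1 + j))%:Z) + (2 *+ i + 2 *+ j) - (2 * mdeg c)%:Z by lia.
apply: (scale_hom (HF _ j)); apply: fps_homM; last exact: fps_homX.
apply: fps_hom_sum => l.
have -> : (2 : int) *+ i = 2 *+ (i - l) + 2 *+ l by rewrite -mulrnDr subnK // -ltnS ltn_ord.
by apply: fps_homM; exact: fps_homX.
Qed.

Lemma fps_shift_hom d (f : fps 1 E) : fps_hom d f -> fps_hom (d - 2) (fps_shift f).
Proof.
move=> df c; have := df (c + U_(ord0))%MM; rewrite /fps_shift mdegD mdeg1.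
by have -> // : d - (2 * (mdeg c + 1))%:Z = d - 2 - (2 * mdeg c)%:Z by lia.
Qed.

Lemma iter_shift_hom d i (f : fps 1 E) : fps_hom d f -> fps_hom (d - 2 *+ i) (iter i (@fps_shift E) f).
Proof.
move=> df; elim: i => [|i IH]; first by rewrite subr0.
by rewrite mulrSr opprD addrA; exact: fps_shift_hom.
Qed.

End GradedSeries.

(** * Power series over a graded polynomial ring *)

Section PolynomialSeries.
Variables (B : comNzRingType) (r w : nat) (wt : 'I_r -> int).
Hypothesis wt_neg : forall i, wt i < 0.
Variable q : B.
Hypothesis B_domain : forall a b : B, a * b = 0 -> a = 0 \/ b = 0.
Hypothesis B_principal : forall K : set B,
  is_ideal K ->
  exists b, forall x, K x <-> exists c, x = c * b.
Hypothesis B_local : forall b : B, (forall c, b <> c * q) -> exists c, c * b = 1.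
Hypothesis q_proper : forall c : B, 1 <> c * q.

Local Notation E := (gmpoly B wt).
Local Notation S := (gfps E w).
Let EP := ghomP E.
Let SP := ghomP S.

Definition ecoef (e : E) (a : 'X_{1..r}) : B := mcoeff a (e : {mpoly B[r]}).

Lemma ecoefD e f a : ecoef (e + f) a = ecoef e a + ecoef f a. Proof. exact: mcoeffD. Qed.
Lemma ecoefB e f a : ecoef (e - f) a = ecoef e a - ecoef f a. Proof. exact: mcoeffB. Qed.
Lemma ecoef0 a : ecoef 0 a = 0. Proof. exact: mcoeff0. Qed.
Lemma ecoef1 a : ecoef 1 a = (a == 0%MM)%:R. Proof. exact: mcoeff1. Qed.
Lemma ecoef_sum (T : Type) (s : seq T) (F : T -> E) a :
  ecoef (\sum_(i <- s) F i) a = \sum_(i <- s) ecoef (F i) a.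
Proof. by apply: (big_morph (fun e => ecoef e a)) => [x y|]; [exact: ecoefD|exact: ecoef0]. Qed.
Lemma ecoefP (e f : E) : (forall a, ecoef e a = ecoef f a) -> e = f.
Proof. by move=> H; apply/mpolyP. Qed.

Lemma ecoefM e f a : ecoef (e * f) a = \sum_(b <- mdivs a) ecoef e b * ecoef f (a - b)%MM.
Proof.
rewrite [LHS]/ecoef [LHS](@mcoeffM _ _ (e : {mpoly B[r]}) f a).
rewrite -(pair_big_dep xpredT (fun b d : 'X_{1..r < (mdeg a).+1} => a == (b + d)%MM)
  (fun b d => ecoef e b * ecoef f d)) /=.
rewrite big_filter big_map big_enum_cond /= [RHS]big_mkcond; apply: eq_bigr => b _.
case: ifP => ba; last first.
  rewrite big1 // => d /eqP ad; suff : (b <= a)%MM by rewrite ba.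
  by rewrite [X in (_ <= X)%MM]ad lem_addr.
have da : (mdeg (a - b) < (mdeg a).+1)%N by rewrite ltnS mdegB.
rewrite (big_pred1 (BMultinom da)) // => d /=.
apply/eqP/eqP => [ad|->]; last by rewrite /= addmC submK.
by apply: val_inj; rewrite /= [X in (X - _)%MM]ad addmC addmK.
Qed.

Definition ecoef_series (e : E) : fps r B := ecoef e.
Lemma ecoef_seriesM e f : ecoef_series (e * f) = ecoef_series e * ecoef_series f.
Proof. by apply: fpsP => a; rewrite /ecoef_series ecoefM. Qed.

Definition econst (b : B) : E := mpolyC r b.
Definition emono (a : 'X_{1..r}) : E := mpolyX B a.

Lemma ecoef_const b a : ecoef (econst b) a = if a == 0%MM then b else 0.
Proof. by rewrite /ecoef mcoeffC; case: eqP; rewrite ?mulr1 ?mulr0. Qed.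
Lemma ecoef_mono b a : ecoef (emono b) a = (a == b)%:R.
Proof. by rewrite /ecoef mcoeffX eq_sym. Qed.

Lemma ecoef_monoM b e a : ecoef (emono b * e) a = if (b <= a)%MM then ecoef e (a - b)%MM else 0.
Proof.
rewrite -[LHS]/(ecoef_series _ a) ecoef_seriesM.
have -> : ecoef_series (emono b) = fps_mono B b by apply: fpsP => c; exact: ecoef_mono.
by rewrite fps_monoM.
Qed.

Lemma ecoef_constM b e a : ecoef (econst b * e) a = b * ecoef e a.
Proof. exact: mcoeffCM. Qed.

Definition edeg (a : 'X_{1..r}) : int := 2 * \sum_(i < r) (a i)%:Z * wt i.

Lemma ehomP d (e : E) : ghom d e <-> forall a, ecoef e a != 0 -> d = edeg a.
Proof. by split=> H a; [rewrite -mcoeff_msupp; exact: H|rewrite mcoeff_msupp; exact: H]. Qed.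

Lemma edeg_le0 a : edeg a <= 0.
Proof.
rewrite /edeg; apply: Num.Theory.mulr_ge0_le0 => //; apply: Num.Theory.sumr_le0 => i _.
by apply: Num.Theory.mulr_ge0_le0 => //; exact: Order.POrderTheory.ltW (wt_neg i).
Qed.

Lemma edeg_eq0 a : edeg a = 0 -> a = 0%MM.
Proof.
move=> d0; apply/mnmP => i; rewrite mnm0E; apply/eqP/negPn/negP => ai.
move: d0; rewrite /edeg (bigD1 i) //=.
have le0 : \sum_(j < r | j != i) (a j)%:Z * wt j <= 0.
  apply: Num.Theory.sumr_le0 => j _.
  by apply: Num.Theory.mulr_ge0_le0 => //; exact: Order.POrderTheory.ltW (wt_neg j).
have lt0 : (a i)%:Z * wt i < 0 by have := wt_neg i; nia.
move: lt0 le0; set y := \sum_(j < r | _) _; set x := _%:Z * _; clearbody x y; lia.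
Qed.

Lemma edegMn a k : edeg (a *+ k) = edeg a *+ k.
Proof.
rewrite /edeg -mulrnAr -sumrMnl; congr (_ * _); apply: eq_bigr => i _.
by rewrite mulmnE PoszM -mulr_natr mulrAC natz.
Qed.

(** All the polynomial generators have negative degree. *)
Lemma ehom_pos d (e : E) : 0 < d -> ghom d e -> e = 0.
Proof.
move=> d0 /ehomP H; apply: ecoefP => a; rewrite ecoef0; apply/eqP/negP => /negP/H dE.
by have := edeg_le0 a; lia.
Qed.

Lemma ehom0 (e : E) : ghom 0 e -> e = econst (ecoef e 0%MM).
Proof.
move=> /ehomP H; apply: ecoefP => a; rewrite ecoef_const; case: eqP => [->//|a0].
by apply/eqP/negP => /negP/H/esym/edeg_eq0.
Qed.

Lemma econst_hom b : ghom 0 (econst b).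
Proof.
apply/ehomP => a; rewrite ecoef_const; case: (eqVneq a 0%MM) => [-> _|]; last by rewrite eqxx.
by rewrite /edeg big1 ?mulr0 // => i _; rewrite mnm0E mul0r.
Qed.

Lemma emono_hom a : ghom (edeg a) (emono a).
Proof. by apply/ehomP => b; rewrite ecoef_mono; case: (eqVneq b a) => [->|]; rewrite ?eqxx. Qed.

Lemma emonoX a i : emono a ^+ i = emono (a *+ i).
Proof. exact: mpolyXn. Qed.

Lemma edegU i : edeg U_(i) = 2 * wt i.
Proof.
rewrite /edeg (bigD1 i) //= mnm1E eqxx mul1r big1 ?addr0 // => j ji.
by rewrite mnm1E eq_sym (negPf ji) mul0r.
Qed.

Definition gfps_coefvar (i : 'I_r) : S := gfps_const w (emono U_(i)%MM).
Definition gfps_base (b : B) : S := gfps_const w (econst b).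

Lemma gfps_coefvar_hom i : ghom (2 * wt i) (gfps_coefvar i).
Proof. by apply: gfps_const_hom; rewrite -edegU; exact: emono_hom. Qed.

(** In a given degree only finitely many powers of [v_i] have nonzero coefficients,
    because the coefficient ring vanishes in positive degrees; so the coefficients of
    [sum a_k v_i^k] are finite sums. *)
Lemma gfps_coefvar_complete i : complete (gfps_coefvar i).
Proof.
set e := 2 * wt i; exists e; split; first exact: gfps_coefvar_hom.
  move=> z H; apply: gfps_val_inj; apply: fpsP => c; apply: ecoefP => a.
  have [d ->] := H (a i).+1.
  have -> : ecoef (gfps_val (0 : S) c) a = 0 by exact: ecoef0.
  rewrite /gfps_coefvar -gfps_constX gfps_const_mulE emonoX ecoef_monoM.
  by case: ifP => // /mnm_lepP/(_ i); rewrite mulmnE mnm1E eqxx mul1n ltnn.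
pose bnd (d : int) (c : 'X_{1..w}) : nat := (`|d| + 2 * mdeg c + 1)%N.
exists (fun (d : int) (a : nat -> S) => gfps_of (fun c =>
  \sum_(k < bnd d c) gfps_val (a k) c * emono U_(i)%MM ^+ k)).
have Hh d (a : nat -> S) : (forall k, ghom (d - e *+ k) (a k)) ->
    fps_hom d (fun c => \sum_(k < bnd d c) gfps_val (a k) c * emono U_(i)%MM ^+ k).
  move=> ha c; apply: ghom_sum => k _.
  have := ghom_val c (ha k) => hk.
  have := @emono_hom (U_(i) *+ k)%MM; rewrite -emonoX => hx.
  rewrite edegMn edegU -/e in hx; have := gradingM EP hk hx.
  by have -> : d - e *+ k - (2 * mdeg c)%:Z + e *+ k = d - (2 * mdeg c)%:Z by lia.
have van d (a : nat -> S) c k : (forall k, ghom (d - e *+ k) (a k)) ->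
    (bnd d c <= k)%N -> gfps_val (a k) c = 0.
  move=> ha bk; apply: (ehom_pos _ (ghom_val c (ha k))).
  have ek : e *+ k <= - (2 * k%:Z).
    rewrite -mulr_natr natz /e; have := wt_neg i; nia.
  by move: bk ek; rewrite /bnd; lia.
have wide d (a : nat -> S) c K : (forall k, ghom (d - e *+ k) (a k)) -> (bnd d c <= K)%N ->
    \sum_(k < bnd d c) gfps_val (a k) c * emono U_(i)%MM ^+ k =
    \sum_(k < K) gfps_val (a k) c * emono U_(i)%MM ^+ k.
  move=> ha bK; rewrite (big_ord_widen K (fun k => gfps_val (a k) c * emono U_(i)%MM ^+ k) bK).
  rewrite [RHS](bigID (fun k : 'I_K => (k < bnd d c)%N)) /= [X in _ + X]big1 ?addr0 //.
  by move=> k; rewrite -leqNgt => /(@van d a c k ha) ->; rewrite mul0r.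
move=> d a ha.
have ha' k : ghom (d - e - e *+ k) (a k.+1) by have := ha k.+1; rewrite mulrS opprD addrA.
split; first by apply: gfps_of_hom; exact: Hh.
apply: gfps_val_inj; rewrite gfps_valD gfps_valM (gfps_ofE (Hh _ _ ha)) (gfps_ofE (Hh _ _ ha')).
apply: fpsP => c; rewrite fps_addE [gfps_val (gfps_coefvar i)]/= fps_const_mul /fps_scale.
pose K := (bnd d c + bnd (d - e)%R c)%N.
rewrite (@wide d a c K.+1 ha); last by rewrite /K; lia.
rewrite (@wide (d - e) _ c K ha'); last by rewrite /K; lia.
rewrite big_ord_recl expr0 mulr1; congr (_ + _).
rewrite big_distrr; apply: eq_bigr => k _; rewrite /= /bump /= add1n exprS; ring.
Qed.

Definition const_coef (f : S) : B := ecoef (gfps_val f 0%MM) 0%MM.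

Local Notation xs := [seq gfps_var E i | i <- enum 'I_w].
Local Notation vs := [seq gfps_coefvar i | i <- enum 'I_r].
Local Notation T := (xs ++ vs).

Lemma gfps_constB e f : gfps_const w (e - f : E) = gfps_const w e - gfps_const w f.
Proof. by apply: (addIr (gfps_const w f)); rewrite -gfps_constD !subrK. Qed.

(** The constant term is a polynomial in the [v_i], whose nonconstant monomials are
    multiples of some [v_i]. *)
Lemma series_mod_all f : adjs [set 0] T (f - gfps_base (const_coef f)).
Proof.
have H0 := gideal_ideal (gideal0 S).
have HX : is_ideal (adjs [set 0] T) by exact: adjs_ideal.
have -> : f - gfps_base (const_coef f) =
    (f - gfps_const w (gfps_val f 0%MM)) + gfps_const w (gfps_val f 0%MM - econst (const_coef f)).
  by rewrite gfps_constB addrA subrK.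
apply: is_idealD => //.
  rewrite adjs_cat; apply: sub_adjs; exact: series_mod_vars.
set e := gfps_val f 0%MM.
have -> : e - econst (const_coef f) =
    \sum_(a <- [seq a <- msupp (e : {mpoly B[r]}) | a != 0%MM]) econst (ecoef e a) * emono a.
  apply: ecoefP => a; rewrite ecoefB ecoef_const ecoef_sum.
  rewrite (eq_bigr (fun b => ecoef e b * (a == b)%:R)); last first.
    by move=> b _; rewrite ecoef_constM ecoef_mono.
  set l := filter _ _; case: (eqVneq a 0%MM) => [->|a0].
    rewrite subrr big_seq big1 // => b; rewrite mem_filter => /andP[b0 _].
    by rewrite eq_sym (negPf b0) mulr0.
  rewrite subr0; have [al|al] := boolP (a \in l).
    rewrite (bigD1_seq a) ?filter_uniq ?msupp_uniq //= eqxx mulr1 big1 ?addr0 // => b ba.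
    by rewrite eq_sym (negPf ba) mulr0.
  rewrite big_seq big1 => [|b bl].
    by apply/eqP; move: al; rewrite mem_filter a0 /= -mcoeff_eq0.
  by case: eqP => [ab|]; [rewrite ab bl in al|rewrite mulr0].
rewrite gfps_const_sum; apply: is_ideal_sum => // a; rewrite mem_filter => /andP[a0 _].
rewrite gfps_constM; apply: is_idealM => //.
have [i ai] : exists i, a i != 0%N.
  apply: contrapT => H; move/eqP: a0; apply; apply/mnmP => i; rewrite mnm0E.
  by apply/eqP/negPn/negP => ai; apply: H; exists i.
have -> : emono a = emono (a - U_(i))%MM * emono U_(i)%MM.
  by rewrite -[LHS]/(mpolyX B a) -{1}(submK (_ : (U_(i) <= a)%MM)) ?lep1mP // mpolyXD.
rewrite gfps_constM; apply: is_idealM => //; apply: mem_adjs => //.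
by rewrite -/(gfps_coefvar i) mem_cat orbC map_f // mem_enum.
Qed.

Lemma gfps_baseD a b : gfps_base (a + b) = gfps_base a + gfps_base b.
Proof. by rewrite /gfps_base -gfps_constD; congr (gfps_const _ _); exact: rmorphD. Qed.
Lemma gfps_baseM a b : gfps_base (a * b) = gfps_base a * gfps_base b.
Proof. by rewrite /gfps_base -gfps_constM; congr (gfps_const _ _); exact: rmorphM. Qed.
Lemma gfps_base0 : gfps_base 0 = 0.
Proof. by rewrite /gfps_base -[RHS](gfps_const0 E w); congr (gfps_const _ _); exact: rmorph0. Qed.
Lemma gfps_base_hom b : ghom 0 (gfps_base b).
Proof. by apply: gfps_const_hom; exact: econst_hom. Qed.

Lemma gfps_gens_hom a : a \in T -> homogen a.
Proof.
rewrite mem_cat => /orP[|/mapP[i _ ->]]; first exact: gfps_vars_hom.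
by exists (2 * wt i); exact: gfps_coefvar_hom.
Qed.

(** All the variables are complete, and modulo all of them the ring is the principal
    ideal ring [B] in degree zero. *)
Theorem gfps_noeth : gnoetherian S.
Proof.
have H0 := gideal_ideal (gideal0 S).
apply: (@noeth_of_complete _ T).
  move=> t; rewrite mem_cat => /orP[] /mapP[i _ ->]; [exact: gfps_var_complete|exact: gfps_coefvar_complete].
move=> I HI TI; have HI' := gideal_ideal HI.
have [|b bP] := @B_principal [set b | I (gfps_base b)].
  split=> [|x y Ix Iy|a x Ix] /=; rewrite ?gfps_base0 ?gfps_baseD ?gfps_baseM.
  - exact: is_ideal0.
  - exact: is_idealD.
  - exact: is_idealM.
have Ib : I (gfps_base b) by apply/bP; exists 1; rewrite mul1r.
exists (T ++ [:: gfps_base b]).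
  by move=> a; rewrite mem_cat inE => /orP[/gfps_gens_hom//|/eqP ->]; exists 0; exact: gfps_base_hom.
rewrite adjs_cat /=; have HT := adjs_ideal T H0; apply/seteqP; split.
  move=> f If; have := series_mod_all f.
  set d := f - _ => Td.
  have /bP[c cE'] : I (gfps_base (const_coef f)).
    have -> : gfps_base (const_coef f) = f - d by rewrite /d opprB addrC subrK.
    by apply: (is_idealB HI') => //; exact: TI.
  by exists d, (gfps_base c); rewrite -gfps_baseM -cE' /d subrK.
exact: (adj_min HI' TI Ib).
Qed.

(** The series whose constant coefficient is not a unit. *)
Definition gfps_max : set S := [set f | exists c, const_coef f = c * q].

Lemma const_coefD f g : const_coef (f + g) = const_coef f + const_coef g.
Proof. by rewrite /const_coef gfps_valD fps_addE ecoefD. Qed.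

Lemma const_coefM f g : const_coef (f * g) = const_coef f * const_coef g.
Proof.
have mdivs0 n : mdivs (0%MM : 'X_{1..n}) = [:: 0%MM].
  apply: perm_small_eq => //; apply: uniq_perm => //; first exact: mdivs_uniq.
  move=> a; rewrite mem_mdivs inE; apply/idP/eqP => [|->]; last exact: lepm_refl.
  by move=> /mnm_lepP H; apply/mnmP => i; have := H i; rewrite mnm0E; lia.
by rewrite /const_coef gfps_valM fpsME mdivs0 big_seq1 subm0 ecoefM mdivs0 big_seq1 subm0.
Qed.

Lemma const_coef1 : const_coef 1 = 1.
Proof. by rewrite /const_coef gfps_val1 fps1E eqxx ecoef1 eqxx. Qed.

Lemma const_coef_base b : const_coef (gfps_base b) = b.
Proof. by rewrite /const_coef gfps_constE eqxx ecoef_const eqxx. Qed.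

Lemma gfps_max_ideal : is_ideal gfps_max.
Proof.
split.
- by exists 0; rewrite mul0r /const_coef ecoef0.
- by move=> f g [c fc] [d gd]; exists (c + d); rewrite const_coefD fc gd mulrDl.
- by move=> f g [c gc]; exists (const_coef f * c); rewrite const_coefM gc mulrA.
Qed.

Lemma const_coef_hom d f : ghom d f -> d != 0 -> const_coef f = 0.
Proof.
move=> df d0; have := ghom_val 0%MM df; rewrite mdeg0 subr0 => /ehomP H.
apply/eqP/negP => /negP/H dE; move/eqP: d0; apply; rewrite dE /edeg.
by rewrite big1 ?mulr0 // => i _; rewrite mnm0E mul0r.
Qed.

Lemma gfps_max_gideal : gideal gfps_max.
Proof.
apply: gidealI; first exact: gfps_max_ideal.
move=> f [c fc]; have [s [g [us gh g0 fE]]] := hom_dec f.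
exists s, g; split=> // d; have [->|d0] := eqVneq d 0; last first.
  by exists 0; rewrite (const_coef_hom (gh d) d0) mul0r.
suff E0 : const_coef f = const_coef (g 0) by exists c; rewrite -E0.
have c00_sum : const_coef f = \sum_(k <- s) const_coef (g k).
  by rewrite fE; apply: (big_morph const_coef const_coefD); rewrite /const_coef ecoef0.
rewrite c00_sum; have [s0|s0] := boolP (0 \in s).
  rewrite (bigD1_seq 0) //= big1 ?addr0 // => k k0; exact: const_coef_hom (gh k) k0.
rewrite (g0 0 s0) big_seq big1 => [|k ks]; first by rewrite /const_coef ecoef0.
by apply: (const_coef_hom (gh k)); apply: contraNneq s0 => <-.
Qed.

(** The inverse is the geometric series. *)
Lemma inverse_one_minus (n : S) : ghom 0 n -> gfps_val n 0%MM = 0 ->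
  exists g : S, (1 - n) * g = 1.
Proof.
move=> dn n0; have n1 := order_ge1 n0.
pose g : fps w E := fun c => \sum_(k < (mdeg c).+1) (gfps_val n ^+ k) c.
have hn k : fps_hom 0 (gfps_val n ^+ k).
  by have := fps_homX k (gfps_val_hom dn); rewrite mul0rn.
have hg : fps_hom 0 g by move=> c; apply: ghom_sum => k _; exact: hn.
have gE N : eq_below N g (\sum_(k < N) gfps_val n ^+ k).
  move=> c cN; rewrite fps_sumE /g (big_ord_widen N (fun k => (gfps_val n ^+ k) c) cN).
  rewrite [RHS](bigID (fun k : 'I_N => (k < (mdeg c).+1)%N)) /= [X in _ + X]big1 ?addr0 //.
  by move=> k; rewrite -leqNgt => ck; apply: order_geX.
exists (gfps_of g); apply: gfps_val_inj; rewrite gfps_valM gfps_valB (gfps_ofE hg) gfps_val1.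
apply: eq_below_all => N.
have H : eq_below N ((1 - gfps_val n) * g) ((1 - gfps_val n) * \sum_(k < N) gfps_val n ^+ k).
  exact: eq_belowM.
apply: (eq_below_trans H) => c cN.
have -> : (1 - gfps_val n) * \sum_(k < N) gfps_val n ^+ k = 1 - gfps_val n ^+ N.
  have := subrXX 1 (gfps_val n) N; rewrite expr1n => ->; congr (_ * _).
  by apply: eq_bigr => i _; rewrite expr1n mul1r.
by rewrite fps_addE fps_oppE (@order_geX _ _ N) // subr0.
Qed.

(** A homogeneous series with invertible constant coefficient has degree zero, so its
    constant term is that coefficient and [inverse_one_minus] applies. *)
Lemma gfps_max_largest I : gideal I -> ~ I 1 -> I `<=` gfps_max.
Proof.
move=> HI I1; have HI' := gideal_ideal HI.
apply: gideal_sub => //; first exact: gfps_max_ideal.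
move=> f [d df] If; apply: contrapT => nf; apply: I1.
have [c cf] : exists c, c * const_coef f = 1.
  by apply: B_local => c E; apply: nf; exists c.
have d0 : d = 0.
  apply/eqP/negPn/negP => d0; rewrite (const_coef_hom df d0) mulr0 in cf.
  by apply: (@q_proper 0); rewrite mul0r.
rewrite d0 in df.
pose n : S := 1 - gfps_base c * f.
have dn : ghom 0 n.
  apply: (gradingB SP); first exact: (grading1 SP).
  by rewrite -(addr0 (0 : int)); apply: (gradingM SP) => //; exact: gfps_base_hom.
have n0 : gfps_val n 0%MM = 0.
  have := ghom_val 0%MM dn; rewrite mdeg0 subr0 => /ehom0 ->.
  have -> : ecoef (gfps_val n 0%MM) 0%MM = const_coef 1 - const_coef (gfps_base c * f).
    by rewrite /n /const_coef gfps_valB fps_addE fps_oppE ecoefB.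
  by rewrite const_coef1 const_coefM const_coef_base cf subrr; exact: rmorph0.
have [g gE] := inverse_one_minus dn n0.
have -> : (1 : S) = (gfps_base c * g) * f by rewrite -gE /n; ring.
exact: is_idealM.
Qed.

Lemma gfps_local : noeth_local gfps_max.
Proof.
split; [exact: gfps_noeth|exact: gfps_max_gideal| |exact: gfps_max_largest].
by move=> [c]; rewrite const_coef1; exact: q_proper.
Qed.

Lemma gfps_max_gen : gfps_max = adjs [set 0] (gfps_base q :: vs ++ xs).
Proof.
have H0 := gideal_ideal (gideal0 S).
have HL := adjs_ideal (gfps_base q :: vs ++ xs) H0.
apply/seteqP; split.
  move=> f [c fc]; rewrite -(subrK (gfps_base (const_coef f)) f); apply: is_idealD => //.
    have := series_mod_all f; apply: adjs_min => //; first by move=> _ ->; exact: is_ideal0.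
    by move=> a; rewrite mem_cat => /orP[] aT; apply: mem_adjs => //; rewrite inE mem_cat aT !orbT.
  rewrite fc gfps_baseM; apply: is_idealM => //; apply: mem_adjs => //; exact: mem_head.
apply: adjs_min; [exact: gfps_max_ideal|by move=> _ ->; exact: is_ideal0 gfps_max_ideal|].
move=> a; rewrite inE mem_cat => /or3P[/eqP ->|/mapP[i _ ->]|/mapP[i _ ->]].
- by exists 1; rewrite const_coef_base mul1r.
- exists 0; rewrite mul0r /const_coef gfps_constE eqxx ecoef_mono eq_sym mnm1_eq0; by [].
- exists 0; rewrite mul0r /const_coef gfps_varE fps_varE /fps_mono eq_sym mnm1_eq0; exact: ecoef0.
Qed.

(** The ideal of the first [k] of the variables [x_0, ..., x_(w-1)], [v_0, ...,
    v_(r-1)], in this order. *)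
Definition var_prime (k : nat) : set S :=
  [set f | forall c a, face k c -> face (k - w) a -> ecoef (gfps_val f c) a = 0].

Definition to_series (f : S) : fps w (fps r B) := fun c => ecoef_series (gfps_val f c).

Lemma ecoef_seriesD e f : ecoef_series (e + f) = ecoef_series e + ecoef_series f.
Proof. by apply: fpsP => a; rewrite /ecoef_series ecoefD. Qed.

Lemma to_seriesM f g : to_series (f * g) = to_series f * to_series g.
Proof.
apply: fpsP => c; rewrite /to_series gfps_valM !fpsME.
have m0 : ecoef_series 0 = 0 by apply: fpsP => a; exact: ecoef0.
rewrite (big_morph ecoef_series ecoef_seriesD m0); apply: eq_bigr => a _; exact: ecoef_seriesM.
Qed.

Lemma var_primeE k : var_prime k =
  [set f | face_set k (@face_set B r (k - w) [set 0]) (to_series f)].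
Proof.
by apply/seteqP; split=> f H; [move=> c fc a fa|move=> c a fc fa]; exact: H.
Qed.

(** Regarded as a power series in the [x_i] and the [v_i] at once, an element of
    [var_prime k] vanishes on a face of exponents, and [face_prime] applies twice. *)
Lemma var_prime_gprime k : gprime (var_prime k).
Proof.
have B0 : prime_set [set (0 : B)].
  split=> //=.
    by split=> //= [x y -> ->|a x ->]; rewrite ?addr0 ?mulr0.
  by move=> B1; apply: (@q_proper 0); rewrite mul0r.
have [[P0 PD PM] P1 PP] := face_prime w k (face_prime r (k - w) B0).
have tD f g : to_series (f + g) = to_series f + to_series g.
  by apply: fpsP => c; rewrite /to_series gfps_valD !fps_addE ecoef_seriesD.
have t0 : to_series 0 = 0.
  by apply: fpsP => c; apply: fpsP => a; exact: ecoef0.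
have t1 : to_series 1 = 1.
  apply: fpsP => c; rewrite /to_series gfps_val1 !fps1E; apply: fpsP => a.
  by case: eqP => _; [exact: ecoef1|exact: ecoef0].
have idP : is_ideal (var_prime k).
  rewrite var_primeE; split=> [|f g|a f] /=.
  - by rewrite t0.
  - by rewrite tD; exact: PD.
  - by rewrite to_seriesM; exact: PM.
split.
- apply: gidealI => // f Pf; have [s [g [us gh g0 fE]]] := hom_dec f.
  exists s, g; split=> // d c a fc fa.
  have van e : e != edeg a + (2 * mdeg c)%:Z -> ecoef (gfps_val (g e) c) a = 0.
    move=> ne; have /ehomP H := ghom_val c (gh e).
    by apply/eqP/negPn/negP => /H E; move/eqP: ne; apply; rewrite -E subrK.
  have [dE|/van //] := eqVneq d (edeg a + (2 * mdeg c)%:Z).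
  have := Pf c a fc fa; rewrite fE gfps_val_sum fps_sumE ecoef_sum.
  have [ds|ds] := boolP (d \in s); last by rewrite (g0 _ ds) => _; exact: ecoef0.
  rewrite (bigD1_seq d) //= big1 ?addr0 // => e ed; apply: van; by rewrite -dE.
- by rewrite var_primeE /= t1.
- by move=> f g _ _; rewrite var_primeE /= to_seriesM; exact: PP.
Qed.

Lemma faceS n k (c : 'X_{1..n}) : face k.+1 c -> face k c.
Proof. by move=> fc l lk; apply: fc; exact: ltnW. Qed.

Lemma face0 n k : face k (0%MM : 'X_{1..n}).
Proof. by move=> l _; exact: mnm0E. Qed.

Lemma faceU n (i : 'I_n) : face i U_(i)%MM /\ ~ face i.+1 U_(i)%MM.
Proof.
split=> [l li|/(_ i (ltnSn i))]; last by rewrite mnm1E eqxx.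
by rewrite mnm1E; case: eqP => // E; move: li; rewrite -E ltnn.
Qed.

Lemma var_prime_chain : pchain var_prime (w + r).
Proof.
split=> k kwr; first exact: var_prime_gprime.
split.
  move=> f Pf c a fc fa; apply: Pf; first exact: faceS.
  by move=> l lk; apply: fa; apply: leq_trans lk (leq_sub2r _ (leqnSn k)).
have B1 : (1 : B) <> 0 by move=> E; apply: (@q_proper 0); rewrite mul0r.
move=> sub; have [kw|wk] := ltnP k w.
  pose i := Ordinal kw; have [fi nfi] := faceU i.
  have /sub/(_ U_(i)%MM 0%MM fi (@face0 _ _)) : var_prime k.+1 (gfps_var E i).
    move=> c a fc _; rewrite gfps_varE fps_varE /fps_mono; case: eqP => [E|_]; last exact: ecoef0.
    by case: nfi; rewrite -E.
  by rewrite gfps_varE fps_varE /fps_mono eqxx ecoef1 eqxx.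
have ir : (k - w < r)%N by lia.
pose i := Ordinal ir; have [fi nfi] := faceU i.
have /sub/(_ 0%MM U_(i)%MM (@face0 _ _) fi) : var_prime k.+1 (gfps_coefvar i).
  move=> c a fc fa; rewrite gfps_constE; case: ifP => _; last exact: ecoef0.
  rewrite ecoef_mono; case: eqP => // E; case: nfi; rewrite -E.
  by rewrite subSn in fa.
by rewrite gfps_constE eqxx ecoef_mono eqxx.
Qed.

Lemma size_gfps_vars : size xs = w. Proof. by rewrite size_map size_enum_ord. Qed.
Lemma size_gfps_coefvars : size vs = r. Proof. by rewrite size_map size_enum_ord. Qed.

(** If [q = 0] then [B] is a field, and the chain of the [var_prime k] ends at the
    maximal ideal. *)
Lemma gfps_params_field : q = 0 -> params gfps_max [set 0] (vs ++ xs).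
Proof.
move=> q0; have H0 := gideal_ideal (gideal0 S); split.
- exact: gideal0.
- by move=> a; rewrite mem_cat orbC -mem_cat; exact: gfps_gens_hom.
- rewrite gfps_max_gen /= (_ : gfps_base q = 0); last by rewrite q0 gfps_base0.
  by rewrite adj_in //; exact: is_ideal0.
- exists var_prime; last by move=> _ -> c a _ _; exact: ecoef0.
  rewrite size_cat size_gfps_coefvars size_gfps_vars addnC; exact: var_prime_chain.
Qed.

(** If [q] is not zero it is one more parameter, and the maximal ideal is one more
    prime at the top of the chain. *)
Lemma gfps_params_local : q <> 0 -> params gfps_max [set 0] (gfps_base q :: vs ++ xs).
Proof.
move=> q0; have H0 := gideal_ideal (gideal0 S); split.
- exact: gideal0.
- move=> a; rewrite inE mem_cat orbC [X in X || _]orbC -mem_cat => /orP[/gfps_gens_hom //|/eqP ->].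
  by exists 0; exact: gfps_base_hom.
- exact: gfps_max_gen.
rewrite /= size_cat size_gfps_coefvars size_gfps_vars addnC.
have [P1 P2] := var_prime_chain.
exists (fun k => if (k <= w + r)%N then var_prime k else gfps_max); last first.
  by move=> _ -> c a _ _; exact: ecoef0.
split=> k kwr.
  by case: ifP => [/P1 //|_]; exact: (M_prime gfps_local).
rewrite -ltnS kwr; case: ifP => kwr'; first exact: P2.
have -> : k = (w + r)%N by lia.
split.
  move=> f Pf; exists 0; rewrite mul0r; apply: Pf; exact: face0.
move=> sub; have : var_prime (w + r) (gfps_base q).
  by apply: sub; exists 1; rewrite const_coef_base mul1r.
by move=> /(_ 0%MM 0%MM (@face0 _ _) (@face0 _ _)); rewrite -[LHS]/(const_coef (gfps_base q)) const_coef_base.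
Qed.

End PolynomialSeries.

(** * The coefficient rings *)

Section BaseRings.
Variables (p : nat).
Hypothesis p_pr : prime p.

Lemma Zloc_natE k : Zloc_val (k%:R : Zloc p) = k%:R.
Proof. exact: (rmorph_nat (val : Zloc p -> rat)). Qed.

Lemma Zloc_valM (x y : Zloc p) : Zloc_val (x * y) = Zloc_val x * Zloc_val y.
Proof. exact: (rmorphM (val : Zloc p -> rat)). Qed.

Lemma Zloc_inj (x y : Zloc p) : Zloc_val x = Zloc_val y -> x = y.
Proof. exact: val_inj. Qed.

Lemma Zloc_frac (a b : int) : coprime p `|b|%N -> b != 0 ->
  exists x : Zloc p, Zloc_val x = a%:Q / b%:Q.
Proof. by move=> cb b0; exists (ZLoc (Zloc_predP a cb b0)). Qed.

(** The numerator is divided by its exact power of [p]. *)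
Lemma Zloc_factor (x : Zloc p) : x <> 0 -> exists (k : nat) (u u' : Zloc p),
  u * u' = 1 /\ x = u * p%:R ^+ k.
Proof.
move=> x0; pose N := numq (Zloc_val x); pose D := denq (Zloc_val x).
have N0 : N != 0.
  by rewrite numq_eq0; apply/eqP => x0'; apply: x0; apply: Zloc_inj; rewrite x0'.
have D0 : D != 0 := denq_neq0 _.
have xE : Zloc_val x = N%:Q / D%:Q by rewrite divq_num_den.
have cD : coprime p `|D|%N by exact: (valP x).
have Npos : (0 < `|N|)%N by rewrite absz_gt0.
have [m cm NE] := pfactor_coprime p_pr Npos.
set k := logn p `|N| in NE.
pose M : int := Num.sg N * m%:Z.
have M0 : M != 0.
  rewrite mulf_neq0 // ?Num.Theory.sgr_eq0 //; apply/eqP => -[m0].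
  by move: NE N0; rewrite m0 mul0n -absz_eq0 => ->.
have cM : coprime p `|M|%N.
  by rewrite /M abszM absz_sg N0 mul1n.
have [u uE] := Zloc_frac M cD D0; have [u' u'E] := Zloc_frac D cM M0.
have MQ : M%:Q != 0 by rewrite intr_eq0.
have DQ : D%:Q != 0 by rewrite intr_eq0.
exists k, u, u'; split; apply: Zloc_inj.
  by rewrite Zloc_valM uE u'E mulf_div [X in X / _]mulrC divff // mulf_neq0.
rewrite Zloc_valM uE xE -natrX Zloc_natE mulrAC; congr (_ / _).
rewrite -[_%:R]/((p ^ k)%N%:Z%:Q) -intrM; congr (_%:~R).
by rewrite /M -mulrA -PoszM -NE abszE -Num.Theory.numEsg.
Qed.

Lemma Zloc_domain (a b : Zloc p) : a * b = 0 -> a = 0 \/ b = 0.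
Proof.
move=> /(congr1 (fun z : Zloc p => Zloc_val z)); rewrite Zloc_valM => /eqP.
by rewrite mulf_eq0 => /orP[] /eqP E; [left|right]; apply: Zloc_inj; rewrite E.
Qed.

Lemma Zloc_local (b : Zloc p) : (forall c, b <> c * p%:R) -> exists c, c * b = 1.
Proof.
move=> nb; have b0 : b <> 0 by move=> b0; apply: (nb 0); rewrite mul0r.
have [[|k] [u [u' [uu' bE]]]] := Zloc_factor b0.
  by exists u'; rewrite bE expr0 mulr1 mulrC.
by case: (nb (u * p%:R ^+ k)); rewrite bE exprSr mulrA.
Qed.

Lemma Zloc_principal (K : set (Zloc p)) :
  is_ideal K ->
  exists b, forall x, K x <-> exists c, x = c * b.
Proof.
move=> [K0 KD KM].
have [[x [Kx x0]]|H] := pselect (exists x, K x /\ x <> 0); last first.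
  exists 0 => x; split=> [Kx|[c ->]]; last by rewrite mulr0.
  by exists 0; rewrite mulr0; apply: contrapT => x0; apply: H; exists x.
have pw y : K y -> y <> 0 -> exists (k : nat) (u : Zloc p), K (p%:R ^+ k) /\ y = u * p%:R ^+ k.
  move=> Ky /Zloc_factor[k [u [u' [uu' yE]]]]; exists k, u; split=> //.
  have -> : p%:R ^+ k = u' * y by rewrite yE mulrA [u' * u]mulrC uu' mul1r.
  exact: KM.
pose Q := [pred k : nat | `[< K (p%:R ^+ k) >]].
have exQ : exists k, Q k by have [k [u [Kk _]]] := pw _ Kx x0; exists k; apply/asboolP.
case: (ex_minnP exQ) => k /asboolP Kk mink.
exists (p%:R ^+ k) => y; split=> [Ky|[c ->]]; last exact: KM.
have [->|y0] := pselect (y = 0); first by exists 0; rewrite mul0r.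
have [j [u [Kj yE]]] := pw _ Ky y0.
have kj : (k <= j)%N by apply: mink; apply/asboolP.
by exists (u * p%:R ^+ (j - k)); rewrite -mulrA -exprD subnK.
Qed.

Lemma Zloc_proper (c : Zloc p) : 1 <> c * p%:R.
Proof.
move=> /(congr1 (fun z : Zloc p => Zloc_val z)); rewrite Zloc_valM Zloc_natE.
have -> : Zloc_val (1 : Zloc p) = 1 by [].
have cD : coprime p `|denq (Zloc_val c)|%N by exact: (valP c).
rewrite -{1}(divq_num_den (Zloc_val c)) => E.
have DQ : (denq (Zloc_val c))%:Q != 0 by rewrite intr_eq0 denq_neq0.
have : denq (Zloc_val c) = numq (Zloc_val c) * p%:Z.
  apply/eqP; rewrite -(eqr_int rat) intrM -[p%:Z%:~R]/(p%:R : rat); apply/eqP.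
    have -> : (denq (Zloc_val c))%:Q = (denq (Zloc_val c))%:Q *
      ((numq (Zloc_val c))%:Q / (denq (Zloc_val c))%:Q * p%:R) by rewrite -E mulr1.
  by rewrite mulrA [_ * (_ / _)]mulrC divfK.
move=> DE; move: cD; rewrite DE abszM coprimeMr => /andP[_].
by rewrite /coprime gcdnn => /eqP p1; move: p_pr; rewrite p1.
Qed.

Lemma Zloc_p_neq0 : (p%:R : Zloc p) <> 0.
Proof.
move=> /(congr1 (fun z : Zloc p => Zloc_val z)); rewrite Zloc_natE => /eqP.
by rewrite Num.Theory.pnatr_eq0 -leqn0 leqNgt prime_gt0.
Qed.

Lemma field_principal (B : fieldType) (K : set B) :
  is_ideal K ->
  exists b, forall x, K x <-> exists c, x = c * b.
Proof.
move=> [K0 KD KM]; have [[x [Kx x0]]|H] := pselect (exists x, K x /\ x <> 0); last first.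
  exists 0 => x; split=> [Kx|[c ->]]; last by rewrite mulr0.
  by exists 0; rewrite mulr0; apply: contrapT => x0; apply: H; exists x.
exists 1 => y; split=> [_|_]; first by exists y; rewrite mulr1.
by rewrite -[y](divfK (_ : x != 0)); [exact: KM|apply/eqP].
Qed.

Lemma Fp_p0 : (p%:R : 'F_p) = 0.
Proof. exact: pchar_Fp_0. Qed.

(** A discrete valuation ring with uniformiser [q], or a field with [q = 0]: both
    cases of the coefficient ring are treated alike. *)
Definition Ebase_spec (B : comNzRingType) (q : B) : Prop :=
  [/\ forall a b : B, a * b = 0 -> a = 0 \/ b = 0,
      forall K : set B,
       is_ideal K ->
       exists b, forall x, K x <-> exists c, x = c * b,
      forall b : B, (forall c, b <> c * q) -> exists c, c * b = 1
    & forall c : B, 1 <> c * q].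

Lemma EbaseP m : @Ebase_spec (Ebase p m) p%:R.
Proof.
case: m => [|m] /=.
  split; [exact: Zloc_domain|exact: Zloc_principal|exact: Zloc_local|exact: Zloc_proper].
have p0 := Fp_p0; split.
- by move=> a b /eqP; rewrite mulf_eq0 => /orP[] /eqP ->; [left|right].
- exact: (@field_principal 'F_p).
- move=> b nb; exists (b^-1); apply: mulVf; apply/eqP => b0; apply: (nb 0).
  by rewrite mul0r.
- by move=> c; rewrite p0 mulr0 => /eqP; rewrite oner_eq0.
Qed.

End BaseRings.

(** * The points of a formal group law *)

Section MapSeries.
Variables (R R' : comPzRingType) (h : {rmorphism R -> R'}) (F : nat -> nat -> R).

Definition fps_map n (f : fps n R) : fps n R' := fun c => h (f c).

Lemma fps_mapM n (f g : fps n R) : fps_map (f * g) = fps_map f * fps_map g.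
Proof.
apply: fpsP => c; rewrite /fps_map !fpsME rmorph_sum; apply: eq_bigr => a _.
exact: rmorphM.
Qed.

Lemma fps_map1 n : fps_map (1 : fps n R) = 1.
Proof. by apply: fpsP => c; rewrite /fps_map !fps1E rmorph_nat. Qed.

Lemma fps_map0 n : fps_map (0 : fps n R) = 0.
Proof. by apply: fpsP => c; exact: rmorph0. Qed.

Lemma fps_mapX n (f : fps n R) i : fps_map (f ^+ i) = fps_map f ^+ i.
Proof. by elim: i => [|i IH]; rewrite ?expr0 ?fps_map1 // !exprS fps_mapM IH. Qed.

Lemma fps_map_var n i : fps_map (fps_var R i) = fps_var R' i :> fps n R'.
Proof. by apply: fpsP => c; exact: rmorph_nat. Qed.

(** Base change of a formal group law is compatible with formal sums. *)
Lemma fps_map_fgl_add n (f g : fps n R) :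
  fps_map (fgl_add F f g) = fgl_add (fgl_map h F) (fps_map f) (fps_map g).
Proof.
apply: fpsP => c; rewrite /fps_map /fgl_add rmorph_sum; apply: eq_bigr => i _.
rewrite rmorph_sum; apply: eq_bigr => j _; rewrite rmorphM; congr (_ * _).
by rewrite -[LHS]/(fps_map _ c) fps_mapM !fps_mapX.
Qed.

Lemma fps_map_nmul n (f : fps n R) k :
  fps_map (fgl_nmul F k f) = fgl_nmul (fgl_map h F) k (fps_map f).
Proof. by elim: k => [|k IH]; [exact: fps_map0|rewrite /fgl_nmul !iterS fps_map_fgl_add; congr (fgl_add _ _ _)]. Qed.

Lemma is_fgl_map : is_fgl F -> is_fgl (fgl_map h F).
Proof.
move=> [/= H1 H2 H3]; split=> /=.
- by have := congr1 (@fps_map 1) H1; rewrite !fps_map_fgl_add !fps_map_var fps_map0.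
- by have := congr1 (@fps_map 2) H2; rewrite !fps_map_fgl_add !fps_map_var.
- by have := congr1 (@fps_map 3) H3; rewrite !fps_map_fgl_add !fps_map_var.
Qed.

Lemma ideal_gen_map (J : set R) (K : set R') x :
  is_ideal K ->
  (forall y, J y -> K (h y)) -> ideal_gen J x -> K (h x).
Proof.
move=> [K0 KD KM] JK [k [a [b [Jb ->]]]]; rewrite rmorph_sum.
by elim/big_ind: _ => // i _; rewrite rmorphM; apply: KM; exact: JK.
Qed.

End MapSeries.

Section Points.
Variables (E : gradedRing) (w : nat) (F : nat -> nat -> E).
Hypothesis HF : is_fgl F.
Hypothesis F_hom : forall i j, ghom (2 - (2 * (i + j))%:Z) (F i j).
Local Notation S := (gfps E w).
Implicit Types f g h : S.

(** Elements of degree 2 without constant term: the points of the formal group that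
    can be formed from the variables. *)
Definition fgl_point : set S := [set f | order_ge 1 (gfps_val f) /\ fps_hom 2 (gfps_val f)].
Definition point_add f g : S := gfps_of (fgl_add F (gfps_val f) (gfps_val g)).

Lemma point_addE f g : fgl_point f -> fgl_point g ->
  gfps_val (point_add f g) = fgl_add F (gfps_val f) (gfps_val g).
Proof. by move=> [_ hf] [_ hg]; apply: gfps_ofE; exact: fgl_add_hom hf hg. Qed.

Lemma fgl_point_add f g : fgl_point f -> fgl_point g -> fgl_point (point_add f g).
Proof.
move=> pf pg; rewrite /fgl_point /= point_addE //; have [f1 hf] := pf; have [g1 hg] := pg.
by split; [apply: fgl_add_order => //; exact: fgl00|exact: fgl_add_hom].
Qed.

Lemma fgl_point_homogen f : fgl_point f -> homogen f.
Proof. by move=> [_ hf]; exists 2. Qed.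

Lemma fgl_point0 : fgl_point 0. Proof. by split=> //; exact: fps_hom0. Qed.

Lemma fgl_point_var i : fgl_point (gfps_var E i).
Proof.
rewrite /fgl_point /= gfps_varE; split; last exact: fps_hom_var.
by apply: order_ge1; rewrite fps_varE /fps_mono eq_sym mnm1_eq0.
Qed.

Lemma point_addC f g : fgl_point f -> fgl_point g -> point_add f g = point_add g f.
Proof.
move=> pf pg; apply: gfps_val_inj; rewrite !point_addE //.
by apply: (fgl_addC HF); [case: pf|case: pg].
Qed.

Lemma point_addA f g h : fgl_point f -> fgl_point g -> fgl_point h ->
  point_add f (point_add g h) = point_add (point_add f g) h.
Proof.
move=> pf pg ph; have pgh := fgl_point_add pg ph; have pfg := fgl_point_add pf pg.
apply: gfps_val_inj; rewrite !point_addE //.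
by apply: (fgl_addA HF); [case: pf|case: pg|case: ph].
Qed.

Lemma point_add0 f : fgl_point f -> point_add f 0 = f.
Proof.
move=> pf; apply: gfps_val_inj; rewrite point_addE //; last exact: fgl_point0.
by apply: (fgl_add0 HF); case: pf.
Qed.

Lemma point_add_form f g : fgl_point f -> fgl_point g -> exists h, point_add f g = f + g + f * g * h.
Proof.
move=> pf pg; have [f1 hf] := pf; have [g1 hg] := pg.
have hh : fps_hom (-2) (fgl_add (fun i j => F i.+1 j.+1) (gfps_val f) (gfps_val g)).
  apply: fgl_add_hom => // i j; have := F_hom i.+1 j.+1.
  by have -> // : 2 - (2 * (i.+1 + j.+1))%:Z = -2 - (2 * (i + j))%:Z by lia.
exists (gfps_of (fgl_add (fun i j => F i.+1 j.+1) (gfps_val f) (gfps_val g))).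
apply: gfps_val_inj; rewrite point_addE // !gfps_valD !gfps_valM (gfps_ofE hh).
exact: fgl_add_form.
Qed.

Lemma point_add_sub f f' g : fgl_point f -> fgl_point f' -> fgl_point g ->
  exists h, point_add f g - point_add f' g = (f - f') * h.
Proof.
move=> pf pf' pg; have [f1 hf] := pf; have [f'1 hf'] := pf'; have [g1 hg] := pg.
have hh := fgl_quo_hom F_hom hf hf' hg.
exists (gfps_of (fgl_quo F (gfps_val f) (gfps_val f') (gfps_val g))).
apply: gfps_val_inj; rewrite gfps_valM !gfps_valB !point_addE // (gfps_ofE hh).
exact: fgl_add_sub.
Qed.

Lemma point_nmulE k f : fgl_point f -> fgl_point (iter k (point_add f) 0) /\
  gfps_val (iter k (point_add f) 0) = fgl_nmul F k (gfps_val f).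
Proof.
move=> pf; elim: k => [|k [IH1 IH2]]; first by split=> //; exact: fgl_point0.
by rewrite iterS; split; [exact: fgl_point_add|rewrite point_addE // IH2].
Qed.

Local Notation X := (fps_var E (ord0 : 'I_1)).
Local Notation coef k j := (fgl_nmul F k X (U_(ord0 : 'I_1) *+ j)%MM).

Let X1 : order_ge 1 X.
Proof. by apply: order_ge1; rewrite fps_varE /fps_mono eq_sym mnm1_eq0. Qed.

Lemma nmulX k : order_ge 1 (fgl_nmul F k X) /\ fps_hom 2 (fgl_nmul F k X).
Proof.
elim: k => [|k [IH1 IH2]]; first by split=> //; exact: fps_hom0.
rewrite /fgl_nmul iterS; split.
  by apply: fgl_add_order => //; exact: fgl00.
by apply: fgl_add_hom => //; exact: fps_hom_var.
Qed.

Lemma fgl_nmul_subst n (u : fps n E) k : order_ge 1 u ->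
  fgl_nmul F k u = subst (fun=> u) (fgl_nmul F k X).
Proof.
move=> u1; elim: k => [|k IH]; first by rewrite /fgl_nmul /= subst0.
rewrite /fgl_nmul !iterS -/(fgl_nmul F k u) -/(fgl_nmul F k X) IH subst_fgl_add //.
  by rewrite subst_var.
by case: (nmulX k).
Qed.

(** The series [[k](t)], expanded to order [i] and evaluated at the point [f]. *)
Lemma nmul_expand k i f : fgl_point f -> exists h,
  iter k (point_add f) 0 = \sum_(j < i) gfps_const w (coef k j) * f ^+ j + f ^+ i * h.
Proof.
move=> pf; have [f1 hf] := pf; have [_ hP] := nmulX k.
have hh : fps_hom (2 - 2 *+ i) (subst (fun=> gfps_val f) (iter i (@fps_shift E) (fgl_nmul F k X))).
  by apply: subst_hom => //; exact: iter_shift_hom.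
exists (gfps_of (subst (fun=> gfps_val f) (iter i (@fps_shift E) (fgl_nmul F k X)))).
apply: gfps_val_inj; rewrite (proj2 (point_nmulE k pf)) fgl_nmul_subst // (subst_shift _ i f1).
rewrite gfps_valD gfps_valM gfps_valX gfps_val_sum (gfps_ofE hh); congr (_ + _).
by apply: eq_bigr => j _; rewrite gfps_valM gfps_valX.
Qed.

End Points.

(** * The cohomology ring and its filtration *)

Lemma map_insub (T : Type) d (f : 'I_d -> T) (t0 : T) :
  [seq (if insub i is Some o then f o else t0) | i <- iota 0 d] = [seq f o | o <- enum 'I_d].
Proof. by rewrite -val_enum_ord -map_comp; apply: eq_map => o /=; rewrite valK. Qed.

Section Coefficients.
Variables (p m n : nat) (p_pr : prime p) (le_mn : (m <= n)%N).
Local Notation E := (Ering p m n).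
Local Notation w := (n.+1 - m)%N.
Local Notation r := (n.+1 - maxn m 1)%N.
Local Notation S := (gfps E w).

Definition vwt (i : 'I_r) : int := - (p ^ (maxn m 1 + i) - 1)%N%:Z.

Lemma vwt_neg i : vwt i < 0.
Proof.
have p1 := prime_gt1 p_pr; rewrite /vwt.
have := leq_ltn_trans (leq0n i) (ltn_ord i).
set d := (maxn m 1 + i)%N.
have : (0 < d)%N by rewrite /d; lia.
case: d => // d _ _; rewrite expnS.
have : (0 < p ^ d)%N by rewrite expn_gt0 prime_gt0.
nia.
Qed.

Definition Smax : set S := @gfps_max (Ebase p m) r w vwt p%:R.

Lemma Smax_local : noeth_local Smax.
Proof.
have [H1 H2 H3 H4] := EbaseP p_pr m.
exact: (gfps_local w vwt_neg H2 H3 H4).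
Qed.

Variable vE : nat -> E.
Hypothesis vE0 : vE 0%N = p%:R.
Hypothesis vE_low : forall l, (l < m)%N -> vE l = 0.
Hypothesis vE_gen : forall i : 'I_r, vE (maxn m 1 + i)%N = Egen p i.

(** The images of [v_m, ..., v_n], so that [vgen k] stands for [v_(m+k)]. *)
Definition vgen (k : nat) : S := gfps_const w (vE (m + k)%N).
Definition xgen (i : nat) : S := if insub i is Some o then gfps_var E o else 0.

Lemma xgenE : map xgen (iota 0 w) = [seq gfps_var E i | i <- enum 'I_w].
Proof. exact: map_insub. Qed.

(** For [m = 0] the first element of the list is [v_0 = p], the remaining ones are
    polynomial generators; for [m > 0] all are. *)
Lemma Smax_params : params Smax [set 0] (map vgen (iota 0 w) ++ map xgen (iota 0 w)).
Proof.
rewrite xgenE; have [H1 H2 H3 H4] := EbaseP p_pr m.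
have vgE : [seq gfps_const w (vE (maxn m 1 + k)%N) | k <- iota 0 r] =
    [seq @gfps_coefvar (Ebase p m) r w vwt i | i <- enum 'I_r].
  rewrite -val_enum_ord -map_comp; apply: eq_map => i /=; rewrite vE_gen //.
case: (posnP m) => m0.
  have q0 : (p%:R : Ebase p m) <> 0 by rewrite m0; exact: Zloc_p_neq0.
  suff -> : map vgen (iota 0 w) = @gfps_base (Ebase p m) r w vwt p%:R :: [seq @gfps_coefvar (Ebase p m) r w vwt i | i <- enum 'I_r].
    exact: (gfps_params_local w vwt_neg H1 H2 H3 H4 q0).
  have wr : w = r.+1 by lia.
  have -> : iota 0 w = 0%N :: map succn (iota 0 r) by rewrite wr /= (iotaDl 1 0).
  rewrite -vgE /= -map_comp; congr (_ :: _).
    rewrite /vgen; have -> : (m + 0)%N = 0%N by lia.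
    rewrite vE0 /gfps_base; congr (gfps_const _ _); apply/esym; exact: (rmorph_nat (@mpolyC r (Ebase p m))).
  apply: eq_map => k /=; rewrite /vgen; congr (gfps_const _ (vE _)); lia.
have q0 : (p%:R : Ebase p m) = 0 by case: (m) m0 => // m' _; exact: Fp_p0.
suff -> : map vgen (iota 0 w) = [seq @gfps_coefvar (Ebase p m) r w vwt i | i <- enum 'I_r].
  exact: (gfps_params_field w vwt H1 H4 q0).
have rw : r = w by lia.
rewrite -vgE rw; apply: eq_map => k; rewrite /vgen; congr (gfps_const _ (vE _)); lia.
Qed.

Variable F : nat -> nat -> E.
Hypothesis HF : is_fgl F.
Hypothesis F_hom : forall i j, ghom (2 - (2 * (i + j))%:Z) (F i j).
Local Notation coef j := (fgl_nmul F p (fps_var E (ord0 : 'I_1)) (U_(ord0 : 'I_1) *+ j)%MM).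
Hypothesis coefE : forall k j, (j <= p ^ k)%N ->
  ideal_gen [set vE i | i in [set i | (i < k)%N]]
    (coef j - (if j == (p ^ k)%N then vE k else 0)).

Local Notation fadd := (@point_add E w F).
Local Notation ps f := (iter p (fadd f) 0).

(** The elements [v_l] with [l < m] vanish in the coefficient ring. *)
Lemma coef_low j : (j < p ^ m)%N -> coef j = 0.
Proof.
move=> jm; have := coefE (ltnW jm); rewrite ltn_eqF // subr0.
move=> /(ideal_gen_map (h := idfun) (is_ideal_zero _)); apply.
by move=> _ [i im <-]; rewrite /= vE_low.
Qed.

Lemma ps_root f : fgl_point f -> exists h, ps f = f ^+ (p ^ m) * h.
Proof.
move=> pf; have [h ->] := nmul_expand HF F_hom p (p ^ m) pf.
by exists h; rewrite big1 ?add0r // => j _; rewrite coef_low // gfps_const0 mul0r.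
Qed.

(** The lower coefficients of the p-series lie in the ideal of [v_0, ..., v_(m+k-1)],
    of which those before [v_m] vanish. *)
Lemma ps_expand i k : (i < w)%N -> (k < w)%N -> exists c c' h,
  let Jk := adjs [set 0] (map vgen (iota 0 k)) in
  [/\ Jk c, Jk c' & ps (xgen i) = c + xgen i ^+ (p ^ (m + k)) * (vgen k + c' + xgen i * h)].
Proof.
move=> iw kw; pose Q := (p ^ (m + k))%N.
have xE : xgen i = gfps_var E (Ordinal iw) by rewrite /xgen insubT.
have px : fgl_point (xgen i) by rewrite xE; exact: fgl_point_var.
have [h hE] := nmul_expand HF F_hom p Q.+1 px.
have HJ : is_ideal (adjs [set 0] (map vgen (iota 0 k))).
  by apply: adjs_ideal; exact: gideal_ideal (gideal0 S).
have Jc x : ideal_gen [set vE i | i in [set i | (i < m + k)%N]] x ->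
    adjs [set 0] (map vgen (iota 0 k)) (gfps_const w x).
  move=> [l [a [b [bv ->]]]]; rewrite gfps_const_sum; apply: is_ideal_sum => // t _.
  rewrite gfps_constM; apply: is_idealM => //; have [j jk <-] := bv t.
  have [jm|mj] := ltnP j m; first by rewrite vE_low // gfps_const0; exact: is_ideal0.
  rewrite -(subnKC mj) -/(vgen _); apply: mem_adjs; first exact: gideal_ideal (gideal0 S).
  by rewrite map_f // mem_iota /= add0n; move: jk => /=; lia.
exists (\sum_(j < Q) gfps_const w (coef j) * xgen i ^+ j), (gfps_const w (coef Q - vE (m + k)%N)), h.
split.
- apply: is_ideal_sum => // j _; apply: is_idealMr => //; apply: Jc.
  by have := coefE (ltnW (ltn_ord j)); rewrite ltn_eqF // subr0.
- by apply: Jc; have := coefE (leqnn Q); rewrite eqxx.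
rewrite hE big_ord_recr -addrA; congr (_ + _).
have -> : gfps_const w (coef Q) = vgen k + gfps_const w (coef Q - vE (m + k)%N).
  by rewrite /vgen -gfps_constD addrC subrK.
by rewrite exprSr /=; ring.
Qed.

Lemma series_ring_filtered :
  filtered (fun D : set S => regular_local (gquot D) w)
    (adjs [set 0] (map (fun j => ps (xgen j)) (iota 0 w))).
Proof.
apply: (@tower_filtered S Smax p m w p_pr Smax_local xgen vgen (@fgl_point E w) fadd).
- exact: Smax_params.
- have -> : (p%:R : S) = @gfps_base (Ebase p m) r w vwt p%:R.
    rewrite -(gfps_const_nat E w) /gfps_base; congr (gfps_const _ _); apply/esym.
    exact: (rmorph_nat (@mpolyC r (Ebase p m))).
  by exists 1; rewrite const_coef_base mul1r.
- by move=> f [].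
- exact: fgl_point0.
- by move=> i iw; rewrite /xgen insubT; exact: fgl_point_var.
- exact: fgl_point_add.
- exact: point_addC.
- exact: point_addA.
- exact: point_add0.
- exact: point_add_form.
- exact: point_add_sub.
- exact: ps_root.
- exact: ps_expand.
Qed.

Lemma ps_xgen (i : 'I_w) : homogen (ps (xgen i)) /\
  gfps_val (ps (xgen i)) = fgl_nmul F p (fps_var E i).
Proof.
have -> : xgen i = gfps_var E i by rewrite /xgen valK.
have [h2 E2] := point_nmulE HF F_hom p (fgl_point_var E i); split; first exact (fgl_point_homogen h2).
by rewrite -gfps_varE; exact E2.
Qed.

Local Notation relations := [set f : S | exists i : 'I_w, gfps_val f = fgl_nmul F p (fps_var E i)].
Local Notation J := (adjs [set 0] (map (fun j => ps (xgen j)) (iota 0 w))).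

Lemma ps_gideal : gideal J.
Proof.
apply: gideal_adjs; first exact: gideal0.
move=> a /mapP[j + ->]; rewrite mem_iota => /andP[_ jw].
by have [] := ps_xgen (Ordinal (jw : (j < w)%N)).
Qed.

(** The relations [[p](x_i)] are homogeneous, so all of them are used as generators of
    the quotient. *)
Lemma relations_ideal : gqideal relations = J.
Proof.
have HJ := gideal_ideal ps_gideal; apply/seteqP; split.
  apply: ideal_gen_min => // f [[i iE] _]; have [_ E2] := ps_xgen i.
  have -> : f = ps (xgen i) by apply: gfps_val_inj; rewrite iE E2.
  apply: mem_adjs; first exact: gideal_ideal (gideal0 S).
  by apply/mapP; exists (i : nat); rewrite ?mem_iota ?ltn_ord.
apply: adjs_min; first exact: gideal_ideal (gideal_gen relations).
  by move=> _ ->; exact: ideal_gen0.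
move=> _ /mapP[j + ->]; rewrite mem_iota => /andP[_ jw].
have [h2 E2] := ps_xgen (Ordinal (jw : (j < w)%N)).
by apply: sub_ideal_gen; split=> //; exists (Ordinal (jw : (j < w)%N)).
Qed.

Lemma EBV_filtration : let A := EBV p w F in
  exists (N : nat) (I : nat -> set A),
    [/\ I 0%N = [set 0],
        I N = setT,
        (forall j, (j <= N)%N -> gideal (I j))
      & forall j, (j < N)%N ->
          I j `<=` I j.+1 /\
          exists R : gradedRing,
            regular_local R w /\ free_quotient R (I j.+1) (I j)].
Proof.
move=> A.
have QJ : gqideal relations `<=` J by rewrite relations_ideal.
have [N [I [I0 IN Ig If]]] := filtered_quotient ps_gideal QJ series_ring_filtered.
exists N, I; split=> //.
rewrite I0 -relations_ideal; apply/seteqP; split.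
  by move=> _ [x Qx <-] /=; apply/qpi_eq0.
by move=> _ ->; exists 0; [exact: ideal_gen0|exact: rmorph0].
Qed.

End Coefficients.

Theorem proposition5p14 (p m n : nat) (p_pr : prime p) (le_mn : (m <= n)%N)
    (MU : gradedRing) (F : nat -> nat -> MU) (MU_spec : is_MUp p F)
    (BP : gradedRing) (pi : {rmorphism MU -> BP}) (BP_spec : is_BP p F pi)
    (v : nat -> BP) (v_spec : is_vseq p (fgl_map pi F) v)
    (phi : {rmorphism BP -> Ering p m n}) (E_spec : is_BPmn v phi) :
  let w := (n.+1 - m)%N in
  let A := EBV p w (fgl_map phi (fgl_map pi F)) in
  exists (N : nat) (I : nat -> set A),
    [/\ I 0%N = [set 0],
        I N = setT,
        (forall j, (j <= N)%N -> gideal (I j))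
      & forall j, (j < N)%N ->
          I j `<=` I j.+1 /\
          exists R : gradedRing,
            regular_local R w /\ free_quotient R (I j.+1) (I j)].
Proof.
move=> w A.
have [_ F_fgl F_deg _] := MU_spec; have [pi_deg _ _ _] := BP_spec.
have [v0 v_deg v_coef] := v_spec; have [phi_deg _ phi_ker phi_gen] := E_spec.
set G := fgl_map phi (fgl_map pi F) in A *.
pose E := Ering p m n; pose S := gfps E w.
have HG : is_fgl G by do 2!apply: is_fgl_map.
have G_deg i j : ghom (2 - (2 * (i + j))%:Z) (G i j) by apply: phi_deg; exact: pi_deg.
pose vE k : E := phi (v k).
have vE0 : vE 0%N = p%:R by rewrite /vE v0 rmorph_nat.
have vE_low l : (l < m)%N -> vE l = 0.
  by move=> lm; apply/phi_ker; apply: sub_ideal_gen; exists l => //=; rewrite lm.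
have vE_coef k j : (j <= p ^ k)%N ->
    ideal_gen [set vE i | i in [set i | (i < k)%N]]
     (fgl_nmul G p (fps_var E (ord0 : 'I_1)) (U_(ord0 : 'I_1) *+ j)%MM
       - (if j == (p ^ k)%N then vE k else 0)).
  move=> jk.
  have gE : fgl_nmul G p (fps_var E (ord0 : 'I_1)) (U_(ord0 : 'I_1) *+ j)%MM =
      phi (fgl_nmul (fgl_map pi F) p (fps_var BP (ord0 : 'I_1)) [multinom j | _ < 1]).
    have -> : [multinom j | _ < 1] = (U_(ord0 : 'I_1) *+ j)%MM.
      by apply/mnmP => i; rewrite mnmE mulmnE mnm1E (ord1 i) eqxx mul1n.
    by rewrite -[RHS]/(fps_map phi _ _) fps_map_nmul fps_map_var.
  have -> : (if j == (p ^ k)%N then vE k else 0) = phi (if j == (p ^ k)%N then v k else 0).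
    by case: ifP => // _; rewrite rmorph0.
  rewrite gE -rmorphB; apply: (ideal_gen_map _ _ (v_coef k j jk)).
    exact: is_ideal_gen.
  by move=> _ [i ik <-]; apply: sub_ideal_gen; exists i.
exact: (EBV_filtration p_pr le_mn vE0 vE_low phi_gen HG G_deg vE_coef).
Qed.
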